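(* Let $(\varphi_{s,t})$ be an evolution family of some order $d\in[1,+\infty]$ and let $\beta:=\lim_{t\to+\infty}\frac{|\varphi_{0,t}'(0)|}{1-|\varphi_{0,t}(0)|^2}$. Then: (1) there is a unique standard Loewner chain $(f_t)$ associated with $(\varphi_{s,t})$; (2) if $\beta=0$, there is a unique normalized Loewner chain associated with $(\varphi_{s,t})$ (namely the standard one); (3) if $\beta>0$ and $(g_t)$ is a normalized Loewner chain associated with $(\varphi_{s,t})$, then there is $h\in\mathcal S$ such that $g_t(z)=h(\beta f_t(z))/\beta$ for all $t\ge0$, $z\in\mathbb D$, where $(f_t)$ is the unique standard Loewner chain associated with $(\varphi_{s,t})$.
   Context: $\mathbb D$ is the open unit disk; $\mathcal S$ is the class of univalent holomorphic $h:\mathbb D\to\mathbb C$ with $h(0)=h'(0)-1=0$. For $d\in[1,+\infty]$, an evolution family of order $d$ is a family $(\varphi_{s,t})_{0\le s\le t<+\infty}$ of holomorphic self-maps of $\mathbb D$ with $\varphi_{s,s}=\mathrm{id}_{\mathbb D}$, $\varphi_{s,t}=\varphi_{u,t}\circ\varphi_{s,u}$ for $0\le s\le u\le t$, and such that for every $z\in\mathbb D$, $T>0$ there is a non-negative $k_{z,T}\in L^d([0,T])$ with $|\varphi_{s,u}(z)-\varphi_{s,t}(z)|\le\int_u^tk_{z,T}$ for all $0\le s\le u\le t\le T$. A Loewner chain (of some order $d'\in[1,+\infty]$) is a family $(f_t)_{t\ge0}$ of univalent holomorphic maps $f_t:\mathbb D\to\mathbb C$ with $f_s(\mathbb D)\subset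 f_t(\mathbb D)$ for $s<t$ and such that for every compact $K\subset\mathbb D$ and $T>0$ there is a non-negative $k_{K,T}\in L^{d'}([0,T])$ with $|f_s(z)-f_t(z)|\le\int_s^tk_{K,T}$ for $z\in K$, $0\le s\le t\le T$. It is normalized if $f_0(0)=0$, $f_0'(0)=1$, and associated with $(\varphi_{s,t})$ if $f_t\circ\varphi_{s,t}=f_s$ for all $0\le s\le t$. A normalized Loewner chain $(f_t)$ associated with $(\varphi_{s,t})$ is standard if $\bigcup_{t\ge0}f_t(\mathbb D)=\{z:|z|<1/\beta\}$, interpreted as $\mathbb C$ when $\beta=0$. *)

(* Defs.v *)
(* Complex plane = (R[i])^o for R : realType
   (the regular normed module of the numeric field R[i] over itself), so that
   `derivable f z 1` is complex (holomorphic) differentiability. *)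
From HB Require Import structures.
From mathcomp Require Import all_boot all_order all_algebra.
From mathcomp Require Import complex.
From mathcomp Require Import all_classical all_reals all_analysis.
Import Order.TTheory GRing.Theory Num.Theory.
Import numFieldNormedType.Exports.

Set Implicit Arguments.
Unset Strict Implicit.
Unset Printing Implicit Defensive.

Local Open Scope classical_set_scope.
Local Open Scope ring_scope.

Section LoewnerDefs.
Context {R : realType}.
Local Notation C := ((R[i])^o).
Local Notation normc := (@ComplexField.Normc.normc R).

Definition disk : set C := [set z | normc z < 1].

Definition holo_on (D : set C) (f : C -> C) : Prop :=
  forall z, D z -> derivable f z 1.

Definition univalent_on (D : set C) (f : C -> C) : Prop :=
  holo_on D f /\ (forall z w, D z -> D w -> f z = f w -> z = w).

Definition class_S (h : C -> C) : Prop :=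
  univalent_on disk h /\ h 0 = 0 /\ 'D_1 h 0 = 1.

Definition Ld_on (d : \bar R) (a b : R) (k : R -> R) : Prop :=
  measurable_fun `[a, b] k /\
  ('N[lebesgue_measure]_d [EFin \o (k \_ `[a, b])] < +oo)%E.

Definition int_on (u t : R) (k : R -> R) : R :=
  Rintegral lebesgue_measure `[u, t] k.

(** evolution family of order d; phi s t only matters for 0 <= s <= t
    and on the disk *)
Definition evolution_family (d : \bar R) (phi : R -> R -> C -> C) : Prop :=
  (1 <= d)%E /\
  (forall s t, 0 <= s -> s <= t ->
     holo_on disk (phi s t) /\ (forall z, disk z -> disk (phi s t z))) /\
  (forall s z, 0 <= s -> disk z -> phi s s z = z) /\
  (forall s u t z, 0 <= s -> s <= u -> u <= t -> disk z ->
     phi s t z = phi u t (phi s u z)) /\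
  (forall z T, disk z -> 0 < T ->
     exists k : R -> R,
       (forall x, x \in `[0, T] -> 0 <= k x) /\ Ld_on d 0 T k /\
       (forall s u t, 0 <= s -> s <= u -> u <= t -> t <= T ->
          normc (phi s u z - phi s t z) <= int_on u t k)).

Definition loewner_chain_of_order (d' : \bar R) (f : R -> C -> C) : Prop :=
  (1 <= d')%E /\
  (forall t, 0 <= t -> univalent_on disk (f t)) /\
  (forall s t, 0 <= s -> s < t -> f s @` disk `<=` f t @` disk) /\
  (forall (K : set C) (T : R), compact K -> K `<=` disk -> 0 < T ->
     exists k : R -> R,
       (forall x, x \in `[0, T] -> 0 <= k x) /\ Ld_on d' 0 T k /\
       (forall s t z, 0 <= s -> s <= t -> t <= T -> K z ->
          normc (f s z - f t z) <= int_on s t k)).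

Definition loewner_chain (f : R -> C -> C) : Prop :=
  exists d' : \bar R, loewner_chain_of_order d' f.

Definition normalized (f : R -> C -> C) : Prop :=
  f 0 0 = 0 /\ 'D_1 (f 0) 0 = 1.

Definition associated (f : R -> C -> C) (phi : R -> R -> C -> C) : Prop :=
  forall s t z, 0 <= s -> s <= t -> disk z -> f t (phi s t z) = f s z.

Definition nlc_assoc (phi : R -> R -> C -> C) (f : R -> C -> C) : Prop :=
  loewner_chain f /\ normalized f /\ associated f phi.

Definition range_disk (beta : R) : set C :=
  if beta == 0 then setT else [set z | normc z < beta^-1].

Definition standard (beta : R) (phi : R -> R -> C -> C) (f : R -> C -> C) : Prop :=
  nlc_assoc phi f /\
  \bigcup_(t in [set t : R | 0 <= t]) (f t @` disk) = range_disk beta.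

Definition beta_ratio (phi : R -> R -> C -> C) (t : R) : R :=
  normc ('D_1 (phi 0 t) 0) / (1 - normc (phi 0 t 0) ^+ 2).

Definition eq_chain (f g : R -> C -> C) : Prop :=
  forall t z, 0 <= t -> disk z -> f t z = g t z.

End LoewnerDefs.

(* Main.v *)
(* Composing with disk automorphisms that carry the orbit of 0 to 0 turns the
   evolution family into self-maps psi s t fixing 0, with lam s t = psi s t '(0);
   then |lam 0 t| decreases to beta. Cutting [s, t] into short steps, on which
   |lam| is close to 1, the Schwarz-Pick lemma gives injectivity of psi s t and
   the growth bound |psi| / (1 - |psi|)^3 <= |lam| |z| / (1 - |z|)^3. Hence
   psi s t / lam s t = z + O((1 - |lam s t|) |z|^2) locally uniformly, so
   psi s t / lam 0 t is Cauchy as t tends to infinity; its limit f s satisfies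
   f t o psi s t = f s. Since lam 0 s * f s is close to the identity for large s
   (on a small disk if beta = 0, on every compact subset if beta > 0), f s is
   injective and the images exhaust the disk of radius 1 / beta.
   Any other chain is h o f with h univalent on that disk: h is the identity by
   Schwarz if both chains are standard, and because an entire injective map is
   affine if beta = 0.
   The complex analysis needed rests on a maximum principle. It is proved for
   merely differentiable functions from Goursat's subdivision argument, applied
   to trapezoidal sums instead of contour integrals. *)

Require Import Defs.
From HB Require Import structures.
From mathcomp Require Import all_boot all_order all_algebra.
From mathcomp Require Import complex.
From mathcomp Require Import all_classical all_reals all_analysis.
From mathcomp Require Import measurable_realfun ess_sup_inf.
From mathcomp Require Import ring lra.
Import Order.TTheory GRing.Theory Num.Theory.
Import numFieldNormedType.Exports.
Set Implicit Arguments.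
Unset Strict Implicit.
Unset Printing Implicit Defensive.
Local Open Scope classical_set_scope.
Local Open Scope ring_scope.

(** * Modulus and complex differentiability *)

(** The bounds in the definition of an evolution family concern one point at a time, whereas a
    Loewner chain needs bounds uniform on compact sets. The bridge is a two-point rigidity of
    self-maps of the disk: if 0 and 1/2 are moved little, so is every point of a given compact
    subset. Hence the two functions [k] at 0 and at 1/2 control everything: they give the chain its
    bound, of order one because every order is integrable on a segment, and they show that |lam s t|
    is close to 1 uniformly for short steps in [0, T].

    Injectivity of a limit is usually drawn from Hurwitz's theorem. Here lower Lipschitz bounds
    replace the counting of zeros: they survive composition, and they also supply the nonzero
    derivatives and Lipschitz inverses needed to compare two chains. Likewise, Cauchy's estimates
    for f' and f'' appear as bounds on first and second divided differences, which follow from the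
    maximum principle alone once bounded isolated singularities are allowed in it. *)

Local Notation nc := ComplexField.Normc.normc.

(* The cost of lra grows with the number of inequalities in the context, so
   those it needs are first moved to the goal and the others dropped. *)
Ltac drop_ineqs := repeat match goal with H : is_true _ |- _ => clear H end.

Section Modulus.
Context {R : realType}.
Local Notation C := R[i].
Implicit Types (x y : R) (z w a b : C).

Lemma nc_ge0 z : 0 <= nc z.
Proof. by case: z => x y; rewrite /nc sqrtr_ge0. Qed.

Lemma nc0 : nc (0 : C) = 0.
Proof. exact: ComplexField.Normc.normc0. Qed.

Lemma nc1 : nc (1 : C) = 1.
Proof. exact: ComplexField.Normc.normc1. Qed.

Lemma ncM z w : nc (z * w) = nc z * nc w.
Proof. exact: ComplexField.Normc.normcM. Qed.

Lemma ncV z : nc z^-1 = (nc z)^-1.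
Proof. exact: ComplexField.Normc.normcV. Qed.

Lemma ncX z n : nc (z ^+ n) = nc z ^+ n.
Proof. by elim: n => [|n IH]; rewrite ?expr0 ?nc1// !exprS ncM IH. Qed.

Lemma ncN z : nc (- z) = nc z.
Proof. exact: normcN. Qed.

Lemma ncD z w : nc (z + w) <= nc z + nc w.
Proof. exact: le_normcD. Qed.

Lemma ncB z w : nc (z - w) <= nc z + nc w.
Proof. by rewrite -(ncN w); exact: ncD. Qed.

Lemma ncC z w : nc (z - w) = nc (w - z).
Proof. by rewrite -ncN opprB. Qed.

Lemma ncBge z w : nc z - nc w <= nc (z - w).
Proof. by rewrite lerBlDr (le_trans _ (ncD _ _))// subrK. Qed.

Lemma ncB3 a z w : nc (z - w) <= nc (z - a) + nc (a - w).
Proof. by rewrite (le_trans _ (ncD _ _))// subrKA. Qed.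

Lemma nc_eq0 z : (nc z == 0) = (z == 0).
Proof.
apply/eqP/eqP => [|->]; first exact: ComplexField.Normc.eq0_normc.
exact: nc0.
Qed.

Lemma nc_gt0 z : (0 < nc z) = (z != 0).
Proof. by rewrite lt_neqAle nc_ge0 andbT eq_sym nc_eq0. Qed.

Lemma nc_real x : nc x%:C%C = `|x|.
Proof. by rewrite /nc /= expr0n /= addr0 sqrtr_sqr. Qed.

Lemma nc_nat n : nc (n%:R : C) = n%:R.
Proof. by rewrite -(rmorph_nat (real_complex R)) nc_real normr_nat. Qed.

Lemma nc_le_ReIm z : nc z <= `|complex.Re z| + `|complex.Im z|.
Proof.
rewrite {1}[z]complexE (le_trans (ncD _ _))// ncM !nc_real.
rewrite [nc 'i%C]/nc expr0n expr1n add0r sqrtr1 mul1r.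
exact: lexx.
Qed.

Lemma nc_ge_Re z : `|complex.Re z| <= nc z.
Proof.
case: z => x y; rewrite /nc /= -sqrtr_sqr ler_sqrt ?lerDl ?sqr_ge0//.
by rewrite addr_ge0 ?sqr_ge0.
Qed.

Lemma nc_ge_Im z : `|complex.Im z| <= nc z.
Proof.
case: z => x y; rewrite /nc /= -sqrtr_sqr ler_sqrt ?lerDr ?sqr_ge0//.
by rewrite addr_ge0 ?sqr_ge0.
Qed.

Lemma nc_conj z : nc z^*%C = nc z.
Proof. by case: z => x y; rewrite /nc /= sqrrN. Qed.

Lemma nc_sqrE z : nc z ^+ 2 = complex.Re z ^+ 2 + complex.Im z ^+ 2.
Proof. by case: z => x y; rewrite /nc /= sqr_sqrtr ?addr_ge0 ?sqr_ge0. Qed.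

Lemma nc_sqr z : (nc z ^+ 2)%:C%C = z * z^*%C.
Proof.
rewrite nc_sqrE; case: z => x y; apply/eqP; rewrite eq_complex /=.
by apply/andP; split; apply/eqP; ring.
Qed.

Lemma conjcM z w : (z * w)^*%C = z^*%C * w^*%C.
Proof. exact: (rmorphM (@conjc R)). Qed.

Lemma nc_unitP z : nc z < 1 -> forall w, nc w <= 1 -> 1 - z^*%C * w != 0.
Proof.
move=> z1 w w1; rewrite subr_eq0; apply/eqP => H.
have : nc (z^*%C * w) < 1.
  by rewrite ncM nc_conj (le_lt_trans _ z1)// ler_piMr// nc_ge0.
by rewrite -H nc1 ltxx.
Qed.

Lemma mobius_identity z w :
  nc (1 - z^*%C * w) ^+ 2 - nc (w - z) ^+ 2 = (1 - nc z ^+ 2) * (1 - nc w ^+ 2).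
Proof.
rewrite !nc_sqrE; case: z w => [x y] [u v] /=; ring.
Qed.

End Modulus.

Section Differentiability.
Context {R : realType}.
Local Notation C := R[i].
Implicit Types (f g q : C -> C) (z w a b l : C).

Definition ccont f a := forall e : R, 0 < e ->
  exists2 d : R, 0 < d & forall z, nc (z - a) < d -> nc (f z - f a) < e.

(** Carathéodory's form of the derivative: [q] is the difference quotient, extended continuously at
    [a]. The differentiation rules become algebra, and for f 0 = 0 the same [q] is the quotient f z
    / z of Schwarz's lemma. *)
Definition cder f a l := exists q,
  [/\ ccont q a, q a = l & forall z, f z - f a = q z * (z - a)].

Definition cdiff f a := exists l, cder f a l.

Lemma ccont_cst c a : ccont (fun=> c) a.
Proof. by move=> e e0; exists 1 => // z _; rewrite subrr nc0. Qed.

Lemma ccont_id a : ccont id a.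
Proof. by move=> e e0; exists e. Qed.

Lemma ccontD f g a : ccont f a -> ccont g a -> ccont (fun z => f z + g z) a.
Proof.
move=> cf cg e e0; have e2 : 0 < e / 2 by lra.
have [d d0 H] := cf _ e2; have [d' d'0 H'] := cg _ e2.
exists (Num.min d d'); first by rewrite lt_min d0.
move=> z; rewrite lt_min => /andP[/H Hz /H' Hz'].
rewrite opprD addrACA (le_lt_trans (ncD _ _))//; lra.
Qed.

Lemma ccontN f a : ccont f a -> ccont (fun z => - f z) a.
Proof.
move=> cf e /cf [d d0 H]; exists d => // z /H.
by rewrite -opprD ncN.
Qed.

Lemma ccontB f g a : ccont f a -> ccont g a -> ccont (fun z => f z - g z) a.
Proof. by move=> cf cg; apply: ccontD => //; exact: ccontN. Qed.

Lemma ccontM f g a : ccont f a -> ccont g a -> ccont (fun z => f z * g z) a.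
Proof.
move=> cf cg e e0.
pose A := nc (f a) + nc (g a) + 1.
have A1 : 1 <= A by rewrite /A lerDr addr_ge0 ?nc_ge0.
have e2 : 0 < Num.min 1 (e / (2 * A)).
  by rewrite lt_min ltr01 divr_gt0// mulr_gt0//; lra.
have [d d0 H] := cf _ e2; have [d' d'0 H'] := cg _ e2.
exists (Num.min d d'); first by rewrite lt_min d0.
move=> z; rewrite lt_min => /andP[/H + /H'].
rewrite !lt_min => /andP[f1 fe] /andP[g1 ge].
have -> : f z * g z - f a * g a = (f z - f a) * (g z - g a) +
  ((f z - f a) * g a + f a * (g z - g a)) by ring.
have h1 := ncD ((f z - f a) * (g z - g a)) ((f z - f a) * g a + f a * (g z - g a)).
have h2 := ncD ((f z - f a) * g a) (f a * (g z - g a)).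
rewrite !ncM in h1 h2.
have := nc_ge0 (f z - f a); have := nc_ge0 (g z - g a).
have := nc_ge0 (f a); have := nc_ge0 (g a).
set u := nc (f z - f a) in f1 fe h1 h2 *; set v := nc (g z - g a) in g1 ge h1 h2 *.
move=> ga fa v0 u0.
have eA : e / (2 * A) * A = e / 2 by field; lra.
set q := e / (2 * A) in fe ge eA.
have q0 : 0 < q by rewrite /q divr_gt0// mulr_gt0//; lra.
apply: (le_lt_trans (le_trans h1 (lerD (lexx _) h2))).
have : u * v <= q by nra.
have : u * nc (g a) <= q * nc (g a) by nra.
have : nc (f a) * v <= q * nc (f a) by nra.
have : q * (nc (f a) + nc (g a) + 1) = e / 2 by rewrite -eA mulrC.
nra.
Qed.

Lemma ccontV f a : f a != 0 -> ccont f a -> ccont (fun z => (f z)^-1) a.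
Proof.
move=> fa0 cf e e0; have := fa0; rewrite -nc_gt0 => F0.
set F := nc (f a) in F0.
have e2 : 0 < Num.min (F / 2) (e * F ^+ 2 / 2).
  by rewrite lt_min !divr_gt0// mulr_gt0// exprn_gt0.
have [d d0 H] := cf _ e2; exists d => // z /H; rewrite lt_min => /andP[h1 h2].
have hz : F / 2 < nc (f z).
  by have := ncBge (f a) (f z); rewrite ncC -/F; lra.
have fz0 : f z != 0 by rewrite -nc_gt0; lra.
have -> : (f z)^-1 - (f a)^-1 = (f a - f z) / (f z * f a) by field; rewrite fz0 fa0.
rewrite ncM ncV ncM -/F ncC ltr_pdivrMr ?mulr_gt0//; last by lra.
apply: (lt_le_trans h2).
have : e * F * (F / 2) <= e * F * nc (f z).
  by rewrite ler_pM2l ?mulr_gt0// ltW.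
nra.
Qed.

Lemma ccont_comp f g a : ccont f a -> ccont g (f a) -> ccont (fun z => g (f z)) a.
Proof.
move=> cf cg e /cg [d d0 H]; have [d' d'0 H'] := cf _ d0.
by exists d' => // z /H'/H.
Qed.

Lemma eq_ccont f g a : (exists2 d : R, 0 < d & forall z, nc (z - a) < d -> f z = g z) ->
  ccont f a -> ccont g a.
Proof.
move=> [d d0 fg] cf e /cf [d' d'0 H].
exists (Num.min d d'); first by rewrite lt_min d0.
move=> z; rewrite lt_min => /andP[/fg <- /H].
by rewrite (fg a)// subrr nc0.
Qed.

Lemma cder_cont f a l : cder f a l -> ccont f a.
Proof.
move=> [q [cq qa fq]].
have : ccont (fun z => f a + q z * (z - a)) a.
  apply: ccontD; first exact: ccont_cst.
  apply: ccontM => //; apply: ccontB; [exact: ccont_id|exact: ccont_cst].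
apply: eq_ccont; exists 1 => // z _; rewrite -fq; ring.
Qed.

Lemma cdiff_cont f a : cdiff f a -> ccont f a.
Proof. by move=> [l /cder_cont]. Qed.

Lemma cderP f a l : cder f a l <->
  forall e : R, 0 < e -> exists2 d : R, 0 < d &
    forall z, nc (z - a) < d -> nc (f z - f a - l * (z - a)) <= e * nc (z - a).
Proof.
split=> [[q [cq qa fq]] e e0|H].
  have [d d0 H] := cq _ e0; exists d => // z /H.
  rewrite fq -mulrBl ncM qa => h; apply: ler_wpM2r (ltW h); exact: nc_ge0.
exists (fun z => if z == a then l else (f z - f a) / (z - a)); split.
- move=> e e0; have e2 : 0 < e / 2 by lra.
  have [d d0 {}H] := H _ e2; exists d => // z /H; rewrite eqxx.
  case: eqP => [_ _|/eqP za h]; first by rewrite subrr nc0.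
  have za0 : z - a != 0 by rewrite subr_eq0.
  have -> : (f z - f a) / (z - a) - l = (f z - f a - l * (z - a)) / (z - a).
    by field.
  have n0 : 0 < nc (z - a) by rewrite nc_gt0.
  rewrite ncM ncV ltr_pdivrMr// (le_lt_trans h)// ltr_pM2r//; lra.
- by rewrite eqxx.
- move=> z; case: eqP => [->|/eqP za]; first by rewrite !subrr mulr0.
  by rewrite divfK// subr_eq0.
Qed.

Lemma eq_cder f g a l : (exists2 d : R, 0 < d & forall z, nc (z - a) < d -> f z = g z) ->
  cder f a l -> cder g a l.
Proof.
move=> [d d0 fg] /cderP cf; apply/cderP => e /cf [d' d'0 H].
exists (Num.min d d'); first by rewrite lt_min d0.
move=> z; rewrite lt_min => /andP[/fg <- /H].
by rewrite (fg a)// subrr nc0.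
Qed.

Lemma eq_cdiff f g a : (exists2 d : R, 0 < d & forall z, nc (z - a) < d -> f z = g z) ->
  cdiff f a -> cdiff g a.
Proof. by move=> fg [l cf]; exists l; exact: eq_cder cf. Qed.

Lemma cder_cst c a : cder (fun=> c) a 0.
Proof.
by exists (fun=> 0); split=> [||z]; rewrite ?subrr ?mul0r//; exact: ccont_cst.
Qed.

Lemma cder_id a : cder id a 1.
Proof. by exists (fun=> 1); split=> [||z]; rewrite ?mul1r//; exact: ccont_cst. Qed.

Lemma cderD f g a l m : cder f a l -> cder g a m -> cder (fun z => f z + g z) a (l + m).
Proof.
move=> [q [cq <- fq]] [p [cp <- gp]]; exists (fun z => q z + p z); split=> //.
- exact: ccontD.
- by move=> z; rewrite mulrDl -fq -gp opprD addrACA.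
Qed.

Lemma cderN f a l : cder f a l -> cder (fun z => - f z) a (- l).
Proof.
move=> [q [cq <- fq]]; exists (fun z => - q z); split=> //.
- exact: ccontN.
- by move=> z; rewrite mulNr -fq opprD.
Qed.

Lemma cderM f g a l m : cder f a l -> cder g a m ->
  cder (fun z => f z * g z) a (l * g a + f a * m).
Proof.
move=> cf [p [cp <- gp]]; have cf' := cder_cont cf; move: cf => [q [cq <- fq]].
exists (fun z => q z * g a + f z * p z); split=> //.
  apply: ccontD; apply: ccontM => //; exact: ccont_cst.
move=> z.
have -> : (q z * g a + f z * p z) * (z - a) =
  q z * (z - a) * g a + f z * (p z * (z - a)) by ring.
rewrite -fq -gp; ring.
Qed.

Lemma cderV f a l : f a != 0 -> cder f a l ->
  cder (fun z => (f z)^-1) a (- l / f a ^+ 2).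
Proof.
move=> fa0 cf; have cf' := cder_cont cf; move: cf => [q [cq <- fq]].
have F0 : 0 < nc (f a) by rewrite nc_gt0.
have [d d0 H] := cf' _ F0.
have nz z : nc (z - a) < d -> f z != 0.
  by move=> /H; apply: contraTneq => ->; rewrite sub0r ncN ltxx.
(* The factorisation must hold at every [z], also at zeros of [f] far from [a]; there the inverse is
   replaced by a value that satisfies it trivially. *)
apply: (@eq_cder (fun z => if f z == 0 then (f a)^-1 - q z / (f a) ^+ 2 * (z - a)
  else (f z)^-1)).
  by exists d => // z /nz /negbTE ->.
exists (fun z => if f z == 0 then - q z / (f a) ^+ 2 else - q z / (f z * f a)); split.
- apply: (@eq_ccont (fun z => - q z / (f z * f a))).
    by exists d => // z /nz /negbTE ->.
  apply: ccontM; first exact: ccontN.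
  apply: ccontV; first by rewrite mulf_neq0.
  by apply: ccontM => //; exact: ccont_cst.
- by rewrite (negbTE fa0) expr2.
- move=> z; rewrite (negbTE fa0); case: eqP => [fz0|/eqP fz0]; first ring.
  have -> : - q z / (f z * f a) * (z - a) = - (q z * (z - a)) / (f z * f a) by ring.
  by rewrite -fq; field; rewrite fz0 fa0.
Qed.

Lemma cder_comp f g a l m : cder f a l -> cder g (f a) m ->
  cder (fun z => g (f z)) a (m * l).
Proof.
move=> cf [p [cp <- gp]]; have cf' := cder_cont cf; move: cf => [q [cq <- fq]].
exists (fun z => p (f z) * q z); split=> //.
  by apply: ccontM => //; apply: ccont_comp.
by move=> z; rewrite gp fq mulrA.
Qed.

Lemma cder_unique f a l m : cder f a l -> cder f a m -> l = m.
Proof.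
move=> /cderP fl /cderP fm; apply/eqP; rewrite -subr_eq0; apply/negPn/negP.
rewrite -nc_gt0 => lm; have e0 : 0 < nc (l - m) / 4 by lra.
have [d d0 Hl] := fl _ e0; have [d' d'0 Hm] := fm _ e0.
pose x := Num.min d d' / 2.
have dd : 0 < Num.min d d' by rewrite lt_min d0.
have x0 : 0 < x by rewrite /x; lra.
have xd : x < Num.min d d' by rewrite /x; lra.
have nx : nc (a + x%:C%C - a) = x by rewrite addrC addKr nc_real ger0_norm// ltW.
move: xd; rewrite lt_min -{1 2}nx => /andP[/Hl h1 /Hm h2].
have := ncB (f (a + x%:C%C) - f a - m * (a + x%:C%C - a)) (f (a + x%:C%C) - f a - l * (a + x%:C%C - a)).
rewrite nx in h1 h2.
have -> : f (a + x%:C%C) - f a - m * (a + x%:C%C - a) -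
   (f (a + x%:C%C) - f a - l * (a + x%:C%C - a)) = (l - m) * x%:C%C by ring.
rewrite ncM nc_real ger0_norm ?(ltW x0)//; nra.
Qed.

Lemma cdiff_cst c a : cdiff (fun=> c) a.
Proof. by eexists; exact: cder_cst. Qed.
Lemma cdiff_id a : cdiff id a.
Proof. by eexists; exact: cder_id. Qed.
Lemma cdiffD f g a : cdiff f a -> cdiff g a -> cdiff (fun z => f z + g z) a.
Proof. by move=> [l fl] [m gm]; eexists; apply: cderD; eassumption. Qed.
Lemma cdiffN f a : cdiff f a -> cdiff (fun z => - f z) a.
Proof. by move=> [l fl]; eexists; apply: cderN; eassumption. Qed.
Lemma cdiffB f g a : cdiff f a -> cdiff g a -> cdiff (fun z => f z - g z) a.
Proof. by move=> fa ga; apply: cdiffD => //; exact: cdiffN. Qed.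
Lemma cdiffM f g a : cdiff f a -> cdiff g a -> cdiff (fun z => f z * g z) a.
Proof. by move=> [l fl] [m gm]; eexists; apply: cderM; eassumption. Qed.
Lemma cdiffV f a : f a != 0 -> cdiff f a -> cdiff (fun z => (f z)^-1) a.
Proof. by move=> fa0 [l fl]; eexists; apply: cderV; eassumption. Qed.
Lemma cdiff_comp f g a : cdiff f a -> cdiff g (f a) -> cdiff (fun z => g (f z)) a.
Proof. by move=> [l fl] [m gm]; eexists; apply: cder_comp; eassumption. Qed.
Lemma cdiffX f n a : cdiff f a -> cdiff (fun z => f z ^+ n) a.
Proof.
move=> fa; elim: n => [|n IH]; first exact: cdiff_cst.
apply: (@eq_cdiff (fun z => f z * f z ^+ n)); first by exists 1 => // z _; rewrite exprS.
exact: cdiffM.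
Qed.

End Differentiability.

(** * Goursat's lemma for discrete contour sums *)

Section Goursat.
Context {R : realType}.
Local Notation C := R[i].
Implicit Types (g e : C -> C) (p : nat -> C) (P : R -> R -> C) (x y h L : R).

Definition trapsum g p (N : nat) : C :=
  \sum_(j < N) (g (p j) + g (p j.+1)) / 2 * (p j.+1 - p j).

Lemma trapsumS g p N : trapsum g p N.+1 =
  trapsum g p N + (g (p N) + g (p N.+1)) / 2 * (p N.+1 - p N).
Proof. by rewrite /trapsum big_ord_recr. Qed.

Lemma trapsum_add g p N M :
  trapsum g p (N + M) = trapsum g p N + trapsum g (fun j => p (N + j)%N) M.
Proof.
rewrite /trapsum big_split_ord /=; congr (_ + _).
by apply: eq_bigr => j _; rewrite addnS.
Qed.

Lemma eq_trapsum g p q N : p =1 q -> trapsum g p N = trapsum g q N.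
Proof. by move=> pq; apply: eq_bigr => j _; rewrite !pq. Qed.

(** The trapezoidal rule is exact on affine functions: their part telescopes to a difference of
    values of the primitive a z + b z^2 / 2. Around a closed square these values cancel, so only the
    deviation from the linearisation is left. *)
Lemma trapsum_affine g p N a b :
  trapsum g p N = (a * p N + b * p N ^+ 2 / 2) - (a * p 0%N + b * p 0%N ^+ 2 / 2) +
    trapsum (fun z => g z - (a + b * z)) p N.
Proof.
elim: N => [|N IH]; first by rewrite /trapsum !big_ord0 subrr addr0.
by rewrite !trapsumS IH; field.
Qed.

Lemma trapsum_le e p N (E D : R) : (forall j, (j <= N)%N -> nc (e (p j)) <= E) ->
  (forall j, (j < N)%N -> nc (p j.+1 - p j) <= D) ->
  nc (trapsum e p N) <= N%:R * (E * D).
Proof.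
elim: N => [|N IH] hE hD; first by rewrite /trapsum big_ord0 nc0 mul0r.
rewrite trapsumS.
have -> : N.+1%:R * (E * D) = N%:R * (E * D) + E * D by rewrite -natr1; ring.
rewrite (le_trans (ncD _ _))// lerD//.
  by apply: IH => j jN; [apply: hE; rewrite ltnW|apply: hD; rewrite ltnW].
rewrite !ncM ncV nc_nat.
have h1 := hE N (leqnSn N); have h2 := hE N.+1 (leqnn _).
have h3 := hD N (ltnSn N); have h4 := ncD (e (p N)) (e (p N.+1)).
have E0 : 0 <= E by rewrite (le_trans _ h1)// nc_ge0.
apply: ler_pM => //; rewrite ?mulr_ge0 ?nc_ge0//.
lra.
Qed.

(** [P] sends a parameter square to the plane. The sums run along the images of horizontal and
    vertical edges, cut into [N] steps of parameter length [h]. *)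
Definition hedge g P x y h N := trapsum g (fun j => P (x + h * j%:R) y) N.
Definition vedge g P x y h N := trapsum g (fun j => P x (y + h * j%:R)) N.

Definition square_sum g P x y h N :=
  hedge g P x y h N + vedge g P (x + h * N%:R) y h N
  - hedge g P x (y + h * N%:R) h N - vedge g P x y h N.

Lemma square_sum_split g P x y h N :
  square_sum g P x y h (N + N) =
  square_sum g P x y h N + square_sum g P (x + h * N%:R) y h N
  + square_sum g P x (y + h * N%:R) h N
  + square_sum g P (x + h * N%:R) (y + h * N%:R) h N.
Proof.
have H a b : hedge g P a b h (N + N) = hedge g P a b h N + hedge g P (a + h * N%:R) b h N.
  rewrite /hedge trapsum_add; congr (_ + _); apply: eq_trapsum => j.
  by rewrite natrD mulrDr addrA.
have V a b : vedge g P a b h (N + N) = vedge g P a b h N + vedge g P a (b + h * N%:R) h N.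
  rewrite /vedge trapsum_add; congr (_ + _); apply: eq_trapsum => j.
  by rewrite natrD mulrDr addrA.
rewrite /square_sum !H !V natrD mulrDr !addrA; ring.
Qed.

Variables (g : C -> C) (P : R -> R -> C) (K : R).
Hypothesis K0 : 0 <= K.
Hypothesis lipP : forall x y x' y', 0 <= x <= 1 -> 0 <= y <= 1 -> 0 <= x' <= 1 ->
  0 <= y' <= 1 -> nc (P x y - P x' y') <= K * (`|x - x'| + `|y - y'|).

(** Write L = h N. All nodes lie within 2 K L of P x0 y0 and consecutive ones within K h, so each
    edge contributes at most N * (eps * 2 K L) * (K h) = 2 K^2 eps L^2; there are four edges. *)
Lemma square_sum_small x y h N x0 y0 (l : C) (eps d : R) :
  0 <= h -> 0 <= x -> x + h * N%:R <= 1 -> 0 <= y -> y + h * N%:R <= 1 ->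
  x <= x0 <= x + h * N%:R -> y <= y0 <= y + h * N%:R ->
  (forall z, nc (z - P x0 y0) < d ->
     nc (g z - g (P x0 y0) - l * (z - P x0 y0)) <= eps * nc (z - P x0 y0)) ->
  2 * K * (h * N%:R) < d -> 0 <= eps ->
  nc (square_sum g P x y h N) <= 8 * K ^+ 2 * eps * (h * N%:R) ^+ 2.
Proof.
move=> h0 x_0 x1 y_0 y1 /andP[xx xx'] /andP[yy yy'] gl Kd eps0.
set c := P x0 y0 in gl *; set L := h * N%:R in x1 y1 xx' yy' Kd *.
have L0 : 0 <= L by rewrite mulr_ge0.
have in01 (t u : R) : 0 <= t -> t + L <= 1 -> t <= u <= t + L -> 0 <= u <= 1.
  by clear=> t0 t1 /andP[u1 u2]; rewrite (le_trans t0 u1) (le_trans u2 t1).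
have close (t t0 u : R) : t <= t0 -> t0 <= t + L -> t <= u <= t + L -> `|u - t0| <= L.
  by clear=> t1 t2 /andP[u1 u2]; rewrite ler_norml; apply/andP; split; lra.
have shifted (t s : R) : 0 <= s <= L -> t <= t + s <= t + L.
  by clear=> /andP[s0 s1]; rewrite lerDl s0 lerD2l.
have in_x := in01 _ _ x_0 x1; have in_y := in01 _ _ y_0 y1.
pose a : C := g c - l * c.
have err u v : x <= u <= x + L -> y <= v <= y + L ->
    nc (g (P u v) - (a + l * P u v)) <= eps * (2 * K * L).
  move=> uL vL.
  have Pc : nc (P u v - c) <= 2 * K * L.
    have x0_in : x <= x0 <= x + L by rewrite xx.
    have y0_in : y <= y0 <= y + L by rewrite yy.
    apply: le_trans (lipP (in_x _ uL) (in_y _ vL) (in_x _ x0_in) (in_y _ y0_in)) _.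
    have -> : 2 * K * L = K * (L + L) by ring.
    by apply: ler_wpM2l => //; apply: lerD; [apply: (close x) | apply: (close y)].
  have -> : g (P u v) - (a + l * P u v) = g (P u v) - g c - l * (P u v - c).
    by rewrite /a; ring.
  by rewrite (le_trans (gl _ (le_lt_trans Pc Kd)))// ler_wpM2l.
have hj j : (j <= N)%N -> 0 <= h * j%:R <= L.
  by move=> jN; rewrite mulr_ge0//= ler_wpM2l// ler_nat.
have hstep j : (h * j.+1%:R - h * j%:R) = h by rewrite -natr1; ring.
have hE v : y <= v <= y + L ->
  nc (trapsum (fun z => g z - (a + l * z)) (fun j => P (x + h * j%:R) v) N) <=
    N%:R * (eps * (2 * K * L) * (K * h)).
  move=> hv; apply: trapsum_le => j jN.
    by apply: err => //; apply: shifted; apply: hj.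
  have [q1 q2] := (shifted x _ (hj _ jN), shifted x _ (hj _ (ltnW jN))).
  apply: le_trans (lipP (in_x _ q1) (in_y _ hv) (in_x _ q2) (in_y _ hv)) _.
  by rewrite subrr normr0 addr0 opprD addrACA subrr add0r hstep ger0_norm.
have vE u : x <= u <= x + L ->
  nc (trapsum (fun z => g z - (a + l * z)) (fun j => P u (y + h * j%:R)) N) <=
    N%:R * (eps * (2 * K * L) * (K * h)).
  move=> hu; apply: trapsum_le => j jN.
    by apply: err => //; apply: shifted; apply: hj.
  have [q1 q2] := (shifted y _ (hj _ jN), shifted y _ (hj _ (ltnW jN))).
  apply: le_trans (lipP (in_x _ hu) (in_y _ q1) (in_x _ hu) (in_y _ q2)) _.
  by rewrite subrr normr0 add0r opprD addrACA subrr add0r hstep ger0_norm.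
pose Phi (z : C) : C := a * z + l * z ^+ 2 / 2.
have hA v : hedge g P x v h N = Phi (P (x + L) v) - Phi (P x v) +
    trapsum (fun z => g z - (a + l * z)) (fun j => P (x + h * j%:R) v) N.
  by rewrite /hedge (trapsum_affine _ _ _ a l) /Phi -/L mulr0 addr0.
have vA u : vedge g P u y h N = Phi (P u (y + L)) - Phi (P u y) +
    trapsum (fun z => g z - (a + l * z)) (fun j => P u (y + h * j%:R)) N.
  by rewrite /vedge (trapsum_affine _ _ _ a l) /Phi -/L mulr0 addr0.
rewrite /square_sum !hA !vA -/L.
have left_end (t : R) : t <= t <= t + L by rewrite lexx lerDl.
have right_end (t : R) : t <= t + L <= t + L by rewrite lexx lerDl L0.
move: (hE _ (left_end y)) (hE _ (right_end y)) (vE _ (left_end x)) (vE _ (right_end x)).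
set T1 := trapsum _ _ _; set T2 := trapsum _ _ _; set T3 := trapsum _ _ _; set T4 := trapsum _ _ _.
move=> t1 t2 t3 t4.
have cancel (A B D E t u v w : C) : A - B + t + (D - A + w) - (D - E + u) - (E - B + v) =
    t + w - (u + v) by ring.
rewrite cancel.
have := ncB (T1 + T4) (T2 + T3); have := ncD T1 T4; have := ncD T2 T3.
have -> : 8 * K ^+ 2 * eps * L ^+ 2 = 4 * (N%:R * (eps * (2 * K * L) * (K * h))).
  by rewrite (_ : L ^+ 2 = L * (h * N%:R)) ?expr2//; ring.
move: t1 t2 t3 t4; clear; lra.
Qed.

(** Smallness is asked for all sufficiently fine dyadic meshes, since the four quarters of a square
    may have different thresholds. A bound proportional to L^2 adds up exactly over the quarters. *)
Definition tame (eps : R) (t : R * R) L := exists p0 : nat, forall p : nat, (p0 <= p)%N ->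
  nc (square_sum g P t.1 t.2 (L / 2 ^+ p) (2 ^ p)) <= eps * L ^+ 2.

Lemma tame_split eps x y L : 0 <= eps ->
  tame eps (x, y) (L / 2) -> tame eps (x + L / 2, y) (L / 2) ->
  tame eps (x, y + L / 2) (L / 2) -> tame eps (x + L / 2, y + L / 2) (L / 2) ->
  tame eps (x, y) L.
Proof.
move=> e0 [a Ha] [b Hb] [c Hc] [d Hd].
exists (maxn (maxn a b) (maxn c d)).+1 => -[//|p]; rewrite ltnS !geq_max.
move=> /andP[/andP[/Ha {}Ha /Hb {}Hb] /andP[/Hc {}Hc /Hd {}Hd]].
rewrite expnS mul2n -addnn square_sum_split /=.
have h2 : (2 ^+ p : R) != 0 by rewrite expf_neq0.
have -> : L / 2 ^+ p.+1 = L / 2 / 2 ^+ p by rewrite exprS; field.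
have -> : L / 2 / 2 ^+ p * (2 ^ p)%:R = L / 2 by rewrite natrX; field.
move: Ha Hb Hc Hd; rewrite /=.
set A := square_sum _ _ _ _ _ _; set B := square_sum _ _ _ _ _ _.
set A' := square_sum _ _ _ _ _ _; set B' := square_sum _ _ _ _ _ _.
move=> h3 h4 h5 h6.
have := ncD (A + B + A') B'; have := ncD (A + B) A'; have := ncD A B.
have -> : eps * L ^+ 2 = 4 * (eps * (L / 2) ^+ 2) by field.
lra.
Qed.

Hypothesis dg : forall x y, 0 <= x <= 1 -> 0 <= y <= 1 -> cdiff g (P x y).

Lemma nested_sup (x : nat -> R) : (forall k, x k <= x k.+1) ->
  (forall k, x k.+1 + (2 ^+ k.+1)^-1 <= x k + (2 ^+ k)^-1) ->
  exists s, forall k, x k <= s <= x k + (2 ^+ k)^-1.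
Proof.
move=> xi xd.
have xi' k n : x k <= x (k + n)%N.
  elim: n => [|n IH]; first by rewrite addn0.
  by rewrite addnS (le_trans IH).
have xd' k n : x (k + n)%N + (2 ^+ (k + n)%N)^-1 <= x k + (2 ^+ k)^-1.
  elim: n => [|n IH]; first by rewrite addn0.
  by rewrite addnS (le_trans (xd _)).
have xx k j : x j <= x k + (2 ^+ k)^-1.
  have p0 i : (0 : R) <= (2 ^+ i)^-1 by rewrite invr_ge0 exprn_ge0.
  have /orP[kj|jk] := leq_total k j.
    have := xd' k (j - k)%N; rewrite subnKC//; apply: le_trans.
    by rewrite lerDl.
  have := xi' j (k - j)%N; rewrite subnKC// => h.
  by rewrite (le_trans h)// lerDl.
exists (sup (range x)) => k; apply/andP; split.
  apply: ub_le_sup; last by exists k.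
  by exists (x 0%N + (2 ^+ 0)^-1) => _ [j _ <-].
apply: ge_sup; first by exists (x 0%N), 0%N.
by move=> _ [j _ <-].
Qed.

Lemma goursat eps : 0 < eps -> tame eps (0, 0) 1.
Proof.
move=> eps0; apply: contrapT => nt0.
(* A state is a depth k with the corner of a square of side 2^-k that is not tame; [rel] says that
   the next square is nested in it. *)
pose inv (t : nat * (R * R)) := [/\ ~ tame eps t.2 (2 ^+ t.1)^-1,
  0 <= t.2.1, t.2.1 + (2 ^+ t.1)^-1 <= 1, 0 <= t.2.2 & t.2.2 + (2 ^+ t.1)^-1 <= 1].
pose rel (t u : nat * (R * R)) := [/\ u.1 = t.1.+1,
  t.2.1 <= u.2.1, u.2.1 + (2 ^+ u.1)^-1 <= t.2.1 + (2 ^+ t.1)^-1,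
  t.2.2 <= u.2.2 & u.2.2 + (2 ^+ u.1)^-1 <= t.2.2 + (2 ^+ t.1)^-1].
have step (t : {t | inv t}) : {u : {t | inv t} | rel (sval t) (sval u)}.
  apply: cid; case: t => -[k [x y]] /= [/= nt x0 x1 y0 y1].
  have L2 : (2 ^+ k.+1 : R)^-1 = (2 ^+ k)^-1 / 2 by rewrite exprS invfM mulrC.
  have L0 : 0 < (2 ^+ k : R)^-1 by rewrite invr_gt0 exprn_gt0.
  set L := (2 ^+ k)^-1 in nt x1 y1 L2 L0.
  have [s [q [st sx sx' sy sy']]] : exists s q, [/\ ~ tame eps (s, q) (L / 2),
      x <= s, s <= x + L / 2, y <= q & q <= y + L / 2].
    apply: contrapT => H; apply: nt; apply: tame_split; first exact: ltW.
    - by apply: contrapT => h; apply: H; exists x, y; split=> //; lra.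
    - by apply: contrapT => h; apply: H; exists (x + L / 2), y; split=> //; lra.
    - by apply: contrapT => h; apply: H; exists x, (y + L / 2); split=> //; lra.
    - by apply: contrapT => h; apply: H; exists (x + L / 2), (y + L / 2); split=> //; lra.
  have half_step (a b : R) : a <= b + L / 2 -> a + L / 2 <= b + L.
    by rewrite [X in _ -> _ <= b + X](splitr L) addrA lerD2r.
  have [sL qL] := (half_step _ _ sx', half_step _ _ sy').
  have I : inv (k.+1, (s, q)).
    by rewrite /inv /= L2 (le_trans x0 sx) (le_trans y0 sy) (le_trans sL x1) (le_trans qL y1).
  by exists (exist _ _ I); rewrite /rel /= L2 -/L.
have I0 : inv (0%N, (0, 0)) by rewrite /inv /= expr0 invr1; split=> //; lra.
have [f [f0 fS]] := dependent_choice step (exist _ _ I0).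
pose t k := sval (f k).
have tS k : rel (t k) (t k.+1) by exact: fS.
have tI k : inv (t k) by exact: (svalP (f k)).
have t1 k : (t k).1 = k.
  by elim: k => [|k IH]; [rewrite /t f0|have [-> _ _ _ _] := tS k; rewrite IH].
have [x0 Hx] : exists s, forall k, (t k).2.1 <= s <= (t k).2.1 + (2 ^+ k)^-1.
  by apply: nested_sup => k; have := tS k; rewrite /rel !t1 => -[].
have [y0 Hy] : exists s, forall k, (t k).2.2 <= s <= (t k).2.2 + (2 ^+ k)^-1.
  by apply: nested_sup => k; have := tS k; rewrite /rel !t1 => -[].
have bnd : 0 <= x0 <= 1 /\ 0 <= y0 <= 1.
  have := tI 0%N; rewrite /inv t1 => -[_ a1 a2 a3 a4].
  have /andP[a5 a6] := Hx 0%N; have /andP[a7 a8] := Hy 0%N.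
  rewrite (le_trans a1 a5) (le_trans a6 a2) (le_trans a3 a7) (le_trans a8 a4).
  by [].
have [l /cderP dgl] := dg bnd.1 bnd.2.
(* Chosen to absorb the factor 8 K^2 of [square_sum_small]; the summand 1 covers K = 0. *)
pose e' := eps / (8 * K ^+ 2 + 1).
have K2 : 0 < 8 * K ^+ 2 + 1 by rewrite ltr_wpDl ?mulr_ge0 ?sqr_ge0.
have e'0 : 0 < e' by rewrite divr_gt0.
have [d d0 Hd] := dgl _ e'0.
have [k Hk] : exists k : nat, 2 * K * (2 ^+ k)^-1 < d.
  have [k hk] : exists k : nat, 2 * K / d < k%:R.
    by exists (Num.bound (2 * K / d)); rewrite archi_boundP// divr_ge0 ?mulr_ge0 ?(ltW d0).
  exists k; rewrite ltr_pdivrMr ?exprn_gt0//.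
  rewrite -ltr_pdivrMl// mulrC (lt_trans hk)// -natrX ltr_nat.
  exact: ltn_expl.
have := tI k; rewrite /inv t1 => -[nt a1 a2 a3 a4]; apply: nt.
exists 0%N => p _.
have p2 : (2 ^+ p : R) != 0 by rewrite expf_neq0.
have hN : (2 ^+ k)^-1 / 2 ^+ p * (2 ^ p)%:R = (2 ^+ k)^-1 :> R.
  by rewrite natrX divfK.
apply: le_trans.
  apply: (@square_sum_small _ _ _ _ x0 y0 l e' d); rewrite ?hN//.
  exact: ltW.
rewrite hN ler_wpM2r ?sqr_ge0// /e'.
by rewrite mulrA ler_pdivrMr// mulrC ler_pM2l// lerDl.
Qed.

End Goursat.

(** * A weak Cauchy estimate on circles *)

Section CauchyBound.
Context {R : realType}.
Local Notation C := R[i].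
Implicit Types (f g : C -> C) (x y t : R) (a z w b : C).

(** The point exp(2 pi i t): the unit interval runs once around the circle. *)
Definition cis t : C := (cos (t * pi *+ 2) +i* sin (t * pi *+ 2))%C.

Lemma cisD t s : cis (t + s) = cis t * cis s.
Proof.
rewrite /cis mulrDl mulrnDl; move: (t * pi *+ 2) (s * pi *+ 2) => u v.
apply/eqP; rewrite eq_complex /= cosD sinD.
by apply/andP; split; apply/eqP; ring.
Qed.

Lemma cis0 : cis 0 = 1.
Proof. by rewrite /cis mul0r mul0rn cos0 sin0. Qed.

Lemma cis1 : cis 1 = 1.
Proof. by rewrite /cis mul1r cos2pi sin2pi. Qed.

Lemma nc_cis t : nc (cis t) = 1.
Proof. by rewrite /nc /= cos2Dsin2 sqrtr1. Qed.

Lemma cis_neq0 t : cis t != 0.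
Proof. by rewrite -nc_gt0 nc_cis. Qed.

Lemma cis_sub_inv t : cis t - (cis t)^-1 = (2 * sin (t * pi *+ 2))%:C%C * 'i%C.
Proof.
have -> : (cis t)^-1 = (cis t)^*%C.
  by apply: (mulfI (cis_neq0 t)); rewrite mulfV ?cis_neq0// -nc_sqr nc_cis expr1n.
by rewrite subcJ /= rmorphM /= rmorph_nat.
Qed.

Lemma lip_trig (F dF : R -> R) x y : (forall t, is_derive t 1 F (dF t)) ->
  (forall t, `|dF t| <= 1) -> `|F x - F y| <= `|x - y|.
Proof.
move=> dFF dF1; wlog xy : x y / y <= x.
  move=> H; have [xy|/ltW xy] := leP y x; first exact: H.
  by rewrite distrC [leRHS]distrC; exact: H.
have cF : {within `[y, x], continuous F}.
  apply: continuous_subspaceT => t.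
  apply/differentiable_continuous/derivable1_diffP; exact: ex_derive.
have [t _ ->] := MVT_segment xy (fun t _ => dFF t) cF.
by rewrite normrM ler_piMl.
Qed.

Lemma cis_lip t s : nc (cis t - cis s) <= 4 * pi * `|t - s|.
Proof.
apply: (le_trans (nc_le_ReIm _)) => /=.
have hc := @lip_trig cos (fun t => - sin t) (t * pi *+ 2) (s * pi *+ 2).
have hs := @lip_trig sin cos (t * pi *+ 2) (s * pi *+ 2).
have {}hc : `|cos (t * pi *+ 2) - cos (s * pi *+ 2)| <= `|t * pi *+ 2 - s * pi *+ 2|.
  by apply: hc => u; rewrite normrN sin_max.
have {}hs : `|sin (t * pi *+ 2) - sin (s * pi *+ 2)| <= `|t * pi *+ 2 - s * pi *+ 2|.
  by apply: hs => u; exact: cos_max.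
have E : `|t * pi *+ 2 - s * pi *+ 2| = 2 * pi * `|t - s|.
  have -> : t * pi *+ 2 - s * pi *+ 2 = 2 * pi * (t - s) by ring.
  by rewrite normrM ger0_norm// mulr_ge0 ?pi_ge0.
rewrite E in hc hs; lra.
Qed.

(** Up to the factor i, N sin(2 pi / N) is the trapezoidal sum of 1 / z over the regular N-gon,
    standing in for 2 pi. It equals 4 for N = 4, and doubling N increases it because sin 2u = 2 sin
    u cos u <= 2 sin u. *)
Lemma cis_sin_ge p : (2 <= p)%N -> 4 <= 2 ^+ p * sin ((2 ^+ p)^-1 * pi *+ 2) :> R.
Proof.
have pi0 := @pi_gt0 R.
elim: p => // p IH; rewrite leq_eqVlt => /orP[/eqP [<-]|].
  have -> : (2 ^+ 2)^-1 * pi *+ 2 = pi / 2 :> R by rewrite -mulr_natl; field.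
  rewrite sin_pihalf; lra.
rewrite ltnS => p2; have {IH} := IH p2.
set u := ((2 ^+ p.+1)^-1 * pi *+ 2).
have -> : (2 ^+ p)^-1 * pi *+ 2 = u *+ 2 by rewrite /u exprS -mulr_natl; field; rewrite expf_neq0.
rewrite sin_mulr2n => h.
have p4 : 4 <= 2 ^+ p :> R.
  by rewrite (_ : 4 = 2 ^+ 2) ?ler_eXn2l//; [lra|ring].
have u0 : 0 < u by rewrite /u -mulr_natl !mulr_gt0// invr_gt0 exprn_gt0.
have u1 : u <= pi / 4.
  rewrite /u -mulr_natl exprS.
  have -> : 2 * ((2 * 2 ^+ p)^-1 * pi) = pi / 2 ^+ p :> R by field; rewrite expf_neq0.
  by rewrite ler_pM2l// lef_pV2// posrE ?exprn_gt0.
have s0 : 0 <= sin u by apply: sin_ge0_pi; apply/andP; split; lra.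
have E : 2 ^+ p * ((cos u * sin u) *+ 2) = 2 ^+ p.+1 * sin u * cos u.
  by rewrite exprS; ring.
by rewrite (le_trans h)// E ler_piMr ?cos_le1// mulr_ge0// exprn_ge0.
Qed.

Lemma trapsumD (g1 g2 : C -> C) (p : nat -> C) N :
  trapsum (fun z => g1 z + g2 z) p N = trapsum g1 p N + trapsum g2 p N.
Proof. by rewrite /trapsum -big_split /=; apply: eq_bigr => j _; ring. Qed.

(** By rotation invariance every step contributes the same amount c (w - 1/w) / 2 with w = cis h,
    whatever the radius. *)
Lemma trapsum_cauchy_kernel c a (d h : R) N : 0 < d ->
  trapsum (fun z => c / (z - a)) (fun j => a + d%:C%C * cis (h * j%:R)) N =
  c * (N%:R * sin (h * pi *+ 2))%:C%C * 'i%C.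
Proof.
move=> d0; have dC : (d%:C%C : C) != 0 by rewrite -nc_gt0 nc_real gtr0_norm.
elim: N => [|N IH]; first by rewrite /trapsum big_ord0 mul0r mulr0 mul0r.
have hS : h * N.+1%:R = h * N%:R + h by rewrite -natr1; ring.
rewrite trapsumS IH hS cisD.
have w0 := cis_neq0 h; have e0 := cis_neq0 (h * N%:R).
set w := cis h in w0 *; set e := cis _ in e0 *.
have := cis_sub_inv h; rewrite -/w rmorphM /= rmorph_nat => hw.
have E : (c / (a + d%:C%C * e - a) + c / (a + d%:C%C * (e * w) - a)) / 2 *
   (a + d%:C%C * (e * w) - (a + d%:C%C * e)) = c * (w - w^-1) / 2.
  by rewrite ![a + _]addrC !addrK; field; rewrite dC e0 w0.
rewrite E hw -[in RHS]natr1 [in RHS]mulrDl mul1r rmorphD /=; by field.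
Qed.

(* P below moves a small circle around a to the circle |z| = r; by Goursat the
   trapezoidal sums of f z / (z - a) along the two circles have the same limit. *)
Lemma cauchy_weak f a (r M : R) : nc a < r ->
  (forall z, nc z <= r -> cdiff f z) -> (forall z, nc z = r -> nc (f z) <= M) ->
  nc (f a) <= pi * r / (r - nc a) * M.
Proof.
move=> ar df fM; have pi0 := @pi_gt0 R.
have a0 := nc_ge0 a; have r0 : 0 < r by lra.
have M0 : 0 <= M.
  have := fM r%:C%C; rewrite nc_real ger0_norm ?(ltW r0)// => /(_ erefl).
  by apply: le_trans; exact: nc_ge0.
apply/ler_addgt0Pr => e e0.
have e1 : 0 < e / (4 * pi) by rewrite divr_gt0// mulr_gt0.
have [d' d'0 fd'] := cdiff_cont (df a (ltW ar)) e1.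
have [d [d0 dd' dr]] : exists d, [/\ 0 < d, d < d' & d < r - nc a].
  have m0 : 0 < Num.min d' (r - nc a) by rewrite lt_min d'0; lra.
  exists (Num.min d' (r - nc a) / 2); split; first lra.
    have : Num.min d' (r - nc a) <= d' by rewrite ge_min lexx.
    lra.
  have : Num.min d' (r - nc a) <= r - nc a by rewrite ge_min lexx orbT.
  lra.
(* The circle with parameter x has centre (1 - x) a and radius rho x. [rhoI] keeps it inside the
   closed disk of radius r, [rhoJ] keeps it off the pole a. *)
pose rho x := (1 - x) * d + x * r.
pose P x y : C := (1 - x)%:C%C * a + (rho x)%:C%C * cis y.
pose g z := f z / (z - a).
have rhoI x : 0 <= x <= 1 -> nc ((1 - x)%:C%C * a) + rho x <= r.
  move=> /andP[x0 x1]; rewrite ncM nc_real ger0_norm /rho; last lra.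
  nra.
have rhoJ x : 0 <= x <= 1 -> 0 < rho x - x * nc a.
  move=> /andP[x0 x1]; rewrite /rho.
  have -> : (1 - x) * d + x * r - x * nc a = (1 - x) * d + x * (r - nc a) by ring.
  nra.
have rho0 x : 0 <= x <= 1 -> 0 <= rho x <= r.
  move=> /andP[x0 x1]; rewrite /rho; apply/andP; split; nra.
pose K := 2 * r + r * (4 * pi).
have K0 : 0 <= K by rewrite /K; nra.
have lipP x y x' y' : 0 <= x <= 1 -> 0 <= y <= 1 -> 0 <= x' <= 1 -> 0 <= y' <= 1 ->
    nc (P x y - P x' y') <= K * (`|x - x'| + `|y - y'|).
  move=> hx hy hx' hy'.
  have -> : P x y - P x' y' = (x' - x)%:C%C * a + (rho x - rho x')%:C%C * cis y
      + (rho x')%:C%C * (cis y - cis y').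
    rewrite /P !rmorphB /=; ring.
  apply: (le_trans (ncD _ _)).
  apply: (@le_trans _ _ (2 * r * `|x - x'| + r * (4 * pi) * `|y - y'|)).
    apply: lerD.
      apply: (le_trans (ncD _ _)); rewrite !ncM !nc_real nc_cis mulr1.
      have -> : rho x - rho x' = (x - x') * (r - d) by rewrite /rho; ring.
      rewrite normrM [`|x' - x|]distrC [`|r - d|]ger0_norm; last lra.
      have := normr_ge0 (x - x'); nra.
    rewrite ncM nc_real -mulrA; have /andP[q0 q1] := rho0 _ hx'.
    rewrite ger0_norm//; apply: ler_pM => //; [exact: nc_ge0|exact: cis_lip].
  have u0 := normr_ge0 (x - x'); have v0 := normr_ge0 (y - y').
  have uv : 0 <= 2 * r * `|y - y'| by rewrite !mulr_ge0// ltW.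
  have vu : 0 <= r * (4 * pi) * `|x - x'| by rewrite !mulr_ge0 ?pi_ge0// ltW.
  have -> : K * (`|x - x'| + `|y - y'|) = 2 * r * `|x - x'| + r * (4 * pi) * `|y - y'|
      + (2 * r * `|y - y'| + r * (4 * pi) * `|x - x'|) by rewrite /K; ring.
  by rewrite lerDl addr_ge0.
have Pr x y : 0 <= x <= 1 -> nc (P x y) <= r.
  move=> hx; apply: le_trans (rhoI _ hx); rewrite (le_trans (ncD _ _))// lerD2l.
  have /andP[q0 q1] := rho0 _ hx.
  by rewrite ncM nc_real nc_cis mulr1 ger0_norm.
have Pa x y : 0 <= x <= 1 -> P x y - a != 0.
  move=> hx; rewrite -nc_gt0; apply: (lt_le_trans (rhoJ _ hx)).
  have -> : P x y - a = (rho x)%:C%C * cis y - x%:C%C * a by rewrite /P !rmorphB rmorph1; ring.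
  apply: le_trans (ncBge _ _); have /andP[q0 q1] := rho0 _ hx; have /andP[q2 q3] := hx.
  by rewrite !ncM !nc_real nc_cis mulr1 !ger0_norm.
have dg x y : 0 <= x <= 1 -> 0 <= y <= 1 -> cdiff g (P x y).
  move=> hx hy; apply: cdiffM; first exact/df/Pr.
  apply: cdiffV; first exact: Pa.
  by apply: cdiffB; [exact: cdiff_id|exact: cdiff_cst].
have [p0 Hp] := goursat K0 lipP dg e0.
(* At least 2, as [cis_sin_ge] requires. *)
pose p := (p0 + 2)%N.
have := Hp p (leq_addr _ _); rewrite expr1n mulr1 div1r.
set h := (2 ^+ p)^-1; set N := (2 ^ p)%N.
have hN : h * N%:R = 1 by rewrite /h /N natrX mulVf// expf_neq0.
have h0 : 0 < h by rewrite /h invr_gt0 exprn_gt0.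
rewrite /square_sum /= hN !add0r.
(* The two horizontal edges are the same segment, since cis 0 = cis 1; they cancel and only the two
   circles remain. *)
have -> : hedge g P 0 1 h N = hedge g P 0 0 h N.
  by apply: eq_trapsum => j; rewrite /P cis0 cis1.
set H := hedge _ _ _ _ _ _.
have cancel (A B D : C) : A + B - A - D = B - D by ring.
rewrite cancel.
set V1 := vedge g P 1 0 h N; set V0 := vedge g P 0 0 h N => HV.
have hj j : (j <= N)%N -> 0 <= h * j%:R <= 1.
  move=> jN; rewrite mulr_ge0 ?(ltW h0)//= -[X in _ <= X]hN.
  by rewrite ler_pM2l// ler_nat.
have cstep j : nc (cis (0 + h * j.+1%:R) - cis (0 + h * j%:R)) <= 4 * pi * h.
  apply: (le_trans (cis_lip _ _)); rewrite !add0r.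
  have -> : h * j.+1%:R - h * j%:R = h by rewrite -[j.+1%:R]natr1; ring.
  by rewrite ger0_norm// ltW.
have V1le : nc V1 <= 4 * pi * r / (r - nc a) * M.
  have -> : 4 * pi * r / (r - nc a) * M = N%:R * (M / (r - nc a) * (r * (4 * pi * h))).
    transitivity (4 * pi * r / (r - nc a) * M * (h * N%:R)); first by rewrite hN mulr1.
    ring.
  have rho1 : rho 1 = r by rewrite /rho; ring.
  have P1 y : P 1 y = r%:C%C * cis y by rewrite /P rho1 subrr mul0r add0r.
  have nP1 y : nc (P 1 y) = r by rewrite P1 ncM nc_real nc_cis mulr1 gtr0_norm.
  apply: trapsum_le => j jN.
    rewrite /g ncM ncV; apply: ler_pM; rewrite ?nc_ge0 ?invr_ge0 ?nc_ge0//.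
      by apply: fM.
    rewrite lef_pV2 ?posrE ?subr_gt0//.
      by have := ncBge (P 1 (0 + h * j%:R)) a; rewrite nP1.
    by rewrite nc_gt0; apply: Pa; rewrite ler01 lexx.
  rewrite !P1 -mulrBr ncM nc_real gtr0_norm//; apply: ler_wpM2l; first exact: ltW.
  exact: cstep.
have rho00 : rho 0 = d by rewrite /rho; ring.
have P0 y : P 0 y = a + d%:C%C * cis y by rewrite /P rho00 subr0 mul1r.
have V0E : V0 = trapsum (fun z => f a / (z - a)) (fun j => a + d%:C%C * cis (h * j%:R)) N +
     trapsum (fun z => (f z - f a) / (z - a)) (fun j => a + d%:C%C * cis (h * j%:R)) N.
  rewrite -trapsumD /V0 /vedge /trapsum; apply: eq_bigr => j _.
  by rewrite !P0 !add0r /g !mulrBl !subrKC.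
have V0le : nc (trapsum (fun z => (f z - f a) / (z - a))
    (fun j => a + d%:C%C * cis (h * j%:R)) N) <= e.
  have -> : e = N%:R * (e / (4 * pi) / d * (d * (4 * pi * h))).
    transitivity (e * (h * N%:R)); first by rewrite hN mulr1.
    by move: (pi : R) pi0 => q q0; field; rewrite !gt_eqF.
  apply: trapsum_le => j jN.
    have E : a + d%:C%C * cis (h * j%:R) - a = d%:C%C * cis (h * j%:R) by rewrite addrC addKr.
    have nE : nc (a + d%:C%C * cis (h * j%:R) - a) = d.
      by rewrite E ncM nc_real nc_cis mulr1 gtr0_norm.
    rewrite ncM ncV nE ler_wpM2r ?invr_ge0 ?(ltW d0)//.
    by apply/ltW/fd'; rewrite nE.
  have := cstep j; rewrite !add0r => cs.
  rewrite opprD addrACA subrr add0r -mulrBr ncM nc_real gtr0_norm//.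
  by rewrite ler_wpM2l// ltW.
rewrite trapsum_cauchy_kernel// in V0E.
have s4 := @cis_sin_ge p (leq_addl _ _).
rewrite -/h -natrX -/N in s4.
have nF : nc (f a) * 4 <= nc (f a * (N%:R * sin (h * pi *+ 2))%:C%C * 'i%C).
  rewrite !ncM nc_real [nc 'i%C]/nc /= expr0n expr1n add0r sqrtr1 mulr1.
  by rewrite ler_wpM2l ?nc_ge0// (le_trans s4)// ler_norm.
set F := f a * _ * _ in V0E nF; set T := trapsum _ _ _ in V0E V0le.
have := ncB V1 (V1 - V0); have := ncB V0 T.
have -> : V1 - (V1 - V0) = V0 by ring.
have -> : V0 - T = F by rewrite V0E addrK.
(* The 4 pi is the Lipschitz constant of [cis], the division by 4 is the lower bound of
   [cis_sin_ge]; the two errors e together also get divided by 4. *)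
have -> : pi * r / (r - nc a) * M = (4 * pi * r / (r - nc a) * M) / 4.
  by move: (pi : R) => q; field; lra.
lra.
Qed.

End CauchyBound.

(** * The maximum principle and divided differences *)

Section MaximumPrinciple.
Context {R : realType}.
Local Notation C := R[i].
Implicit Types (f g : C -> C) (x y t r M : R) (a z w v b : C) (s : seq C).

(** The powers of x / y stay below K, while by Bernoulli's inequality those of a number above 1 are
    unbounded. *)
Lemma ler_of_powers x y K : 0 <= x -> 0 <= y -> (forall n, x ^+ n <= K * y ^+ n) -> x <= y.
Proof.
move=> x0 y0 H; rewrite leNgt; apply/negP => xy.
have [y00|yp] : y = 0 \/ 0 < y by move: y0; rewrite le_eqVlt => /orP[/eqP <-|]; [left|right].
  by have := H 1%N; rewrite !expr1 y00 mulr0; lra.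
have bern n (u : R) : 0 <= u -> 1 + n%:R * u <= (1 + u) ^+ n.
  move=> u0; elim: n => [|n IH]; first by rewrite mul0r addr0 expr0.
  rewrite exprS -[n.+1%:R]natr1.
  have n0 : 0 <= n%:R :> R by [].
  apply: (@le_trans _ _ ((1 + u) * (1 + n%:R * u))); first nra.
  by rewrite ler_wpM2l//; lra.
pose u := x / y - 1.
have u0 : 0 < u by rewrite /u subr_gt0 ltr_pdivlMr// mul1r.
have xE : x = y * (1 + u) by rewrite /u; field; lra.
have HK n : (1 + u) ^+ n <= K.
  have := H n; rewrite xE exprMn [K * _]mulrC ler_pM2l// exprn_gt0//.
have K1 : 1 <= K by have := HK 0%N; rewrite expr0.
have Ku : 0 <= K / u by rewrite divr_ge0// ?ltW//; lra.
have := archi_boundP Ku; set n := Num.bound _ => hn.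
have := le_trans (bern n _ (ltW u0)) (HK n).
by move: hn; rewrite ltr_pdivrMr//; lra.
Qed.

Definition lbound f b := exists B d, 0 < d /\
  forall z, z != b -> nc (z - b) < d -> nc (f z) <= B.

(** Divided differences have isolated singularities at which they are only known to be bounded. The
    list [s] records them, so that the maximum principle applies before any of them is removed; the
    values of [f] on [s] are irrelevant. *)
Definition hol_off s f r := (forall z, nc z <= r -> z \notin s -> cdiff f z) /\
  (forall b, b \in s -> lbound f b).

Lemma ccont_lbound f b : ccont f b -> lbound f b.
Proof.
move=> /(_ 1 ltr01) [d d0 H]; exists (nc (f b) + 1), d; split=> // z _ /H h.
by have := ncBge (f z) (f b); lra.
Qed.

Lemma eq_lbound f g b : (exists2 d : R, 0 < d & forall z, nc (z - b) < d -> z != b -> f z = g z) ->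
  lbound f b -> lbound g b.
Proof.
move=> [d d0 fg] [B [d' [d'0 H]]]; exists B, (Num.min d d').
by rewrite lt_min d0; split=> // z zb; rewrite lt_min => /andP[/fg <- // /H]; apply.
Qed.

Lemma lboundM f g b : lbound f b -> lbound g b -> lbound (fun z => f z * g z) b.
Proof.
move=> [B [d [d0 H]]] [B' [d' [d'0 H']]]; exists (B * B'), (Num.min d d').
rewrite lt_min d0; split=> // z zb; rewrite lt_min => /andP[/(H _ zb) h /(H' _ zb) h'].
by rewrite ncM ler_pM ?nc_ge0.
Qed.

Lemma lboundX f n b : lbound f b -> lbound (fun z => f z ^+ n) b.
Proof.
move=> fb; elim: n => [|n IH]; first exact/ccont_lbound/ccont_cst.
apply: (@eq_lbound (fun z => f z * f z ^+ n)); first by exists 1 => // z _ _; rewrite exprS.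
exact: lboundM.
Qed.

Lemma lboundB f g b : lbound f b -> lbound g b -> lbound (fun z => f z - g z) b.
Proof.
move=> [B [d [d0 H]]] [B' [d' [d'0 H']]]; exists (B + B'), (Num.min d d').
rewrite lt_min d0; split=> // z zb; rewrite lt_min => /andP[/(H _ zb) h /(H' _ zb) h'].
by rewrite (le_trans (ncB _ _))// lerD.
Qed.

(* Multiplying by (z - b)^2 turns a locally bounded singularity into a zero of order two. *)
Lemma lbound_cdiff f b : lbound f b -> cdiff (fun z => if z == b then 0 else (z - b) ^+ 2 * f z) b.
Proof.
move=> [B [d [d0 H]]]; exists 0; apply/cderP => e e0.
have B1 : 0 < `|B| + 1 by have := normr_ge0 B; lra.
exists (Num.min d (e / (`|B| + 1))); first by rewrite lt_min d0 divr_gt0.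
move=> z; rewrite lt_min => /andP[zd ze]; rewrite eqxx mul0r !subr0.
case: eqP => [->|/eqP zb]; first by rewrite nc0 mulr_ge0 ?nc_ge0 ?ltW.
rewrite ncM ncX; have h := H z zb zd; have h' := ler_norm B.
move: ze; rewrite ltr_pdivlMr// => ze.
have n0 := nc_ge0 (z - b); have f0 := nc_ge0 (f z).
rewrite expr2 -mulrA mulrC; apply: ler_wpM2r => //.
apply: le_trans (ltW ze); apply: ler_wpM2l => //; lra.
Qed.

(* The constant of the weak Cauchy estimate disappears on applying it to the powers of f. *)
Lemma max_principle s f r M a : hol_off s f r ->
  (forall z, nc z = r -> z \notin s -> nc (f z) <= M) -> 0 <= M ->
  nc a < r -> a \notin s -> nc (f a) <= M.
Proof.
move=> + + M0 ar; elim: s f M M0 => [|b s IH] f M M0 [df lf] fM aNs.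
  apply: (@ler_of_powers _ _ (pi * r / (r - nc a))); rewrite ?nc_ge0// => n.
  rewrite -ncX; apply: (@cauchy_weak _ (fun z => f z ^+ n)) => // [z zr|z zr].
    by apply: cdiffX; apply: df.
  by rewrite ncX lerXn2r ?nnegrE ?nc_ge0//; apply: fM.
have [bs|bNs] := boolP (b \in s).
  apply: IH => //; first split.
  - by move=> z zr zs; apply: df => //; rewrite in_cons negb_or zs andbT; apply: contraNneq zs => ->.
  - by move=> c cs; apply: lf; rewrite in_cons cs orbT.
  - by move=> z zr zs; apply: fM => //; rewrite in_cons negb_or zs andbT; apply: contraNneq zs => ->.
  - by move: aNs; rewrite in_cons negb_or => /andP[].
move: aNs; rewrite in_cons negb_or => /andP[ab aNs].
have r0 : 0 < r by have := nc_ge0 a; lra.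
have ab0 : 0 < nc (a - b) by rewrite nc_gt0 subr_eq0.
(* The factor (z - b)^2 costs at most (r + |b|)^2 / |a - b|^2. It multiplies the n-th power of f
   once, so its cost is independent of n and disappears with the powers. *)
apply: (@ler_of_powers _ _ ((r + nc b) ^+ 2 / nc (a - b) ^+ 2)); rewrite ?nc_ge0// => n.
pose F z := if z == b then 0 else (z - b) ^+ 2 * f z ^+ n.
have : nc (F a) <= (r + nc b) ^+ 2 * M ^+ n.
  apply: IH => //; first by rewrite mulr_ge0 ?exprn_ge0 ?addr_ge0 ?nc_ge0// ltW.
    split=> [z zr zs|c cs].
      have [->|zb] := eqVneq z b.
        by apply: (@lbound_cdiff (fun z => f z ^+ n)); apply: lboundX; apply: lf; rewrite mem_head.
      apply: (@eq_cdiff _ (fun z => (z - b) ^+ 2 * f z ^+ n)).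
        exists (nc (z - b)); first by rewrite nc_gt0 subr_eq0.
        move=> u uz; rewrite /F; case: eqP => // ub; move: uz.
        by rewrite ub ncC ltxx.
      apply: cdiffM; first by apply: cdiffX; apply: cdiffB; [exact: cdiff_id|exact: cdiff_cst].
      by apply: cdiffX; apply: df => //; rewrite in_cons negb_or zb.
    have cb : c != b by apply: contraNneq bNs => <-.
    apply: (@eq_lbound (fun z => (z - b) ^+ 2 * f z ^+ n)).
      exists (nc (c - b)); first by rewrite nc_gt0 subr_eq0.
      move=> u uz _; rewrite /F; case: eqP => // ub; move: uz.
      by rewrite ub ncC ltxx.
    apply: lboundM; last by apply: lboundX; apply: lf; rewrite in_cons cs orbT.
    apply: ccont_lbound; apply: cdiff_cont; apply: cdiffX.
    by apply: cdiffB; [exact: cdiff_id|exact: cdiff_cst].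
  move=> z zr zs; rewrite /F; case: eqP => [_|/eqP zb].
    by rewrite nc0 mulr_ge0 ?sqr_ge0 ?exprn_ge0.
  rewrite ncM !ncX; apply: ler_pM; rewrite ?exprn_ge0 ?nc_ge0//.
    have h : nc (z - b) <= r + nc b by rewrite -zr ncB.
    by rewrite lerXn2r ?nnegrE ?nc_ge0 ?addr_ge0 ?nc_ge0// ltW.
  by rewrite lerXn2r ?nnegrE ?nc_ge0//; apply: fM => //; rewrite in_cons negb_or zb.
rewrite /F (negbTE ab) ncM !ncX => h.
by rewrite mulrAC ler_pdivlMr ?exprn_gt0// mulrC.
Qed.

Definition dq f w z := (f z - f w) / (z - w).

Lemma dqK f w z : f z - f w = dq f w z * (z - w).
Proof.
have [->|zw] := eqVneq z w; first by rewrite !subrr mulr0.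
by rewrite /dq divfK// subr_eq0.
Qed.

Lemma cdiff_dq f w z : z != w -> cdiff f z -> cdiff (dq f w) z.
Proof.
move=> zw fz; apply: cdiffM; first by apply: cdiffB => //; exact: cdiff_cst.
apply: cdiffV; first by rewrite subr_eq0.
by apply: cdiffB; [exact: cdiff_id|exact: cdiff_cst].
Qed.

Lemma lbound_dq_diag f w : cdiff f w -> lbound (dq f w) w.
Proof.
move=> [l [q [cq _ fq]]]; apply: (@eq_lbound q); last exact: ccont_lbound.
by exists 1 => // z _ zw; rewrite /dq fq mulfK// subr_eq0.
Qed.

Lemma lbound_dq f w b : b != w -> lbound f b -> lbound (dq f w) b.
Proof.
move=> bw fb; apply: lboundM.
  by apply: lboundB => //; exact/ccont_lbound/ccont_cst.
apply: ccont_lbound; apply: ccontV; first by rewrite subr_eq0.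
by apply: ccontB; [exact: ccont_id|exact: ccont_cst].
Qed.

Lemma hol_off_dq s f r w : nc w <= r -> w \notin s -> hol_off s f r -> hol_off (w :: s) (dq f w) r.
Proof.
move=> wr ws [df lf]; split.
  move=> z zr; rewrite in_cons negb_or => /andP[zw zs].
  by apply: cdiff_dq => //; apply: df.
move=> b; rewrite in_cons => /orP[/eqP ->|bs].
  by apply: lbound_dq_diag; apply: df.
by apply: lbound_dq; [apply: contraNneq ws => <-|apply: lf].
Qed.

(** On the circle of radius r the numerator is at most 2 M and the denominator at least r - rho; the
    maximum principle with [w] as a new singularity carries the bound inside. It plays the part of
    Cauchy's estimate for f'. *)
Lemma dq_bound s f r M rho w z : hol_off s f r ->
  (forall z, nc z = r -> z \notin s -> nc (f z) <= M) -> 0 <= M ->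
  nc w <= rho -> rho < r -> w \notin s -> nc z < r -> z \notin s -> z != w ->
  nc (dq f w z) <= 2 * M / (r - rho).
Proof.
move=> fs fM M0 wr rr ws zr zs zw.
have fw : nc (f w) <= M by apply: (max_principle fs) => //; apply: le_lt_trans rr.
apply: (@max_principle (w :: s) _ r) => //.
- by apply: hol_off_dq => //; lra.
- move=> u ur; rewrite in_cons negb_or => /andP[uw us].
  rewrite ncM ncV; apply: ler_pM; rewrite ?nc_ge0 ?invr_ge0 ?nc_ge0//.
    by have := ncB (f u) (f w); have := fM u ur us; lra.
  rewrite lef_pV2 ?posrE ?subr_gt0 ?nc_gt0 ?subr_eq0//.
  by have := ncBge u w; rewrite ur; lra.
- by rewrite divr_ge0 ?mulr_ge0 ?subr_ge0// ltW.
- by rewrite in_cons negb_or zw.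
Qed.

(** [dq_bound] applied to [dq f w] itself, in place of Cauchy's estimate for f''. That the constant
    depends only on M, r and rho is what gives removability, limits of sequences and a Liouville
    argument. *)
Lemma dq2_bound s f r M rho w v z : hol_off s f r ->
  (forall z, nc z = r -> z \notin s -> nc (f z) <= M) -> 0 <= M ->
  nc w <= rho -> nc v <= rho -> rho < r -> w \notin s -> v \notin s -> nc z < r -> z \notin s ->
  v != w -> z != w ->
  nc (dq f w z - dq f w v) <= 4 * M / (r - rho) ^+ 2 * nc (z - v).
Proof.
move=> fs fM M0 wr vr rr ws vs zr zs vw zw.
have [->|zv] := eqVneq z v; first by rewrite !subrr nc0 mulr0.
have rr0 : 0 < r - rho by lra.
rewrite dqK ncM; apply: ler_wpM2r; first exact: nc_ge0.
have -> : 4 * M / (r - rho) ^+ 2 = 2 * (2 * M / (r - rho)) / (r - rho) by field; lra.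
have M1 : 0 <= 2 * M / (r - rho) by rewrite divr_ge0 ?mulr_ge0 ?(ltW rr0).
apply: (@dq_bound (w :: s) _ r) => //; rewrite ?in_cons ?negb_or ?vw ?zw//.
  by apply: hol_off_dq => //; lra.
move=> u ur; rewrite in_cons negb_or => /andP[uw us].
have fw : nc (f w) <= M by apply: (max_principle fs) => //; apply: le_lt_trans rr.
rewrite ncM ncV; apply: ler_pM; rewrite ?nc_ge0 ?invr_ge0 ?nc_ge0//.
  by have := ncB (f u) (f w); have := fM u ur us; lra.
rewrite lef_pV2 ?posrE ?subr_gt0 ?nc_gt0 ?subr_eq0//.
by have := ncBge u w; rewrite ur; lra.
Qed.

End MaximumPrinciple.

(** * Limits, removable singularities and pointwise limits of bounded sequences *)

Section Limits.
Context {R : realType}.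
Local Notation C := R[i].
Implicit Types (f g : C -> C) (x y t r M : R) (a z w v b l : C) (u : nat -> C).

Definition ccvg u l := forall e : R, 0 < e ->
  exists N : nat, forall n, (N <= n)%N -> nc (u n - l) < e.

Lemma real_cauchy_cvg (x : nat -> R) :
  (forall e : R, 0 < e -> exists N : nat, forall n m, (N <= n)%N -> (N <= m)%N -> `|x n - x m| < e) ->
  exists l : R, forall e : R, 0 < e -> exists N : nat, forall n, (N <= n)%N -> `|x n - l| < e.
Proof.
move=> H; have /cvg_ex [l /cvgrPdistC_lt xl] : cvg (x @ \oo).
  apply/cauchy_cvgP/cauchy_exP => e /H [N HN]; exists (x N); exists N => // n Nn.
  by rewrite /ball/= HN.
by exists l => e /xl [N _ HN]; exists N => n /HN.
Qed.

Lemma ccauchy_cvg u :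
  (forall e : R, 0 < e -> exists N : nat, forall n m, (N <= n)%N -> (N <= m)%N -> nc (u n - u m) < e) ->
  exists l, ccvg u l.
Proof.
move=> H.
have [|x Hx] := @real_cauchy_cvg (fun n => complex.Re (u n)).
  move=> e /H [N HN]; exists N => n m nN mN; apply: le_lt_trans (HN n m nN mN).
  by apply: le_trans (nc_ge_Re _); case: (u n) (u m) => ? ? [? ?].
have [|y Hy] := @real_cauchy_cvg (fun n => complex.Im (u n)).
  move=> e /H [N HN]; exists N => n m nN mN; apply: le_lt_trans (HN n m nN mN).
  by apply: le_trans (nc_ge_Im _); case: (u n) (u m) => ? ? [? ?].
exists (x +i* y)%C => e e0; have e2 : 0 < e / 2 by lra.
have [N HN] := Hx _ e2; have [N' HN'] := Hy _ e2.
exists (maxn N N') => n; rewrite geq_max => /andP[/HN + /HN'].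
case: (u n) => p q h1 h2; rewrite /= in h1 h2.
apply: (le_lt_trans (nc_le_ReIm _)); rewrite /=; lra.
Qed.

Lemma ccvg_le u l a B : ccvg u l ->
  (exists N : nat, forall n, (N <= n)%N -> nc (u n - a) <= B) -> nc (l - a) <= B.
Proof.
move=> ul [N HN]; apply/ler_addgt0Pr => e e0; have [N' HN'] := ul _ e0.
have h := HN (maxn N N') (leq_maxl _ _); have h' := HN' (maxn N N') (leq_maxr _ _).
by have := ncB3 (u (maxn N N')) l a; rewrite (ncC l (u _)); lra.
Qed.

Lemma ccvg_le0 u l B : ccvg u l ->
  (exists N : nat, forall n, (N <= n)%N -> nc (u n) <= B) -> nc l <= B.
Proof.
move=> ul [N HN]; rewrite -[l]subr0; apply: (ccvg_le ul); exists N => n /HN.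
by rewrite subr0.
Qed.

Lemma ccvg_unique u l l' : ccvg u l -> ccvg u l' -> l = l'.
Proof.
move=> ul ul'; apply/eqP; rewrite -subr_eq0 -nc_eq0 eq_le nc_ge0 andbT.
apply/ler_addgt0Pr => e e0; rewrite add0r; apply: (ccvg_le ul); have [N HN] := ul' _ e0.
by exists N => n /HN /ltW.
Qed.

Lemma eq_ccvg u (v : nat -> C) l : (exists N : nat, forall n, (N <= n)%N -> u n = v n) -> ccvg u l -> ccvg v l.
Proof.
move=> [N HN] ul e /ul [N' HN']; exists (maxn N N') => n; rewrite geq_max.
by move=> /andP[/HN <- /HN'].
Qed.

Lemma ccvg_cont f u l : ccont f l -> ccvg u l -> ccvg (fun n => f (u n)) (f l).
Proof. by move=> fl ul e /fl [d /ul [N HN] H]; exists N => n /HN /H. Qed.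

Lemma ccvgB u (v : nat -> C) l m : ccvg u l -> ccvg v m -> ccvg (fun n => u n - v n) (l - m).
Proof.
move=> ul vm e e0; have e2 : 0 < e / 2 by lra.
have [N HN] := ul _ e2; have [N' HN'] := vm _ e2.
exists (maxn N N') => n; rewrite geq_max => /andP[/HN h1 /HN' h2].
have := ncB (u n - l) (v n - m).
have -> : u n - l - (v n - m) = u n - v n - (l - m) by ring.
lra.
Qed.

Lemma ccvgM c u l : ccvg u l -> ccvg (fun n => c * u n) (c * l).
Proof.
move=> ul; apply: (@ccvg_cont (fun z => c * z)) => //.
by apply: ccontM; [exact: ccont_cst|exact: ccont_id].
Qed.

Lemma ccont_le f b B : ccont f b ->
  (exists2 d : R, 0 < d & forall z, z != b -> nc (z - b) < d -> nc (f z) <= B) -> nc (f b) <= B.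
Proof.
move=> fb [d d0 H]; apply/ler_addgt0Pr => e e0; have [d' d'0 H'] := fb _ e0.
have m0 : 0 < Num.min d d' by rewrite lt_min d0.
pose t := Num.min d d' / 2.
have t0 : 0 < t by rewrite /t; lra.
have tm : t < Num.min d d' by rewrite /t; lra.
have nz : nc (b + t%:C%C - b) = t by rewrite addrC addKr nc_real gtr0_norm.
move: tm; rewrite lt_min -{1 2}nz => /andP[td td'].
have zb : b + t%:C%C != b.
  by rewrite -subr_eq0 -nc_gt0 nz.
have h := H _ zb td; have h' := H' _ td'.
by have := ncBge (f b) (f (b + t%:C%C)); rewrite ncC; lra.
Qed.

Lemma cdiff_trans f b z : cdiff f (z + b) -> cdiff (fun u : C => f (u + b)) z.
Proof.
move=> fz; apply: (@cdiff_comp _ (fun u : C => u + b)) => //.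
by apply: cdiffD; [exact: cdiff_id|exact: cdiff_cst].
Qed.

Lemma cdiff_trans0 f b : cdiff (fun u : C => f (u + b)) 0 -> cdiff f b.
Proof.
move=> fz; apply: (@eq_cdiff _ (fun z => f (z - b + b))).
  by exists 1 => // z _; rewrite subrK.
apply: (@cdiff_comp _ (fun z => z - b) (fun u : C => f (u + b))); last by rewrite subrr.
by apply: cdiffB; [exact: cdiff_id|exact: cdiff_cst].
Qed.

(** A Lipschitz difference quotient is Cauchy along b + r / (n + 1); its limit there is the
    derivative, at a rate given by the same Lipschitz constant. *)
Lemma dq_cauchy_cdiff f b r K : 0 < r ->
  (forall z v, z != b -> v != b -> nc (z - b) <= r -> nc (v - b) <= r ->
    nc (dq f b z - dq f b v) <= K * nc (z - v)) -> cdiff f b.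
Proof.
move=> r0 H.
have K0 : 0 <= `|K| by [].
have {}H z v : z != b -> v != b -> nc (z - b) <= r -> nc (v - b) <= r ->
    nc (dq f b z - dq f b v) <= `|K| * nc (z - v).
  move=> zb vb zr vr; apply: (le_trans (H _ _ zb vb zr vr)).
  by rewrite ler_wpM2r ?nc_ge0// ler_norm.
pose t n : R := r / n.+1%:R.
pose v n := b + (t n)%:C%C.
have t0 n : 0 < t n by rewrite divr_gt0.
have nv n : nc (v n - b) = t n by rewrite /v addrC addKr nc_real gtr0_norm.
have tr n : t n <= r by rewrite ler_pdivrMr// ler_peMr ?ler1n// ltW.
have vb n : v n != b by rewrite -subr_eq0 -nc_gt0 nv.
have vr n : nc (v n - b) <= r by rewrite nv.
have small e : 0 < e -> exists N : nat, forall n, (N <= n)%N -> (`|K| + 1) * t n < e.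
  move=> e0; have q0 : 0 <= (`|K| + 1) * r / e by rewrite divr_ge0 ?mulr_ge0 ?ltW//; lra.
  exists (Num.bound ((`|K| + 1) * r / e)) => n Nn.
  rewrite mulrA ltr_pdivrMr// -ltr_pdivrMl// mulrC.
  apply: (lt_le_trans (archi_boundP q0)).
  by rewrite ler_nat (leq_trans Nn).
have [l Hl] : exists l, ccvg (fun n => dq f b (v n)) l.
  apply: ccauchy_cvg => e e0; have e2 : 0 < e / 2 by lra.
  have [N HN] := small _ e2; exists N => n m /HN hn /HN hm.
  apply: (le_lt_trans (H _ _ (vb n) (vb m) (vr n) (vr m))).
  have := ncB3 b (v n) (v m); rewrite nv (ncC b) nv => h.
  have := t0 n; have := t0 m.
  have : `|K| * nc (v n - v m) <= `|K| * (t n + t m) by rewrite ler_wpM2l.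
  nra.
have lim z : z != b -> nc (z - b) <= r -> nc (dq f b z - l) <= `|K| * nc (z - b).
  move=> zb zr; apply/ler_addgt0Pr => e e0; have e2 : 0 < e / 2 by lra.
  have [N HN] := small _ e2; have [N' HN'] := Hl _ e2.
  pose n := maxn N N'.
  have h1 := HN n (leq_maxl _ _); have h2 := HN' n (leq_maxr _ _).
  have h3 := H _ _ zb (vb n) zr (vr n).
  have := ncB3 (dq f b (v n)) (dq f b z) l.
  have := ncB3 b z (v n); rewrite (ncC b) nv => h4.
  have : `|K| * nc (z - v n) <= `|K| * (nc (z - b) + t n) by rewrite ler_wpM2l.
  have := t0 n; nra.
exists l; apply/cderP => e e0.
have K1 : 0 < `|K| + 1 by lra.
exists (Num.min r (e / (`|K| + 1))); first by rewrite lt_min r0 divr_gt0.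
move=> z; rewrite lt_min ltr_pdivlMr// => /andP[/ltW zr ze].
have [->|zb] := eqVneq z b; first by rewrite !subrr mulr0 subrr nc0 mulr0.
rewrite dqK -mulrBl ncM; apply: ler_wpM2r; first exact: nc_ge0.
apply: (le_trans (lim _ zb zr)); have := nc_ge0 (z - b); lra.
Qed.

Lemma ccont_small f b r : 0 < r -> ccont f b ->
  exists t, [/\ 0 < t, t < r & forall z, nc (z - b) <= t -> nc (f z) <= nc (f b) + 1].
Proof.
move=> r0 /(_ 1 ltr01) [d d0 H].
have m0 : 0 < Num.min d r by rewrite lt_min d0.
have tm : Num.min d r / 2 < Num.min d r by lra.
exists (Num.min d r / 2); split.
- by lra.
- by apply: (lt_le_trans tm); rewrite ge_min lexx orbT.
- move=> z zt; have zd : nc (z - b) < d.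
    by apply: (le_lt_trans zt); apply: (lt_le_trans tm); rewrite ge_min lexx.
  by have := H _ zd; have := ncBge (f z) (f b); lra.
Qed.

(** [dq2_bound] needs a base point [w] other than the singular point. Its constant is independent of
    [w], so continuity of [f] lets [w] tend to the singular point. *)
Lemma removable f b r : 0 < r -> ccont f b ->
  (forall z, z != b -> nc (z - b) < r -> cdiff f z) -> cdiff f b.
Proof.
move=> r0 fb df; apply: cdiff_trans0; set F := fun u : C => f (u + b).
have [t [t0 tr ft]] := ccont_small r0 fb.
have FM z : nc z <= t -> nc (F z) <= nc (f b) + 1 by move=> zt; apply: ft; rewrite addrK.
have hF : hol_off [:: 0] F t.
  split=> [z zt|c]; rewrite in_cons in_nil orbF => z0.
    apply: cdiff_trans; apply: df; last by rewrite addrK; lra.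
    by rewrite -subr_eq0 addrK.
  exists (nc (f b) + 1), t; split=> // z _; rewrite (eqP z0) subr0 => zt.
  exact/FM/ltW.
have M0 : 0 <= nc (f b) + 1 by have := nc_ge0 (f b); lra.
have t2 : t / 2 < t by lra.
have cF : ccont F 0.
  move=> e /fb [d d0 H]; exists d => // z; rewrite subr0 /F add0r => zd.
  by apply: H; rewrite addrK.
apply: (@dq_cauchy_cdiff F 0 (t / 2) (4 * (nc (f b) + 1) / (t - t / 2) ^+ 2)); first lra.
move=> z v z0 v0; rewrite !subr0 => zt vt.
apply: (@ccont_le (fun w => dq F w z - dq F w v)).
  apply: ccontB; apply: ccontM.
  - by apply: ccontB => //; exact: ccont_cst.
  - by apply: ccontV; rewrite ?subr_eq0//; apply: ccontB; [exact: ccont_cst|exact: ccont_id].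
  - by apply: ccontB => //; exact: ccont_cst.
  - by apply: ccontV; rewrite ?subr_eq0//; apply: ccontB; [exact: ccont_cst|exact: ccont_id].
have nz : 0 < nc z by rewrite nc_gt0.
have nv : 0 < nc v by rewrite nc_gt0.
exists (Num.min (nc z) (nc v)); first by rewrite lt_min nz.
move=> w w0; rewrite subr0 lt_min => /andP[wz wv].
apply: (dq2_bound hF) => //; rewrite ?in_cons ?in_nil ?orbF //; try lra.
- by move=> u ut _; apply: FM; lra.
- by apply: contraTneq wv => ->; rewrite ltxx.
- by apply: contraTneq wz => ->; rewrite ltxx.
Qed.

(** The Lipschitz constant of [dq (fn n) b] depends only on the common bound [M] and on [r], hence
    passes to a merely pointwise limit. *)
Lemma weierstrass (fn : nat -> C -> C) f b r M : 0 < r -> 0 <= M ->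
  (exists N : nat, forall n z, (N <= n)%N -> nc (z - b) <= r -> cdiff (fn n) z /\ nc (fn n z) <= M) ->
  (forall z, nc (z - b) <= r -> ccvg (fun n => fn n z) (f z)) ->
  cdiff f b.
Proof.
move=> r0 M0 [N HN] fl; have r2 : r / 2 < r by lra.
apply: (@dq_cauchy_cdiff f b (r / 2) (4 * M / (r - r / 2) ^+ 2)); first lra.
move=> z v zb vb zr vr.
have conv (u : C) : nc (u - b) <= r / 2 -> ccvg (fun n => dq (fn n) b u) (dq f b u).
  move=> ur; have cE n : dq (fn n) b u = (u - b)^-1 * (fn n u - fn n b) by rewrite mulrC.
  apply: (@eq_ccvg (fun n => (u - b)^-1 * (fn n u - fn n b))); first by exists 0%N => n _; rewrite cE.
  rewrite /dq mulrC; apply: ccvgM; apply: ccvgB; apply: fl; first lra.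
  by rewrite subrr nc0 ltW.
apply: (ccvg_le0 (ccvgB (conv _ zr) (conv _ vr))); exists N => n Nn.
pose F (u : C) := fn n (u + b).
have FE (u : C) : dq (fn n) b u = dq F 0 (u - b) by rewrite /dq /F subrK add0r subr0.
rewrite !FE.
have -> : z - v = (z - b) - (v - b) by ring.
apply: (@dq2_bound _ [::]) => //.
- split=> // u ur _; apply: cdiff_trans.
  by apply: (HN n _ Nn _).1; rewrite addrK.
- by move=> u ur _; apply: (HN n _ Nn _).2; rewrite addrK ur.
- by rewrite nc0; lra.
- by lra.
- by rewrite subr_eq0.
- by rewrite subr_eq0.
Qed.

Lemma lip_bound f r M rho : (forall z, nc z <= r -> cdiff f z) ->
  (forall z, nc z = r -> nc (f z) <= M) -> 0 <= M -> rho < r ->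
  forall z w, nc z <= rho -> nc w <= rho -> nc (f z - f w) <= 2 * M / (r - rho) * nc (z - w).
Proof.
move=> df fM M0 rr z w zr wr.
have [->|zw] := eqVneq z w; first by rewrite !subrr nc0 mulr0.
rewrite dqK ncM; apply: ler_wpM2r; first exact: nc_ge0.
apply: (@dq_bound _ [::]) => //; last lra.
- by split=> // u ur _; apply: df.
- by move=> u ur _; apply: fM.
Qed.

End Limits.

(** * The Schwarz-Pick lemma *)

Section SchwarzPick.
Context {R : realType}.
Local Notation C := R[i].
Implicit Types (f g : C -> C) (x y t r M : R) (a z w v b l : C).

(** [G] is the quotient of the disk automorphisms centred at f w and w, taken at f u and u. Its
    first factor has modulus at most 1 by [mobius_identity], the second tends to modulus 1 at the
    boundary. The bound c < 1 keeps 1 - conj(f w) f u away from 0. *)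
Lemma schwarz_pick_strict f c w z : c < 1 -> (forall z, nc z < 1 -> cdiff f z) ->
  (forall z, nc z < 1 -> nc (f z) <= c) -> nc w < 1 -> nc z < 1 ->
  nc (f z - f w) * nc (1 - w^*%C * z) <= nc (1 - (f w)^*%C * f z) * nc (z - w).
Proof.
move=> c1 df fc w1 z1.
have [->|zw] := eqVneq z w; first by rewrite !subrr nc0 mul0r mulr0.
have f1 u : nc u < 1 -> nc (f u) < 1 by move=> /fc; lra.
have nzf u : nc u < 1 -> 1 - (f w)^*%C * f u != 0.
  by move=> u1; apply: nc_unitP; [exact: f1|exact/ltW/f1].
pose G u := (f u - f w) * (1 - w^*%C * u) / ((1 - (f w)^*%C * f u) * (u - w)).
have dconj u : cdiff (fun u => 1 - w^*%C * u) u.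
  apply: cdiffB; first exact: cdiff_cst.
  by apply: cdiffM; [exact: cdiff_cst|exact: cdiff_id].
have G1 : nc (G z) <= 1.
  apply/ler_addgt0Pr => e e0.
  have m0 : 0 < (1 - nc w) / 2 by lra.
  pose m := (1 - nc w) / 2; rewrite -/m in m0.
  have em : 0 < e * m ^+ 2 by rewrite mulr_gt0// exprn_gt0.
  have [r [r1 rw rz rm]] : exists r, [/\ r < 1, m <= r - nc w, nc z < r & 1 - r <= e * m ^+ 2].
    (* With m <= |u - w| and 1 - r <= e m^2, the term (1 - |w|^2) (1 - |u|^2) is at most 2 e |u -
       w|^2, whence |1 - conj(w) u| <= (1 + e) |u - w| on the circle. *)
    exists (Num.max (Num.max ((1 + nc w) / 2) ((1 + nc z) / 2)) (1 - Num.min (1/2) (e * m ^+ 2))).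
    split.
    - rewrite !gt_max gtrBl lt_min em; apply/andP; split; last by rewrite andbT; lra.
      apply/andP; split; lra.
    - rewrite /m lerBrDr !le_max; apply/orP; left; apply/orP; left; lra.
    - rewrite !lt_max; apply/orP; left; apply/orP; right; lra.
    - rewrite lerBlDr -lerBlDl !le_max; apply/orP; right.
      by rewrite lerD2l lerN2 ge_min lexx orbT.
  have rpos : 0 < r by have := nc_ge0 z; lra.
  apply: (@max_principle _ [:: w] _ r) => //.
  - split=> [u ur|b]; rewrite in_cons in_nil orbF => ub.
      have u1 : nc u < 1 by lra.
      apply: cdiffM; first by apply: cdiffM => //; apply: cdiffB; [exact: df|exact: cdiff_cst].
      apply: cdiffV; first by rewrite mulf_neq0 ?nzf ?subr_eq0.
      apply: cdiffM; last by apply: cdiffB; [exact: cdiff_id|exact: cdiff_cst].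
      apply: cdiffB; first exact: cdiff_cst.
      by apply: cdiffM; [exact: cdiff_cst|exact: df].
    move/eqP: ub => ->.
    apply: (@eq_lbound _ (fun u => dq f w u * ((1 - w^*%C * u) / (1 - (f w)^*%C * f u)))).
      by exists 1 => // u _ _; rewrite /G /dq invfM; ring.
    apply: lboundM; first by apply: lbound_dq_diag; exact: df.
    apply/ccont_lbound/cdiff_cont/cdiffM => //.
    apply: cdiffV; first exact: nzf.
    apply: cdiffB; first exact: cdiff_cst.
    by apply: cdiffM; [exact: cdiff_cst|exact: df].
  - move=> u ur _; have u1 : nc u < 1 by lra.
    have h1 := mobius_identity (f w) (f u); have h2 := mobius_identity w u.
    have A1 : nc (f u - f w) <= nc (1 - (f w)^*%C * f u).
      rewrite -ler_sqr ?nnegrE ?nc_ge0//.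
      have := f1 _ u1; have := f1 _ w1; have := nc_ge0 (f u); have := nc_ge0 (f w) => q1 q2 q3 q4.
      rewrite -subr_ge0 h1 mulr_ge0// subr_ge0 expr_le1//; exact: ltW.
    have A2 : nc (1 - w^*%C * u) <= nc (u - w) * (1 + e).
      have mu : m <= nc (u - w) by have := ncBge u w; rewrite ur; lra.
      rewrite -ler_sqr ?nnegrE ?mulr_ge0 ?nc_ge0//; last lra.
      have -> : nc (1 - w^*%C * u) ^+ 2 = nc (u - w) ^+ 2 + (1 - nc w ^+ 2) * (1 - nc u ^+ 2).
        by rewrite -h2; ring.
      have w0 := nc_ge0 w.
      have B1 : (1 - nc w ^+ 2) * (1 - nc u ^+ 2) <= 1 - r ^+ 2.
        rewrite ur ler_piMl ?subr_ge0 ?expr_le1//; try exact: ltW.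
        by rewrite gerBl sqr_ge0.
      have B2 : 1 - r ^+ 2 <= 2 * (e * m ^+ 2) by nra.
      have B3 : m ^+ 2 <= nc (u - w) ^+ 2 by rewrite lerXn2r ?nnegrE ?nc_ge0// ltW.
      have := sqr_ge0 (nc (u - w)); rewrite exprMn; nra.
    rewrite /G !ncM ncV ncM ler_pdivrMr; last first.
      rewrite mulr_gt0// nc_gt0 ?nzf// subr_eq0.
      by apply/eqP => uw; rewrite uw in ur; lra.
    have := ler_pM (nc_ge0 _) (nc_ge0 _) A1 A2.
    by rewrite mulrA [X in _ -> _ <= X]mulrC.
  - lra.
  - by rewrite in_cons in_nil orbF.
move: G1; rewrite /G !ncM ncV ncM ler_pdivrMr ?mul1r//.
by rewrite mulr_gt0// nc_gt0 ?nzf// subr_eq0.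
Qed.

(** The strict version for c f, with c tending to 1. Modulus 1 has to be allowed: the quotient f z /
    z of a rotation attains it. *)
Lemma schwarz_pick f w z : (forall z, nc z < 1 -> cdiff f z) ->
  (forall z, nc z < 1 -> nc (f z) <= 1) -> nc w < 1 -> nc z < 1 ->
  nc (f z - f w) * nc (1 - w^*%C * z) <= nc (1 - (f w)^*%C * f z) * nc (z - w).
Proof.
move=> df f1 w1 z1.
have H c : 0 < c -> c < 1 -> c * (nc (f z - f w) * nc (1 - w^*%C * z)) <=
    (nc (1 - (f w)^*%C * f z) + (1 - c ^+ 2)) * nc (z - w).
  move=> c0 c1.
  have := @schwarz_pick_strict (fun z => c%:C%C * f z) c w z c1.
  have dcf u : nc u < 1 -> cdiff (fun z => c%:C%C * f z) u.
    by move=> u1; apply: cdiffM; [exact: cdiff_cst|exact: df].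
  have bcf u : nc u < 1 -> nc (c%:C%C * f u) <= c.
    by move=> /f1 h; rewrite ncM nc_real gtr0_norm// ler_piMr// ltW.
  move=> /(_ dcf bcf w1 z1); rewrite -mulrBr ncM nc_real gtr0_norm// -mulrA => h.
  apply: (le_trans h); apply: ler_wpM2r; first exact: nc_ge0.
  have -> : 1 - (c%:C%C * f w)^*%C * (c%:C%C * f z) =
      (1 - (f w)^*%C * f z) + (1 - c ^+ 2)%:C%C * ((f w)^*%C * f z).
    by rewrite conjcM conjc_real rmorphB rmorph1 rmorphXn /=; ring.
  rewrite (le_trans (ncD _ _))// lerD2l ncM nc_real ger0_norm; last first.
    by rewrite subr_ge0 expr_le1// ltW.
  apply: ler_piMr; first by rewrite subr_ge0 expr_le1// ltW.
  by rewrite ncM nc_conj mulr_ile1 ?nc_ge0 ?f1.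
set A := _ * _ in H *; set B := nc (1 - _) in H *; set D := nc (z - w) in H *.
have D0 : 0 <= D := nc_ge0 _.
have A0 : 0 <= A by rewrite mulr_ge0 ?nc_ge0.
apply/ler_addgt0Pr => e e0.
have q0 : 0 < A + 2 * D + 1 by lra.
pose d := Num.min (1 / 2) (e / (A + 2 * D + 1)).
have d0 : 0 < d by rewrite lt_min !divr_gt0.
have d1 : d <= 1 / 2 by rewrite ge_min lexx.
have de : d * (A + 2 * D + 1) <= e by rewrite -ler_pdivlMr// ge_min lexx orbT.
have := H (1 - d); have -> : 1 - (1 - d) ^+ 2 = 2 * d - d ^+ 2 by ring.
move=> h; have {}h := h ltac:(lra) ltac:(lra).
have : d ^+ 2 * D >= 0 by rewrite mulr_ge0// sqr_ge0.
nra.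
Qed.

(** Where |f w| is close to 1, f is almost constant on hyperbolic balls around w. Applied to f z /
    z, this spreads closeness to a linear map from one point to a compact set. It rests on |1 -
    conj(f w) f z| <= 1 - |f w|^2 + |f z - f w|. *)
Lemma schwarz_pick_contract f w z (rho : R) : (forall z, nc z < 1 -> cdiff f z) ->
  (forall z, nc z < 1 -> nc (f z) <= 1) -> nc w < 1 -> nc z < 1 ->
  nc (z - w) <= rho * nc (1 - w^*%C * z) -> 0 <= rho -> rho < 1 ->
  nc (f z - f w) <= (1 - nc (f w) ^+ 2) * rho / (1 - rho).
Proof.
move=> df f1 w1 z1 zw r0 r1; have h := schwarz_pick df f1 w1 z1.
have p0 : 0 < nc (1 - w^*%C * z) by rewrite nc_gt0 nc_unitP// ltW.
have h1 : nc (f z - f w) <= nc (1 - (f w)^*%C * f z) * rho.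
  by rewrite -(ler_pM2r p0) (le_trans h)// -mulrA ler_wpM2l// nc_ge0.
have fw := f1 _ w1; have fw0 := nc_ge0 (f w).
have h2 : nc (1 - (f w)^*%C * f z) <= (1 - nc (f w) ^+ 2) + nc (f z - f w).
  have -> : 1 - (f w)^*%C * f z = (1 - nc (f w) ^+ 2)%:C%C - (f w)^*%C * (f z - f w).
    by rewrite rmorphB rmorph1 /= nc_sqr; ring.
  rewrite (le_trans (ncB _ _))// nc_real ger0_norm ?subr_ge0 ?expr_le1// lerD2l.
  by rewrite ncM nc_conj ler_piMl// nc_ge0.
rewrite ler_pdivlMr ?subr_gt0//.
have : nc (1 - (f w)^*%C * f z) * rho <= ((1 - nc (f w) ^+ 2) + nc (f z - f w)) * rho.
  by rewrite ler_wpM2r.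
lra.
Qed.

Lemma schwarz_pick0 f z : (forall z, nc z < 1 -> cdiff f z) ->
  (forall z, nc z < 1 -> nc (f z) <= 1) -> nc z < 1 ->
  nc (f z - f 0) <= nc (1 - (f 0)^*%C * f z) * nc z.
Proof.
move=> df f1 z1; have := @schwarz_pick f 0 z df f1.
by rewrite nc0 ltr01 subr0 conjc0 mul0r subr0 nc1 mulr1 => /(_ isT z1).
Qed.

(** The function [q] in [cder f 0] is f z / z with its continuous value at 0, so [removable] applies
    to it; the bound at 0 follows by continuity from the one elsewhere. *)
Lemma schwarz_quotient f : (forall z, nc z < 1 -> cdiff f z) -> f 0 = 0 ->
  (forall z, nc z < 1 -> nc (f z) <= 1) -> exists k,
  [/\ forall z, nc z < 1 -> cdiff k z, forall z, nc z < 1 -> nc (k z) <= 1,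
      forall z, f z = z * k z & cder f 0 (k 0)].
Proof.
move=> df f0 f1; have /df [l fl] : nc (0 : C) < 1 by rewrite nc0.
have [q [cq q0 fq]] := fl.
have fE z : f z = z * q z by have := fq z; rewrite f0 !subr0 mulrC.
have qE z : z != 0 -> q z = f z / z by move=> z0; rewrite fE mulrC mulKf.
have dq z : nc z < 1 -> cdiff q z.
  have away u : u != 0 -> nc u < 1 -> cdiff q u.
    move=> u0 u1; apply: (@eq_cdiff _ (fun z => f z / z)).
      exists (nc u); rewrite ?nc_gt0// => v vu; rewrite qE//; apply: contraTneq vu => ->.
      by rewrite sub0r ncN ltxx.
    apply: cdiffM; first exact: df.
    by apply: cdiffV => //; exact: cdiff_id.
  have [->|z0] := eqVneq z 0; last exact: away.
  move=> _; apply: (@removable _ q 0 1) => // v v0; rewrite subr0; exact: away.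
exists q; split=> //; last by rewrite q0.
have bnd z : z != 0 -> nc z < 1 -> nc (q z) <= 1.
  move=> z0 z1; have nz : 0 < nc z by rewrite nc_gt0.
  have := @schwarz_pick0 f z df f1 z1.
  by rewrite f0 subr0 conjc0 mul0r subr0 nc1 mul1r fE ncM ger_pMr.
move=> z z1; have [->|z0] := eqVneq z 0; last exact: bnd.
apply: ccont_le => //; exists 1 => // u u0; rewrite subr0; exact: bnd.
Qed.

End SchwarzPick.

(** * Surjectivity of small perturbations of the identity *)

Section Covering.
Context {R : realType}.
Local Notation C := R[i].

(* Banach iteration z |-> y - E z. *)
Lemma covering (E : C -> C) (rho eps : R) (y : C) : 0 < rho -> 0 <= eps < 1 -> E 0 = 0 ->
  (forall z w, nc z <= rho -> nc w <= rho -> nc (E z - E w) <= eps * nc (z - w)) ->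
  nc y <= (1 - eps) * rho -> exists2 z, nc z <= rho & z + E z = y.
Proof.
move=> r0 /andP[e0 e1] E0 lipE yr.
pose u := fix u n := if n is m.+1 then y - E (u m) else 0.
have ur n : nc (u n) <= rho.
  elim: n => [|n IH]; first by rewrite nc0 ltW.
  rewrite (le_trans (ncB _ _))//.
  have := lipE _ 0 IH; rewrite nc0 E0 !subr0 => /(_ (ltW r0)) h.
  have : eps * nc (u n) <= eps * rho by rewrite ler_wpM2l.
  lra.
have step n : nc (u n.+1 - u n) <= eps ^+ n * rho.
  elim: n => [|n IH]; first by rewrite expr0 mul1r subr0; exact: (ur 1%N).
  have -> : u n.+2 - u n.+1 = E (u n) - E (u n.+1).
    by rewrite [u n.+2]/= [X in _ - X = _]/=; rewrite -/(u n); ring.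
  rewrite (le_trans (lipE _ _ (ur _) (ur _)))// ncC exprS -mulrA ler_wpM2l//.
have tail n m : nc (u (n + m)%N - u n) <= eps ^+ n * (rho / (1 - eps)).
  have : nc (u (n + m)%N - u n) <= eps ^+ n * (rho * (1 - eps ^+ m) / (1 - eps)).
    elim: m => [|m IH]; first by rewrite addn0 !subrr nc0 mulr0 mul0r mulr0.
    rewrite addnS; apply: (le_trans (ncB3 (u (n + m)%N) _ _)).
    apply: (le_trans (lerD (step _) IH)); rewrite exprD exprS.
    rewrite le_eqVlt; apply/orP; left; apply/eqP; field; lra.
  move=> /le_trans; apply; rewrite ler_wpM2l ?exprn_ge0//.
  rewrite ler_wpM2r ?invr_ge0 ?subr_ge0 ?(ltW e1)// ler_piMr ?(ltW r0)//.
  by rewrite gerBl exprn_ge0.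
have [l ul] : exists l, ccvg u l.
  apply: ccauchy_cvg => e e_0.
  have q0 : 0 < e / (2 * (rho / (1 - eps)) + 1).
    by rewrite divr_gt0// ltr_wpDl// mulr_ge0// divr_ge0 ?subr_ge0 ?(ltW r0) ?(ltW e1).
  have /cvgrPdist_lt/(_ _ q0) [N _ HN] : (fun n => eps ^+ n) @ \oo --> (0 : R).
    by apply: cvg_expr; rewrite ger0_norm.
  have := HN N (leqnn _); rewrite /= sub0r normrN ger0_norm ?exprn_ge0//.
  have q1 : 0 < 2 * (rho / (1 - eps)) + 1.
    by rewrite ltr_wpDl// mulr_ge0// divr_ge0 ?subr_ge0 ?(ltW r0) ?(ltW e1).
  rewrite ltr_pdivlMr// => hN.
  exists N => n m nN mN.
  have hn := tail N (n - N)%N; have hm := tail N (m - N)%N.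
  rewrite subnKC// in hn; rewrite subnKC// in hm.
  apply: (le_lt_trans (ncB3 (u N) _ _)); rewrite (ncC (u N)).
  have : 0 <= eps ^+ N by rewrite exprn_ge0.
  lra.
exists l; first by apply: (ccvg_le0 ul); exists 0%N => n _; exact: ur.
have lr : nc l <= rho by apply: (ccvg_le0 ul); exists 0%N => n _; exact: ur.
have S : ccvg (fun n => u n.+1) l.
  by move=> e /ul [N HN]; exists N => n nN; apply: HN; rewrite (leq_trans nN).
have S' : ccvg (fun n => u n.+1) (y - E l).
  move=> e /ul [N HN]; exists N => n /HN h.
  have -> : u n.+1 - (y - E l) = E l - E (u n) by rewrite /=; ring.
  by apply: le_lt_trans h; rewrite (le_trans (lipE _ _ lr (ur _)))// ncC ler_piMl ?nc_ge0// ltW.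
by rewrite {1}(ccvg_unique S S') subrK.
Qed.

End Covering.

(** * Self-maps of the disk fixing the origin *)

Section SelfMaps.
Context {R : realType}.
Local Notation C := R[i].
Variables (f : C -> C) (l : C).
Hypothesis df : forall z, nc z < 1 -> cdiff f z.
Hypothesis f0 : f 0 = 0.
Hypothesis f1 : forall z, nc z < 1 -> nc (f z) < 1.
Hypothesis fl : cder f 0 l.

Let f1' z : nc z < 1 -> nc (f z) <= 1.
Proof. by move=> /f1/ltW. Qed.

Lemma selfmap_quotient : exists k,
  [/\ forall z, nc z < 1 -> cdiff k z, forall z, nc z < 1 -> nc (k z) <= 1,
      forall z, f z = z * k z & k 0 = l].
Proof.
have [k [dk k1 fk fk0]] := schwarz_quotient df f0 f1'.
by exists k; split=> //; apply: cder_unique fl.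
Qed.

Lemma schwarz_lemma z : nc z < 1 -> nc (f z) <= nc z.
Proof.
move=> z1; have [k [_ k1 -> _]] := selfmap_quotient.
by rewrite ncM ler_piMr ?nc_ge0 ?k1.
Qed.

Lemma selfmap_deriv_le1 : nc l <= 1.
Proof. by have [k [_ k1 _ <-]] := selfmap_quotient; apply: k1; rewrite nc0. Qed.

Lemma selfmap_near_linear z : nc z < 1 ->
  nc (f z - l * z) <= (1 - nc l ^+ 2) * nc z ^+ 2 / (1 - nc z).
Proof.
move=> z1; have [k [dk k1 fk k0]] := selfmap_quotient.
have z0 := nc_ge0 z.
have := @schwarz_pick_contract _ k 0 z (nc z) dk k1.
rewrite nc0 ltr01 conjc0 mul0r !subr0 nc1 mulr1 k0 => /(_ isT z1 (lexx _) z0 z1) h.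
have -> : f z - l * z = z * (k z - l) by rewrite fk; ring.
rewrite ncM (_ : _ / _ = nc z * ((1 - nc l ^+ 2) * nc z / (1 - nc z))); last by ring.
by rewrite ler_wpM2l.
Qed.

(** Koebe's x / (1 - x)^2 would not do for steps of finite length: there the growth factor (m + x)
    (1 + m x) / (1 + x)^2 exceeds m by x (1 - m)^2 / (1 + x)^2. With exponent 3 the factor is at
    most m for m >= 1/2, so the bounds compose without loss. *)
Definition growth_fun (x : R) := x / (1 - x) ^+ 3.

Lemma growth_fun_ge x : 0 <= x -> x < 1 -> x <= growth_fun x.
Proof.
move=> x0 x1; rewrite ler_pdivlMr ?exprn_gt0 ?subr_gt0// ler_piMr//.
by rewrite exprn_ile1// ?subr_ge0 ?gerBl// ltW.
Qed.

Lemma growth_fun_mono x y : 0 <= x -> x <= y -> y < 1 -> growth_fun x <= growth_fun y.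
Proof.
move=> x0 xy y1; have x1 : x < 1 by lra.
apply: ler_pM => //; first by rewrite invr_ge0 exprn_ge0// subr_ge0 ltW.
rewrite lef_pV2 ?posrE ?exprn_gt0 ?subr_gt0//.
by rewrite lerXn2r ?nnegrE; lra.
Qed.

(* With x = |z|, m = |l| and y = x (m + x) / (1 + m x) one has
   growth_fun y = growth_fun x * (m + x) (1 + m x)^2 / (1 + x)^3, and the last
   factor is at most m when 1/2 <= m <= 1. *)
Lemma selfmap_growth z : 1 / 2 <= nc l -> nc z < 1 ->
  growth_fun (nc (f z)) <= nc l * growth_fun (nc z).
Proof.
move=> l2 z1; have [k [dk k1 fk k0]] := selfmap_quotient.
have := schwarz_pick0 dk k1 z1; rewrite k0.
have l1 := selfmap_deriv_le1; have l0 := nc_ge0 l; have z0 := nc_ge0 z.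
set m := nc l in l0 l1 l2 *; set x := nc z in z1 z0 * => h.
have kz := k1 _ z1; have kz0 := nc_ge0 (k z).
have q0 : 0 < 1 + m * x by nra.
(* The hyperbolic triangle inequality |k z| <= (m + x) / (1 + m x), obtained from Schwarz-Pick at 0
   by comparing [mobius_identity] with its version for the moduli. *)
have kap : nc (k z) * (1 + m * x) <= m + x.
  set p := nc (k z) in kz kz0 *.
  have pm1 : p * m <= 1 by rewrite mulr_ile1//; lra.
  have pmx : p * m * x <= x by rewrite ler_piMl.
  have [pm|mp] := leP p m; first by rewrite mulrDr mulr1 mulrA lerD.
  have h1 := mobius_identity l (k z); rewrite -/m -/p in h1.
  have h2 : p - m <= nc (k z - l) by exact: ncBge.
  set A := nc (k z - l) in h h1 h2; set B := nc (1 - _) in h h1.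
  have B0 : 0 <= B := nc_ge0 _; have A0 : 0 <= A by lra.
  have ml1 : 0 <= 1 - m * p by rewrite subr_ge0 mulrC.
  have e1 : (1 - m ^+ 2) * (1 - p ^+ 2) = (1 - m * p) ^+ 2 - (p - m) ^+ 2 by ring.
  have h3 : A ^+ 2 <= B ^+ 2 * x ^+ 2 by rewrite -exprMn ler_sqr ?nnegrE ?mulr_ge0.
  have h4 : (p - m) ^+ 2 <= A ^+ 2 by rewrite ler_sqr ?nnegrE// subr_ge0 ltW.
  have x2 : 0 <= x ^+ 2 <= 1 by rewrite sqr_ge0 expr_le1// ltW.
  have h5 : (p - m) ^+ 2 <= x ^+ 2 * (1 - m * p) ^+ 2.
    have e2 : B ^+ 2 = A ^+ 2 + ((1 - m * p) ^+ 2 - (p - m) ^+ 2) by rewrite -e1 -h1; ring.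
    have aux (a b c y : R) : a <= (a + (c - b)) * y -> b <= a -> 0 <= y <= 1 -> b <= y * c.
      drop_ineqs=> q1 q2 /andP[y0 y1].
      have : 0 <= (a - b) * (1 - y) by apply: mulr_ge0; lra.
      nra.
    by rewrite e2 in h3; exact: aux h3 h4 x2.
  have : p - m <= x * (1 - m * p).
    by rewrite -ler_sqr ?nnegrE ?mulr_ge0// ?exprMn// subr_ge0 ltW.
  by drop_ineqs; lra.
have fz : nc (f z) = x * nc (k z) by rewrite fk ncM.
have f1z := f1 z1.
pose y := x * (m + x) / (1 + m * x).
have y0 : 0 <= y by rewrite /y divr_ge0 ?mulr_ge0 ?(ltW q0)// addr_ge0.
have y1E : 1 - y = (1 - x ^+ 2) / (1 + m * x) by rewrite /y; field; rewrite gt_eqF.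
have y1 : y < 1 by rewrite -subr_gt0 y1E divr_gt0// subr_gt0 expr_lt1.
have fy : nc (f z) <= y.
  by rewrite fz /y -mulrA ler_wpM2l// ler_pdivlMr.
apply: (le_trans (growth_fun_mono (nc_ge0 _) fy y1)).
rewrite /growth_fun y1E.
have e1 : y / ((1 - x ^+ 2) / (1 + m * x)) ^+ 3 =
    (x / (1 - x) ^+ 3) * ((m + x) * (1 + m * x) ^+ 2 / (1 + x) ^+ 3).
  rewrite /y (_ : 1 - x ^+ 2 = (1 - x) * (1 + x)); last ring.
  have c1 : 1 - x != 0 by rewrite gt_eqF// subr_gt0.
  have c2 : 1 + x != 0 by rewrite gt_eqF// ltr_wpDr.
  have c3 : 1 + m * x != 0 by rewrite gt_eqF.
  by field; rewrite c1 c2 c3.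
rewrite e1 mulrC; apply: ler_wpM2r.
  by rewrite divr_ge0// exprn_ge0// subr_ge0 ltW.
rewrite ler_pdivrMr ?exprn_gt0 ?ltr_wpDr//.
rewrite -subr_ge0.
have -> : m * (1 + x) ^+ 3 - (m + x) * (1 + m * x) ^+ 2 =
  x * ((2 * m - 1) * (1 - m)) + x ^+ 2 * (m * (1 - m ^+ 2)) + x ^+ 3 * (m * (1 - m)) by ring.
have m2 : m ^+ 2 <= 1 by rewrite expr_le1.
have m21 : 1 <= 2 * m by move: l2; drop_ineqs; lra.
by rewrite !addr_ge0 ?mulr_ge0 ?exprn_ge0 ?subr_ge0.
Qed.

(** The map is l z plus an error whose Lipschitz constant on |z| <= r is at most 8 (1 - |l|^2) / (1
    - r)^2. The hypothesis with 64 makes this at most 1/4 and |l| at least 63/64, which leaves more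
    than 1/2. *)
Lemma selfmap_lower_lip r : r < 1 -> 1 - (1 - r) ^+ 2 / 64 <= nc l ->
  forall z w, nc z <= r -> nc w <= r -> nc (z - w) / 2 <= nc (f z - f w).
Proof.
move=> r1 lr z w zr wr; have r0 : 0 <= r by rewrite (le_trans _ zr) ?nc_ge0.
have l1 := selfmap_deriv_le1.
pose E u := f u - l * u.
pose r' := (1 + r) / 2; pose M := (1 - nc l ^+ 2) * 2 / (1 - r).
have l2 : 0 <= 1 - nc l ^+ 2 by rewrite subr_ge0 expr_le1// nc_ge0.
have M0 : 0 <= M by rewrite divr_ge0 ?mulr_ge0// subr_ge0 ltW.
have r'1 : r' < 1 by rewrite /r'; lra.
have rr' : r < r' by rewrite /r'; lra.
have dE u : nc u <= r' -> cdiff E u.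
  move=> ur; apply: cdiffB; first by apply: df; lra.
  by apply: cdiffM; [exact: cdiff_cst|exact: cdiff_id].
have EM u : nc u = r' -> nc (E u) <= M.
  move=> ur; have u1 : nc u < 1 by rewrite ur.
  apply: (le_trans (selfmap_near_linear u1)); rewrite ur.
  have c1 : 1 - r != 0 by rewrite gt_eqF// subr_gt0.
  have -> : (1 - nc l ^+ 2) * r' ^+ 2 / (1 - r') = r' ^+ 2 * M.
    by rewrite /M (_ : 1 - r' = (1 - r) / 2); [field|rewrite /r'; field].
  by rewrite ler_piMl// expr_le1 ?(ltW r'1)// (le_trans r0 (ltW rr')).
have := lip_bound dE EM M0 rr' zr wr.
have -> : 2 * M / (r' - r) = 8 * (1 - nc l ^+ 2) / (1 - r) ^+ 2.
  by rewrite /M /r'; field; lra.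
have : 8 * (1 - nc l ^+ 2) / (1 - r) ^+ 2 <= 1 / 4.
  rewrite ler_pdivrMr ?exprn_gt0 ?subr_gt0//.
  have := nc_ge0 l; nra.
set q := _ / _ => q4 h.
have lz : nc (l * (z - w)) <= nc (f z - f w) + nc (E z - E w).
  have -> : l * (z - w) = (f z - f w) - (E z - E w) by rewrite /E; ring.
  exact: ncB.
rewrite ncM in lz; have n0 := nc_ge0 (z - w).
have : (1 - r) ^+ 2 <= 1 by rewrite expr_le1 ?subr_ge0 ?gerBl// ltW.
have : q * nc (z - w) <= 1 / 4 * nc (z - w) by rewrite ler_wpM2r.
nra.
Qed.

End SelfMaps.

(** * Evolution families fixing the origin *)

(** Induction on the number of pieces of length d / 2. One step length d for all of [0, T] makes
    short-step estimates usable on long intervals. *)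
Lemma interval_chain (R : realType) (P : R -> R -> Prop) (T d : R) : 0 < d ->
  (forall s u t, 0 <= s -> s <= u -> u <= t -> t <= T -> P s u -> P u t -> P s t) ->
  (forall s t, 0 <= s -> s <= t -> t <= T -> t - s < d -> P s t) ->
  forall s t, 0 <= s -> s <= t -> t <= T -> P s t.
Proof.
move=> d0 Pcomp Pbase s t s0 st tT.
have : exists n : nat, t - s < n.+1%:R * (d / 2).
  have q0 : 0 <= (t - s) / (d / 2) by rewrite divr_ge0 ?subr_ge0//; lra.
  exists (Num.bound ((t - s) / (d / 2))).
  rewrite -ltr_pdivrMr; last lra.
  by rewrite (lt_trans (archi_boundP q0))// ltr_nat.
move=> [n]; elim: n s s0 st => [|n IH] s s0 st h; first by apply: Pbase => //; lra.
have [h'|h'] := ltP (t - s) d; first exact: Pbase.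
apply: (Pcomp s (s + d / 2)) => //; try lra; first by apply: Pbase; lra.
by apply: IH; try lra; rewrite -[n.+2%:R]natr1 in h; lra.
Qed.

(* The evolution family after moving the orbit of 0 to 0 by disk automorphisms;
   lam s t is the derivative of psi s t at 0. *)
Record normalized_evolution (R : realType) (psi : R -> R -> R[i] -> R[i])
    (lam : R -> R -> R[i]) (beta : R) : Prop := NormalizedEvolution {
  psi_diff : forall s t z, 0 <= s -> s <= t -> nc z < 1 -> cdiff (psi s t) z;
  psi_self : forall s t z, 0 <= s -> s <= t -> nc z < 1 -> nc (psi s t z) < 1;
  psi0 : forall s t, 0 <= s -> s <= t -> psi s t 0 = 0;
  psi_lam : forall s t, 0 <= s -> s <= t -> cder (psi s t) 0 (lam s t);
  psi_id : forall s z, 0 <= s -> nc z < 1 -> psi s s z = z;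
  psi_comp : forall s u t z, 0 <= s -> s <= u -> u <= t -> nc z < 1 ->
    psi s t z = psi u t (psi s u z);
  lam_cont : forall T e : R, 0 < e -> exists2 d : R, 0 < d &
    forall s t, 0 <= s -> s <= t -> t <= T -> t - s < d -> 1 - e <= nc (lam s t);
  lam_beta : forall e : R, 0 < e -> exists T : R,
    forall t, T <= t -> `|nc (lam 0 t) - beta| < e
}.

Section NormalizedEvolution.
Context {R : realType}.
Local Notation C := R[i].
Variables (psi : R -> R -> C -> C) (lam : R -> R -> C) (beta : R).
Hypothesis NE : normalized_evolution psi lam beta.

Let psi_diff := psi_diff NE.
Let psi_self := psi_self NE.
Let psi0 := psi0 NE.
Let psi_lam := psi_lam NE.
Let psi_id := psi_id NE.
Let psi_comp := psi_comp NE.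
Let lam_cont := lam_cont NE.
Let lam_beta := lam_beta NE.

Let nc01 : nc (0 : C) < 1. Proof. by rewrite nc0. Qed.

Let dpsi s t (s0 : 0 <= s) (st : s <= t) z : nc z < 1 -> cdiff (psi s t) z.
Proof. exact: psi_diff. Qed.

Let spsi s t (s0 : 0 <= s) (st : s <= t) z : nc z < 1 -> nc (psi s t z) < 1.
Proof. exact: psi_self. Qed.

Lemma psi_schwarz s t z : 0 <= s -> s <= t -> nc z < 1 -> nc (psi s t z) <= nc z.
Proof.
move=> s0 st.
exact: (schwarz_lemma (dpsi s0 st) (psi0 s0 st) (spsi s0 st) (psi_lam s0 st)).
Qed.

Lemma lam_comp s u t : 0 <= s -> s <= u -> u <= t -> lam s t = lam u t * lam s u.
Proof.
move=> s0 su ut; have u0 : 0 <= u by lra.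
apply: (@cder_unique _ (psi s t) 0); first by apply: psi_lam => //; lra.
apply: (@eq_cder _ (fun z => psi u t (psi s u z))).
  by exists 1 => // z; rewrite subr0 => z1; rewrite -psi_comp.
by apply: cder_comp; [exact: psi_lam|rewrite psi0//; exact: psi_lam].
Qed.

Lemma lam_le1 s t : 0 <= s -> s <= t -> nc (lam s t) <= 1.
Proof.
move=> s0 st.
exact: (selfmap_deriv_le1 (dpsi s0 st) (psi0 s0 st) (spsi s0 st) (psi_lam s0 st)).
Qed.

Lemma lam_gt0 s t : 0 <= s -> s <= t -> 0 < nc (lam s t).
Proof.
move=> s0 st; have h2 : (0 : R) < 1 / 2 by lra.
have [d d0 Hd] := lam_cont t h2.
apply: (@interval_chain _ (fun s t => 0 < nc (lam s t)) t d) => //.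
- move=> {}s u {st}t' {}s0 su ut _ h h'; rewrite (lam_comp s0 su ut) ncM; exact: mulr_gt0.
- by move=> a b a0 ab bt bd; have := Hd a b a0 ab bt bd; lra.
Qed.

Lemma lam_neq0 s t : 0 <= s -> s <= t -> lam s t != 0.
Proof. by move=> s0 st; rewrite -nc_gt0 lam_gt0. Qed.

Lemma psi_growth s t z : 0 <= s -> s <= t -> nc z < 1 ->
  growth_fun (nc (psi s t z)) <= nc (lam s t) * growth_fun (nc z).
Proof.
move=> s0 st; have h2 : (0 : R) < 1 / 2 by lra.
have [d d0 Hd] := lam_cont t h2.
move: z; apply: (@interval_chain _ (fun s t => forall z, nc z < 1 ->
   growth_fun (nc (psi s t z)) <= nc (lam s t) * growth_fun (nc z)) t d) => //.
- move=> {}s u {st}t' {}s0 su ut _ h h' z z1.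
  rewrite (lam_comp s0 su ut) ncM (psi_comp s0 su ut z1).
  apply: (le_trans (h' _ (psi_self s0 su z1))).
  by rewrite -mulrA ler_wpM2l ?nc_ge0// h.
- move=> a b a0 ab bt bd z z1.
  apply: (selfmap_growth (dpsi a0 ab) (psi0 a0 ab) (spsi a0 ab) (psi_lam a0 ab)) => //.
  by have := Hd a b a0 ab bt bd; lra.
Qed.

(** Each short step loses at most a factor 2, and Schwarz's lemma keeps the points in |z| <= r for
    the next one. The constant depends on s and t, which injectivity tolerates. *)
Lemma psi_lower_lip s t r : 0 <= s -> s <= t -> r < 1 -> exists2 c : R, 0 < c &
  forall z w, nc z <= r -> nc w <= r -> c * nc (z - w) <= nc (psi s t z - psi s t w).
Proof.
move=> s0 st r1.
have h2 : 0 < (1 - r) ^+ 2 / 64 by rewrite divr_gt0// exprn_gt0// subr_gt0.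
have [d d0 Hd] := lam_cont t h2.
apply: (@interval_chain _ (fun s t => exists2 c : R, 0 < c &
  forall z w, nc z <= r -> nc w <= r -> c * nc (z - w) <= nc (psi s t z - psi s t w)) t d) => //.
- move=> {}s u {st}t' {}s0 su ut _ [c c0 h] [c' c'0 h'].
  exists (c' * c); first exact: mulr_gt0.
  move=> z w zr wr; have z1 : nc z < 1 by lra.
  have w1 : nc w < 1 by lra.
  rewrite (psi_comp s0 su ut z1) (psi_comp s0 su ut w1) -mulrA.
  apply: le_trans (h' _ _ _ _); first by rewrite ler_pM2l// h.
    by rewrite (le_trans (psi_schwarz _ _ _)).
  by rewrite (le_trans (psi_schwarz _ _ _)).
- move=> a b a0 ab bt bd; exists (1 / 2) => // z w zr wr.
  rewrite mul1r mulrC.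
  apply: (selfmap_lower_lip (dpsi a0 ab) (psi0 a0 ab) (spsi a0 ab) (psi_lam a0 ab) r1) => //.
  exact: Hd.
Qed.

Local Notation L t := (nc (lam 0 t)).

Lemma L_gt0 t : 0 <= t -> 0 < L t.
Proof. by move=> t0; exact: lam_gt0. Qed.

Lemma L_comp s t : 0 <= s -> s <= t -> L t = nc (lam s t) * L s.
Proof. by move=> s0 st; rewrite (lam_comp (lexx 0) s0 st) ncM. Qed.

Lemma L_mono s t : 0 <= s -> s <= t -> L t <= L s.
Proof. by move=> s0 st; rewrite (L_comp s0 st) ler_piMl ?nc_ge0 ?lam_le1. Qed.

Lemma L_ge_beta t : 0 <= t -> beta <= L t.
Proof.
move=> t0; apply/ler_addgt0Pr => e /lam_beta [T HT].
have := HT (Num.max T t); rewrite le_max lexx => /(_ isT).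
have := @L_mono t (Num.max T t) t0; rewrite le_max lexx orbT => /(_ isT).
by rewrite ltr_norml => h /andP[h1 h2]; lra.
Qed.

Lemma beta_ge0 : 0 <= beta.
Proof.
rewrite leNgt; apply/negP => b0; have e0 : 0 < - beta by lra.
have [T HT] := lam_beta e0; have := HT T (lexx _); have := nc_ge0 (lam 0 T).
by rewrite ltr_norml => h /andP[h1 h2]; lra.
Qed.

Lemma L0 : L 0 = 1.
Proof.
have h : 0 <= (0 : R) by [].
have -> : lam 0 0 = 1; last exact: nc1.
apply: (@cder_unique _ (psi 0 0) 0); first exact: psi_lam.
apply: (@eq_cder _ id); last exact: cder_id.
by exists 1 => // z; rewrite subr0 => z1; rewrite psi_id.
Qed.

Lemma L_close e : 0 < e -> exists2 T : R, 0 <= T & forall t, T <= t -> L t < beta + e.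
Proof.
move=> /lam_beta [T HT]; exists (Num.max 0 T); first by rewrite le_max lexx.
move=> t; rewrite ge_max => /andP[_ /HT]; rewrite ltr_norml => /andP[_ h]; lra.
Qed.

Lemma psi_le s t z : 0 <= s -> s <= t -> nc z < 1 ->
  nc (psi s t z) <= nc (lam s t) * growth_fun (nc z).
Proof.
move=> s0 st z1; apply: le_trans (psi_growth s0 st z1).
by apply: growth_fun_ge; [exact: nc_ge0|exact: psi_self].
Qed.

(* The factor 1 - |lam s t| is what makes the normalised maps psi s n / lam 0 n
   a Cauchy sequence, both for beta = 0 and for beta > 0. *)
Lemma psi_near_linear s t z r : 0 <= s -> s <= t -> r < 1 -> nc z <= r ->
  nc (psi s t z - lam s t * z) <=
  64 / (1 - r) ^+ 4 * (nc (lam s t) * (1 - nc (lam s t))) * nc z ^+ 2.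
Proof.
move=> s0 st r1 zr; have z1 : nc z < 1 by lra.
have z0 := nc_ge0 z; have l0 := lam_gt0 s0 st; have l1 := lam_le1 s0 st.
have p0 := psi0 s0 st; have pl := psi_lam s0 st.
set l := nc (lam s t) in l0 l1 *.
have r0 : 0 < 1 - r by lra.
have r4 : 0 < (1 - r) ^+ 4 by rewrite exprn_gt0.
(* For l >= 1/2 the factor l is harmless, as 1 - l^2 <= 4 l (1 - l). For l < 1/2 the factor 1 - l is
   harmless, and l comes from the growth bound for psi s t z / z on the circle of radius (1 + r) /
   2. *)
have [l2|l2] := leP (1 / 2) l.
  apply: (le_trans (selfmap_near_linear (dpsi s0 st) p0 (spsi s0 st) pl z1)); rewrite -/l.
  have -> : (1 - l ^+ 2) * nc z ^+ 2 / (1 - nc z) = (1 - l ^+ 2) / (1 - nc z) * nc z ^+ 2 by ring.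
  apply: ler_wpM2r; first exact: sqr_ge0.
  rewrite ler_pdivrMr; last lra.
  have h : 1 <= 1 / (1 - r) ^+ 4 * (1 - nc z).
    rewrite mulrAC ler_pdivlMr// !mul1r.
    apply: (@le_trans _ _ (1 - r)); last lra.
    by rewrite exprS ler_piMr ?(ltW r0)// exprn_ile1//; lra.
  have -> : 64 / (1 - r) ^+ 4 * (l * (1 - l)) * (1 - nc z) =
    (64 * (l * (1 - l))) * (1 / (1 - r) ^+ 4 * (1 - nc z)) by ring.
  have q : 0 <= l * (1 - l) by rewrite mulr_ge0//; lra.
  apply: (@le_trans _ _ (64 * (l * (1 - l)))); first nra.
  by rewrite ler_peMr// mulr_ge0.
have [k [dk k1 fk k0]] := selfmap_quotient (dpsi s0 st) p0 (spsi s0 st) pl.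
have [->|zn0] := eqVneq z 0.
  by rewrite p0 mulr0 subrr nc0 expr0n mulr0.
have zp : 0 < nc z by rewrite nc_gt0.
pose r' := (1 + r) / 2; have r'1 : r' < 1 by rewrite /r'; lra.
have rr' : r < r' by rewrite /r'; lra.
have r'0 : 0 < r' by rewrite /r'; lra.
pose M := l * (8 / (1 - r) ^+ 3).
have M0 : 0 <= M by rewrite mulr_ge0 ?divr_ge0 ?exprn_ge0// ltW.
have kM u : nc u = r' -> nc (k u) <= M.
  move=> ur; have u1 : nc u < 1 by lra.
  have := psi_le s0 st u1; rewrite fk ncM ur /growth_fun -/l => h.
  have : nc (k u) <= l / (1 - r') ^+ 3.
    by rewrite -(ler_pM2l r'0) (le_trans h)//; rewrite mulrCA mulrA.
  move/le_trans; apply; rewrite /M.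
  rewrite ler_wpM2l ?(ltW l0)// (_ : 1 - r' = (1 - r) / 2); last by rewrite /r'; field.
  rewrite le_eqVlt; apply/orP; left; apply/eqP; field; lra.
have nc0r : nc (0 : C) <= r by rewrite nc0; lra.
have dk' u : nc u <= r' -> cdiff k u by move=> ur; apply: dk; lra.
have := lip_bound dk' kM M0 rr' zr nc0r; rewrite subr0 => h.
have -> : psi s t z - lam s t * z = z * (k z - k 0) by rewrite fk k0; ring.
have zz : nc z ^+ 2 = nc z * nc z by rewrite expr2.
rewrite ncM zz mulrA mulrC; apply: ler_wpM2r => //.
apply: (le_trans h); apply: ler_wpM2r => //.
have -> : 2 * M / (r' - r) = 64 / (1 - r) ^+ 4 * (l * (1 / 2)) by rewrite /M /r'; field; lra.
by rewrite ler_wpM2l ?divr_ge0 ?(ltW r4)// ler_wpM2l ?(ltW l0)//; lra.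
Qed.

(** Dividing by [lam 0 t] instead of [lam s t] makes these maps compatible with composition before
    the limit: gmap s t = gmap u t o psi s u. *)
Definition gmap s t z := psi s t z / lam 0 t.

(** With w = psi s a z of size at most G L a / L s, [psi_near_linear] gives an error of order (L b /
    L a) (1 - L b / L a) (L a)^2 = L b (L a - L b). Division by L b leaves L a - L b, small because
    L converges. *)
Lemma gmap_diff s a b z r : 0 <= s -> s <= a -> a <= b -> r < 1 -> nc z <= r ->
  nc (gmap s b z - gmap s a z) <=
  64 / (1 - r) ^+ 4 * growth_fun r ^+ 2 * (L a - L b) / L s ^+ 2.
Proof.
move=> s0 sa ab r1 zr; have a0 : 0 <= a by lra.
have z1 : nc z < 1 by lra.
have b0 : 0 <= b by lra.
pose w := psi s a z.
have wr : nc w <= r by rewrite (le_trans (psi_schwarz _ _ _)).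
have h := psi_near_linear a0 ab r1 wr.
have la := lam_neq0 (lexx 0) a0; have lab := lam_neq0 a0 ab.
have -> : gmap s b z - gmap s a z = (psi a b w - lam a b * w) / (lam a b * lam 0 a).
  by rewrite /gmap (psi_comp s0 sa ab z1) -/w (lam_comp (lexx 0) a0 ab); field; rewrite la lab.
rewrite ncM ncV ncM -(L_comp a0 ab).
have Lb := L_gt0 b0; have La := L_gt0 a0; have Ls := L_gt0 s0.
rewrite ler_pdivrMr// (le_trans h)//.
have w2 : nc w <= L a / L s * growth_fun r.
  have LL : nc (lam s a) = L a / L s by rewrite (L_comp s0 sa) mulfK// gt_eqF.
  rewrite -LL (le_trans (psi_le s0 sa z1))// ler_wpM2l ?nc_ge0//.
  by apply: growth_fun_mono => //; exact: nc_ge0.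
have w0 := nc_ge0 w.
have w3 : nc w ^+ 2 <= (L a / L s * growth_fun r) ^+ 2.
  by rewrite ler_sqr ?nnegrE ?(le_trans w0).
have E : nc (lam a b) = L b / L a by rewrite (L_comp a0 ab) mulfK// gt_eqF.
have q : 0 <= 64 / (1 - r) ^+ 4 * (nc (lam a b) * (1 - nc (lam a b))).
  by rewrite mulr_ge0 ?divr_ge0 ?exprn_ge0 ?mulr_ge0 ?nc_ge0 ?subr_ge0 ?lam_le1//; lra.
apply: (le_trans (ler_wpM2l q w3)); rewrite E.
rewrite le_eqVlt; apply/orP; left; apply/eqP; move: (growth_fun r) => G; field.
by rewrite !gt_eqF//; lra.
Qed.

End NormalizedEvolution.

(** * The limit chain of the centred family *)

Section Chain.
Context {R : realType}.
Local Notation C := R[i].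
Variables (psi : R -> R -> C -> C) (lam : R -> R -> C) (beta : R).
Hypothesis NE : normalized_evolution psi lam beta.
Local Notation L t := (nc (lam 0 t)).

Lemma nat_above (T : R) : exists N : nat, forall n, (N <= n)%N -> T <= n%:R.
Proof.
exists (Num.bound `|T|) => n Nn; apply: (le_trans (ler_norm T)).
apply/ltW/(lt_le_trans (archi_boundP (normr_ge0 T))).
by rewrite ler_nat.
Qed.

Lemma chain_limit s z : 0 <= s -> nc z < 1 ->
  exists l, ccvg (fun n => gmap psi lam s n%:R z) l.
Proof.
move=> s0 z1; apply: ccauchy_cvg => e e0.
pose r := nc z; pose D := 64 / (1 - r) ^+ 4 * growth_fun r ^+ 2 / L s ^+ 2.
have Ls := L_gt0 NE s0.
have D0 : 0 <= D.
  apply: divr_ge0 (sqr_ge0 _); apply: mulr_ge0 (sqr_ge0 _); apply: divr_ge0 => //.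
  by rewrite exprn_ge0// subr_ge0 ltW.
have q0 : 0 < e / (D + 1) by rewrite divr_gt0//; lra.
have [T T0 HT] := L_close NE q0.
have [N HN] := nat_above (Num.max T s).
have bnd a b : T <= a -> s <= a -> a <= b -> nc (gmap psi lam s b z - gmap psi lam s a z) < e.
  move=> Ta sa ab; have b0 : 0 <= b by lra.
  apply: (le_lt_trans (gmap_diff NE s0 sa ab z1 (lexx _))).
  have -> : 64 / (1 - nc z) ^+ 4 * growth_fun (nc z) ^+ 2 * (L a - L b) / L s ^+ 2
    = D * (L a - L b) by rewrite /D; ring.
  have h : L a - L b < e / (D + 1).
    by have := HT _ Ta; have := L_ge_beta NE b0; lra.
  have : D * (L a - L b) <= D * (e / (D + 1)) by rewrite ler_wpM2l// ltW.
  have : (D + 1) * (e / (D + 1)) = e by rewrite mulrC divfK// gt_eqF//; lra.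
  lra.
exists N => n m nN mN.
have := HN n nN; have := HN m mN; rewrite !ge_max => /andP[a1 a2] /andP[a3 a4].
have [nm|mn] := leqP n m; last first.
  by apply: bnd => //; rewrite ler_nat ltnW.
by rewrite ncC; apply: bnd => //; rewrite ler_nat.
Qed.

Lemma chain_exists : exists f : R -> C -> C, forall s z, 0 <= s -> nc z < 1 ->
  ccvg (fun n => gmap psi lam s n%:R z) (f s z).
Proof.
have H (p : R * C) : exists l, 0 <= p.1 -> nc p.2 < 1 ->
    ccvg (fun n => gmap psi lam p.1 n%:R p.2) l.
  have [p0|p0] := lerP 0 p.1; last by exists 0.
  have [p1|p1] := ltP (nc p.2) 1; last by exists 0.
  by have [l Hl] := chain_limit p0 p1; exists l.
have [f Hf] := choice H.
by exists (fun s z => f (s, z)) => s z; exact: (Hf (s, z)).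
Qed.

Variable f : R -> C -> C.
Hypothesis fP : forall s z, 0 <= s -> nc z < 1 ->
  ccvg (fun n => gmap psi lam s n%:R z) (f s z).

Lemma chain_comp s t z : 0 <= s -> s <= t -> nc z < 1 -> f t (psi s t z) = f s z.
Proof.
move=> s0 st z1; have t0 : 0 <= t by lra.
apply: ccvg_unique (fP s0 z1); apply: eq_ccvg (fP t0 (psi_self NE s0 st z1)).
have [N HN] := nat_above t; exists N => n /HN tn.
by rewrite /gmap -(psi_comp NE).
Qed.

(** Dividing [psi_near_linear] by lam s n leaves 1 - |lam s n|, at most 1 - beta / L s. If beta > 0
    this tends to 0 as s grows; if beta = 0 it is 1, and only the square of |z| makes the error
    small. *)
Lemma chain_near_id s z r : 0 <= s -> r < 1 -> nc z <= r ->
  nc (lam 0 s * f s z - z) <= 64 / (1 - r) ^+ 4 * (1 - beta / L s) * nc z ^+ 2.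
Proof.
move=> s0 r1 zr; have z1 : nc z < 1 by lra.
have Ls := L_gt0 NE s0.
apply: (ccvg_le (ccvgM (lam 0 s) (fP s0 z1))).
have [N HN] := nat_above s; exists N => n /HN sn.
have n0 : 0 <= n%:R :> R by [].
have ln := lam_neq0 NE s0 sn; have l0 := lam_gt0 NE s0 sn.
have ls0 := lam_neq0 NE (lexx 0) s0.
have -> : lam 0 s * gmap psi lam s n%:R z - z =
    (psi s n%:R z - lam s n%:R * z) / lam s n%:R.
  by rewrite /gmap (lam_comp NE (lexx 0) s0 sn); field; rewrite ln ls0.
rewrite ncM ncV ler_pdivrMr// (le_trans (psi_near_linear NE s0 sn r1 zr))//.
set l := nc (lam s _) in l0 *.
have -> : 64 / (1 - r) ^+ 4 * (1 - beta / L s) * nc z ^+ 2 * l =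
  (64 / (1 - r) ^+ 4 * nc z ^+ 2) * (l * (1 - beta / L s)) by ring.
rewrite mulrAC; apply: ler_wpM2l.
  apply: mulr_ge0 (sqr_ge0 _); apply: divr_ge0 => //.
  by rewrite exprn_ge0// subr_ge0 ltW.
rewrite ler_wpM2l ?(ltW l0)// lerD2l lerN2 ler_pdivrMr// -(L_comp NE s0 sn).
exact: (L_ge_beta NE).
Qed.

Lemma chain_bound s z : 0 <= s -> nc z < 1 -> nc (f s z) <= growth_fun (nc z) / L s.
Proof.
move=> s0 z1; apply: (ccvg_le0 (fP s0 z1)).
have [N HN] := nat_above s; exists N => n /HN sn.
have n0 : 0 <= n%:R :> R by [].
have Ls := L_gt0 NE s0; have l0 := lam_gt0 NE s0 sn.
rewrite /gmap ncM ncV (L_comp NE s0 sn) ler_pdivrMr ?mulr_gt0//.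
rewrite (le_trans (psi_le NE s0 sn z1))//.
by rewrite -mulrA [_ * L s]mulrC mulKf ?gt_eqF// mulrC.
Qed.

Lemma chain_disk s z : 0 <= s -> nc z < 1 -> beta * nc (f s z) <= nc z.
Proof.
move=> s0 z1; have b0 := beta_ge0 NE.
rewrite -{1}[beta]ger0_norm// -nc_real -ncM.
apply: (ccvg_le0 (ccvgM _ (fP s0 z1))).
have [N HN] := nat_above s; exists N => n /HN sn.
have n0 : 0 <= n%:R :> R by [].
rewrite ncM nc_real ger0_norm// /gmap ncM ncV.
have Ln := L_gt0 NE n0; have p0 := nc_ge0 (psi s n%:R z).
apply: le_trans (psi_schwarz NE s0 sn z1).
rewrite mulrCA ler_piMr// ler_pdivrMr// mul1r.
exact: (L_ge_beta NE).
Qed.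

Lemma chain0 s : 0 <= s -> f s 0 = 0.
Proof.
move=> s0; apply/eqP; rewrite -nc_eq0 eq_le nc_ge0 andbT.
have z1 : nc (0 : C) < 1 by rewrite nc0.
by apply: (le_trans (chain_bound s0 z1)); rewrite nc0 /growth_fun !mul0r.
Qed.

Lemma chain_diff s z : 0 <= s -> nc z < 1 -> cdiff (f s) z.
Proof.
move=> s0 z1; have Ls := L_gt0 NE s0; have z0 := nc_ge0 z.
pose r := (1 - nc z) / 2; have r0 : 0 < r by rewrite /r; lra.
pose t := (1 + nc z) / 2; have t1 : t < 1 by rewrite /t; lra.
have near u : nc (u - z) <= r -> nc u <= t.
  by move=> ur; have := ncBge u z; rewrite /t; rewrite /r in ur; lra.
have G0 : 0 <= growth_fun t / L s.
  rewrite divr_ge0 ?(ltW Ls)//; apply: le_trans (growth_fun_ge _ t1); rewrite /t; lra.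
apply: (@weierstrass _ (fun n => gmap psi lam s n%:R) _ _ r (growth_fun t / L s)) => //.
  have [N HN] := nat_above s; exists N => n u /HN sn /near ut.
  have u1 : nc u < 1 by lra.
  have n0 : 0 <= n%:R :> R by [].
  have l0 := lam_gt0 NE s0 sn.
  split.
    by apply: cdiffM; [exact: (psi_diff NE)|exact: cdiff_cst].
  rewrite /gmap ncM ncV (L_comp NE s0 sn) ler_pdivrMr ?mulr_gt0//.
  rewrite (le_trans (psi_le NE s0 sn u1))//.
  rewrite -mulrA [nc (lam s _) * L s]mulrC mulKf ?gt_eqF// mulrC ler_wpM2r ?(ltW l0)//.
  by apply: growth_fun_mono => //; exact: nc_ge0.
by move=> u /near ut; apply: fP => //; lra.
Qed.

Definition chain_err s z := lam 0 s * f s z - z.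

Lemma chain_err_lip s rho r : 0 <= s -> 0 <= rho -> rho < r -> r < 1 ->
  forall z w, nc z <= rho -> nc w <= rho ->
  nc (chain_err s z - chain_err s w) <=
  2 * (64 / (1 - r) ^+ 4 * (1 - beta / L s) * r ^+ 2) / (r - rho) * nc (z - w).
Proof.
move=> s0 rho0 rr r1; apply: lip_bound => //.
- move=> u ur; apply: cdiffB; last exact: cdiff_id.
  by apply: cdiffM; [exact: cdiff_cst|apply: chain_diff => //; lra].
- by move=> u ur; have := @chain_near_id s u r s0 r1; rewrite ur => /(_ (lexx _)).
- have Ls := L_gt0 NE s0.
  apply: mulr_ge0 (sqr_ge0 _); apply: mulr_ge0.
    by rewrite divr_ge0// exprn_ge0// subr_ge0 ltW.
  by rewrite subr_ge0 ler_pdivrMr// mul1r (L_ge_beta NE).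
Qed.

(* For large S the map lam 0 S * f S is close to the identity: on a fixed small
   disk if beta = 0, on an arbitrarily large disk if beta > 0. *)
Lemma chain_eventually_near_id s r R' : 0 <= s -> 0 <= r -> r < 1 -> 0 <= R' -> beta * R' < 1 ->
  exists S rho e, [/\ 0 <= S, s <= S, 0 < rho, rho < 1 & 0 <= e < 1] /\
   [/\ forall z w, nc z <= rho -> nc w <= rho ->
         nc (chain_err S z - chain_err S w) <= e * nc (z - w),
       forall z, nc z <= r -> nc (psi s S z) <= rho & R' * L S <= (1 - e) * rho].
Proof.
move=> s0 r0 r1 R0 bR.
have b0 := beta_ge0 NE; have Ls := L_gt0 NE s0.
have G0 : 0 <= growth_fun r by apply: le_trans (growth_fun_ge r0 r1).
have [bE|bp] : beta = 0 \/ 0 < beta.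
  by move: b0; rewrite le_eqVlt => /orP[/eqP <-|]; [left|right].
(* On |z| <= rho, seen from radius 2 rho, the error has Lipschitz constant 64 / (1 - 2 rho)^4 * 8
   rho <= 128 * 8 rho, which is 1/2 for this rho. *)
- pose rho : R := 1 / (64 * 32).
  have rho0 : 0 < rho by drop_ineqs; rewrite /rho; lra.
  have [R1 G1] : 0 < R' + 1 /\ 0 < growth_fun r + 1 by rewrite !ltr_wpDl.
  (* As L S tends to 0, the first entry yields R' L S <= rho / 2, the second that psi s S sends |z|
     <= r into |z| <= rho. *)
  pose d := Num.min (rho / 2 / (R' + 1)) (rho * L s / (growth_fun r + 1)).
  have d0 : 0 < d by rewrite lt_min !divr_gt0 ?mulr_gt0.
  have [T T0 HT] := L_close NE d0.
  pose S := Num.max T s.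
  have TS : T <= S by rewrite le_max lexx.
  have sS : s <= S by rewrite le_max lexx orbT.
  have S0 : 0 <= S by exact: le_trans s0 sS.
  have LS := L_gt0 NE S0.
  have := HT _ TS; rewrite bE add0r lt_min (ltr_pdivlMr _ _ R1) (ltr_pdivlMr _ _ G1) => /andP[h1 h2].
  exists S, rho, (1 / 2); split; first by split=> //; drop_ineqs; rewrite /rho; lra.
  split.
  + move=> z w zr wr; have rr : rho < 2 * rho by rewrite mulr_natl mulr2n ltrDl.
    have r21 : 2 * rho < 1 by drop_ineqs; rewrite /rho; lra.
    apply: (le_trans (chain_err_lip S0 (ltW rho0) rr r21 zr wr)).
    apply: ler_wpM2r; first exact: nc_ge0.
    rewrite bE mul0r subr0 mulr1.
    have p4 : 1 / 2 <= (1 - 2 * rho) ^+ 4.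
      drop_ineqs; have p2 : 3 / 4 <= (1 - 2 * rho) ^+ 2 by rewrite expr2 /rho; nra.
      have -> : (1 - 2 * rho) ^+ 4 = (1 - 2 * rho) ^+ 2 * (1 - 2 * rho) ^+ 2 by ring.
      nra.
    have q4 : 64 / (1 - 2 * rho) ^+ 4 <= 128 by move: p4; drop_ineqs=> p4; rewrite ler_pdivrMr; lra.
    have -> : 2 * (64 / (1 - 2 * rho) ^+ 4 * (2 * rho) ^+ 2) / (2 * rho - rho) =
      64 / (1 - 2 * rho) ^+ 4 * (8 * rho).
      by move: (64 / _) rho0; drop_ineqs=> c rho0; field; lra.
    have : 64 / (1 - 2 * rho) ^+ 4 * (8 * rho) <= 128 * (8 * rho).
      by rewrite ler_wpM2r// mulr_ge0// ltW.
    have -> : 128 * (8 * rho) = 1 / 2 by drop_ineqs; rewrite /rho; lra.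
    by [].
  + move=> z zr; have z1 : nc z < 1 := le_lt_trans zr r1.
    apply: (le_trans (psi_le NE s0 sS z1)).
    have gz : growth_fun (nc z) <= growth_fun r by apply: growth_fun_mono => //; exact: nc_ge0.
    have lE := L_comp NE s0 sS.
    have l0 := lam_gt0 NE s0 sS.
    rewrite -(ler_pM2r Ls) mulrAC -lE.
    have : L S * growth_fun (nc z) <= L S * growth_fun r by rewrite ler_wpM2l// ltW.
    by move: h2 LS; drop_ineqs; lra.
  + by move: h1 LS; drop_ineqs; lra.
- pose q := Num.max (beta * R') r.
  have q1 : q < 1 by rewrite gt_max bR.
  have qR : beta * R' <= q by rewrite le_max lexx.
  have qr : r <= q by rewrite le_max lexx orbT.
  (* Then (1 - e) rho >= 1 - 2 e = q + (1 - q) / 2. This exceeds R' L S, because beta R' <= q and L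
     S is close to beta. Also r <= q <= rho. *)
  pose e := (1 - q) / 4; pose rho := 1 - e.
  have e0 : 0 < e by rewrite divr_gt0// subr_gt0.
  have q0 : 0 <= q := le_trans r0 qr.
  have e1 : e <= 1 / 4 by move: q0; drop_ineqs; rewrite /e; lra.
  pose r' := (1 + rho) / 2.
  have [r'1 rr rho0 rho1] : [/\ r' < 1, rho < r', 0 < rho & rho < 1].
    by move: e0 e1; rewrite /r' /rho; drop_ineqs=> e0 e1; split; lra.
  pose A := 2 * (64 / (1 - r') ^+ 4 * r' ^+ 2) / (r' - rho).
  have A0 : 0 <= A.
    apply: divr_ge0; last by rewrite subr_ge0 ltW.
    apply: mulr_ge0 => //; apply: mulr_ge0 (sqr_ge0 _); apply: divr_ge0 => //.
    by rewrite exprn_ge0// subr_ge0 ltW.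
  pose d := Num.min (e * beta / (A + 1)) ((1 - q) / 2 / (R' + 1)).
  have [A1 R1 q1'] : [/\ 0 < A + 1, 0 < R' + 1 & 0 < 1 - q].
    by split; rewrite ?subr_gt0// ltr_wpDl.
  have d0 : 0 < d by rewrite lt_min !divr_gt0 ?mulr_gt0.
  have [T T0 HT] := L_close NE d0.
  pose S := Num.max T s.
  have TS : T <= S by rewrite le_max lexx.
  have sS : s <= S by rewrite le_max lexx orbT.
  have S0 : 0 <= S by exact: le_trans s0 sS.
  have LS := L_gt0 NE S0.
  have Lb := L_ge_beta NE S0.
  have := HT _ TS; rewrite -ltrBlDl lt_min (ltr_pdivlMr _ _ A1) (ltr_pdivlMr _ _ R1) => /andP[h1 h2].
  exists S, rho, e; split.
    by split=> //; rewrite ltW//=; move: e1; drop_ineqs; lra.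
  split.
  + move=> z w zr wr.
    apply: (le_trans (chain_err_lip S0 (ltW rho0) rr r'1 zr wr)).
    apply: ler_wpM2r; first exact: nc_ge0.
    have -> : 2 * (64 / (1 - r') ^+ 4 * (1 - beta / L S) * r' ^+ 2) / (r' - rho) =
      A * (1 - beta / L S) by rewrite /A; ring.
    have h3 : 1 - beta / L S <= (L S - beta) / beta.
      rewrite ler_pdivlMr//.
      have -> : (1 - beta / L S) * beta = (L S - beta) * (beta / L S) by field; rewrite gt_eqF.
      by rewrite ler_piMr ?subr_ge0// ler_pdivrMr// mul1r.
    apply: (le_trans (ler_wpM2l A0 h3)).
    rewrite mulrA ler_pdivrMr//.
    by move: h1 Lb; drop_ineqs; lra.
  + move=> z zr; have z1 : nc z < 1 := le_lt_trans zr r1.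
    by apply: (le_trans (psi_schwarz NE s0 sS z1)); move: zr qr q1; drop_ineqs; rewrite /rho /e; lra.
  + have -> : (1 - e) * rho = 1 - 2 * e + e ^+ 2 by rewrite /rho; ring.
    have : R' * (L S - beta) <= (1 - q) / 2 by move: h2 Lb; drop_ineqs; lra.
    by move: (sqr_ge0 e) qR; drop_ineqs; rewrite /e; lra.
Qed.

Lemma chain_lower_lip s r : 0 <= s -> 0 <= r -> r < 1 -> exists2 c : R, 0 < c &
  forall z w, nc z <= r -> nc w <= r -> c * nc (z - w) <= nc (f s z - f s w).
Proof.
move=> s0 r0 r1.
have [|S [rho [e [[S0 sS rho0 rho1 /andP[e0 e1]] [lipE psir _]]]]] :=
  @chain_eventually_near_id s r 0 s0 r0 r1 (lexx _); first by rewrite mulr0.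
have [c c0 Hc] := psi_lower_lip NE s0 sS r1.
have LS := L_gt0 NE S0.
exists ((1 - e) * c / L S); first by rewrite divr_gt0// mulr_gt0// subr_gt0.
move=> z w zr wr; have z1 : nc z < 1 by lra.
have w1 : nc w < 1 by lra.
rewrite -(chain_comp s0 sS z1) -(chain_comp s0 sS w1).
have h := lipE _ _ (psir _ zr) (psir _ wr).
set u := psi s S z in h *; set v := psi s S w in h *.
have hu : c * nc (z - w) <= nc (u - v) := Hc _ _ zr wr.
rewrite mulrAC ler_pdivrMr//.
have : nc (u - v) <= L S * nc (f S u - f S v) + nc (chain_err S u - chain_err S v).
  have -> : u - v = lam 0 S * (f S u - f S v) - (chain_err S u - chain_err S v).
    by rewrite /chain_err; ring.
  by rewrite (le_trans (ncB _ _))// ncM.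
have : (1 - e) * (c * nc (z - w)) <= (1 - e) * nc (u - v) by rewrite ler_wpM2l//; lra.
lra.
Qed.

Lemma chain_inj s z w : 0 <= s -> nc z < 1 -> nc w < 1 -> f s z = f s w -> z = w.
Proof.
move=> s0 z1 w1 E; pose r := Num.max (nc z) (nc w).
have r0 : 0 <= r by rewrite le_max nc_ge0.
have r1 : r < 1 by rewrite gt_max z1.
have [c c0 /(_ z w)] := chain_lower_lip s0 r0 r1.
rewrite !le_max !lexx orbT E subrr nc0 => /(_ isT isT).
rewrite pmulr_rle0// => h; apply/eqP; rewrite -subr_eq0 -nc_eq0 eq_le h.
exact: nc_ge0.
Qed.

Lemma chain_cover R' : 0 <= R' -> beta * R' < 1 -> exists S rho, [/\ 0 <= S, 0 < rho, rho < 1 &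
  forall y, nc y <= R' -> exists2 z, nc z <= rho & f S z = y].
Proof.
move=> R0 bR.
have [S [rho [e [[S0 _ rho0 rho1 eI] [lipE _ RL]]]]] :=
  @chain_eventually_near_id 0 0 R' (lexx _) (lexx _) ltr01 R0 bR.
have LS := L_gt0 NE S0.
exists S, rho; split=> // y yR.
have E0 : chain_err S 0 = 0 by rewrite /chain_err chain0// mulr0 subrr.
have [|z zr zE] := covering rho0 eI E0 lipE (y := lam 0 S * y).
  apply: le_trans RL; rewrite ncM mulrC ler_wpM2r// ltW//.
exists z => //; apply: (mulfI (lam_neq0 NE (lexx 0) S0)).
by rewrite -zE /chain_err addrC subrK.
Qed.

Lemma chain_deriv0 : cder (f 0) 0 1.
Proof.
have c0 : 0 <= (0 : R) by [].
apply/cderP => e e0.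
pose A : R := 64 / (1 - 1 / 2) ^+ 4.
have b0 := beta_ge0 NE.
have A0 : 0 < A by rewrite /A divr_gt0// exprn_gt0//; lra.
have eA : 0 < e / A by rewrite divr_gt0.
exists (Num.min (1 / 2) (e / A)); first by rewrite lt_min eA andbT; lra.
move=> z; rewrite subr0 lt_min => /andP[/ltW z2 ze].
have z1 : (1 / 2 : R) < 1 by lra.
have := chain_near_id c0 z1 z2; rewrite -/A (L0 NE) divr1.
have l00 : lam 0 0 = 1.
  apply: (@cder_unique _ (psi 0 0) 0); first exact: (psi_lam NE).
  apply: (@eq_cder _ id); last exact: cder_id.
  by exists 1 => // u; rewrite subr0 => u1; rewrite (psi_id NE).
rewrite l00 !mul1r chain0// subr0 => h; apply: (le_trans h).
rewrite expr2 mulrA; apply: ler_wpM2r; first exact: nc_ge0.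
move: ze; rewrite ltr_pdivlMr// mulrC => ze; apply: le_trans (ltW ze).
apply: ler_wpM2r; first exact: nc_ge0.
by rewrite ler_piMr ?(ltW A0)//; lra.
Qed.

End Chain.

(** * Rigidity and uniqueness *)

Section Rigidity.
Context {R : realType}.
Local Notation C := R[i].
Implicit Types (f g h : C -> C) (a b z w l : C).

Lemma deriv_neq0 f a l (c d : R) : 0 < c -> 0 < d -> cder f a l ->
  (forall z, nc (z - a) < d -> c * nc (z - a) <= nc (f z - f a)) -> l != 0.
Proof.
move=> c0 d0 [q [cq <- fq]] H; apply/eqP => qa.
have [d' d'0 H'] := cq _ c0.
have m0 : 0 < Num.min d d' by rewrite lt_min d0.
pose t := Num.min d d' / 2.
have t0 : 0 < t by rewrite /t; lra.
have tm : t < Num.min d d' by rewrite /t; lra.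
have nz : nc (a + t%:C%C - a) = t by rewrite addrC addKr nc_real gtr0_norm.
move: tm; rewrite lt_min -{1 2}nz => /andP[/H h1 /H' h2].
move: h1; rewrite fq ncM nz ler_pM2r//; rewrite qa subr0 in h2.
by rewrite leNgt h2.
Qed.

(** The Lipschitz bound makes [zeta] continuous, and then the inverse of [p] composed with [zeta] is
    its Carathéodory quotient near w0. *)
Lemma cdiff_inverse f (zeta : C -> C) w0 l (d K : R) : 0 < d -> cder f (zeta w0) l -> l != 0 ->
  (forall w, nc (w - w0) < d -> f (zeta w) = w) ->
  (forall w, nc (w - w0) < d -> nc (zeta w - zeta w0) <= K * nc (w - w0)) ->
  cdiff zeta w0.
Proof.
move=> d0 [p [cp pl fp]] l0 fz zK.
have cz : ccont zeta w0.
  move=> e e0; have K1 : 0 < `|K| + 1 by have := normr_ge0 K; lra.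
  exists (Num.min d (e / (`|K| + 1))); first by rewrite lt_min d0 divr_gt0.
  move=> w; rewrite lt_min ltr_pdivlMr// => /andP[/zK h we].
  apply: (le_lt_trans h); apply: le_lt_trans we.
  rewrite mulrC; apply: ler_wpM2l; first exact: nc_ge0.
  by rewrite (le_trans (ler_norm K))// lerDl.
have cpz : ccont (fun w => p (zeta w)) w0 by exact: ccont_comp.
have n0 : 0 < nc (p (zeta w0)) by rewrite pl nc_gt0.
have [d' d'0 pn] := cpz _ n0.
have pnz w : nc (w - w0) < d' -> p (zeta w) != 0.
  by move=> /pn; apply: contraTneq => ->; rewrite sub0r ncN ltxx.
pose q w := (p (zeta w))^-1.
have w00 : nc (w0 - w0) < d by rewrite subrr nc0.
apply: (@eq_cdiff _ (fun w => zeta w0 + q w * (w - w0))).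
  exists (Num.min d d'); first by rewrite lt_min d0.
  move=> w; rewrite lt_min => /andP[wd wd'].
  have -> : w - w0 = p (zeta w) * (zeta w - zeta w0) by rewrite -fp (fz _ wd) (fz _ w00).
  rewrite /q mulKf ?pnz//.
  by rewrite addrC subrK.
exists (q w0), q; split=> //; last by move=> w; ring.
by apply: ccontV => //; rewrite pl.
Qed.

Lemma schwarz_rigid h : (forall z, nc z < 1 -> cdiff h z) -> h 0 = 0 ->
  (forall z, nc z < 1 -> nc (h z) <= 1) -> cder h 0 1 ->
  forall z, nc z < 1 -> h z = z.
Proof.
move=> dh h0 h1 hd z z1.
have [k [dk k1 hk hk0]] := schwarz_quotient dh h0 h1.
have k0 : k 0 = 1 by exact: cder_unique hk0 hd.
have := schwarz_pick0 dk k1 z1; rewrite k0 conjc1 mul1r ncC => h2.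
have n0 := nc_ge0 (1 - k z).
have /eqP : nc (1 - k z) = 0.
  apply/eqP; rewrite eq_le n0 andbT leNgt; apply/negP => p0.
  have : nc (1 - k z) * nc z < nc (1 - k z) by rewrite gtr_pMr.
  by rewrite ltNge h2.
by rewrite nc_eq0 subr_eq0 hk => /eqP <-; rewrite mulr1.
Qed.

(* By injectivity h stays away from 0 off a neighbourhood of 0, so z / h z is an
   entire function of at most linear growth; it is affine, and never 0. *)
Lemma entire_injective_id h : (forall z, cdiff h z) -> h 0 = 0 -> cder h 0 1 ->
  (forall z w, h z = h w -> z = w) -> forall z, h z = z.
Proof.
move=> dh h0 hd hinj.
(* Near 0 the error h z - z has Lipschitz constant 1/2, so by [covering] the disk of radius rho
   already takes all values of modulus at most rho / 2; injectivity excludes them elsewhere. *)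
have [rho rho0 far] : exists2 rho : R, 0 < rho & forall z, rho < nc z -> rho / 2 < nc (h z).
  have /cderP/(_ (1/8)) [|d d0 Hd] := hd; first lra.
  pose r := d / 2; have r0 : 0 < r by rewrite /r; lra.
  pose E z := h z - z.
  have EM z : nc z = r -> nc (E z) <= 1 / 8 * r.
    move=> zr; have := Hd z; rewrite h0 !subr0 mul1r zr; apply; rewrite /r; lra.
  have dE z : nc z <= r -> cdiff E z by move=> _; apply: cdiffB => //; exact: cdiff_id.
  have M0 : 0 <= 1 / 8 * r by lra.
  have rr : r / 2 < r by lra.
  have lipE := lip_bound dE EM M0 rr.
  have cst : 2 * (1 / 8 * r) / (r - r / 2) = 1 / 2.
    have -> : r - r / 2 = r / 2 by lra.
    have n : r / 2 != 0 by rewrite gt_eqF//; lra.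
    by apply: (mulIf n); rewrite divfK//; lra.
  rewrite cst in lipE.
  exists (r / 2); first lra.
  move=> z zr; rewrite ltNge; apply/negP => hz.
  have E0 : E 0 = 0 by rewrite /E h0 subrr.
  have r20 : 0 < r / 2 by lra.
  have e1 : 0 <= (1 / 2 : R) < 1 by apply/andP; split; lra.
  have [|u ur uE] := covering r20 e1 E0 lipE (y := h z); first lra.
  have : u = z by apply: hinj; rewrite -uE /E addrC subrK.
  by move=> uz; move: ur; rewrite uz leNgt zr.
have [q [cq q0 hq]] := hd.
have hE z : h z = q z * z by have := hq z; rewrite h0 !subr0.
have qn0 z : q z != 0.
  have [->|z0] := eqVneq z 0; first by rewrite q0 oner_neq0.
  apply: contraNneq z0 => qz; apply/eqP; apply: hinj.
  by rewrite hE qz mul0r h0.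
pose k z := (q z)^-1.
have kE z : z != 0 -> k z = z / h z.
  by move=> z0; rewrite hE /k invfM mulrCA divff// mulr1.
have dk0 z : z != 0 -> cdiff k z.
  move=> z0; apply: (@eq_cdiff _ (fun z => z / h z)).
    exists (nc z); rewrite ?nc_gt0// => v vz; rewrite kE//; apply: contraTneq vz => ->.
    by rewrite sub0r ncN ltxx.
  apply: cdiffM; first exact: cdiff_id.
  by apply: cdiffV => //; rewrite hE mulf_neq0.
have dk z : cdiff k z.
  have [->|] := eqVneq z 0; last exact: dk0.
  apply: (@removable _ k 0 1) => //; first by apply: ccontV.
  by move=> u u0 _; exact: dk0.
have kM r z : rho < r -> nc z = r -> nc (k z) <= 2 / rho * r.
  move=> rr zr; have z0 : z != 0 by rewrite -nc_gt0; lra.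
  rewrite kE// ncM ncV zr mulrC; apply: ler_wpM2r; first lra.
  have hz := far z; rewrite zr in hz; have {}hz := hz rr.
  rewrite -[2 / rho]invf_div lef_pV2 ?posrE; lra.
have aff z v : z != 0 -> v != 0 -> dq k 0 z = dq k 0 v.
  move=> z0 v0; apply/eqP; rewrite -subr_eq0 -nc_eq0 eq_le nc_ge0 andbT.
  apply/ler_addgt0Pr => e e0; rewrite add0r.
  have nz := nc_ge0 z; have nv := nc_ge0 v; have nzv := nc_ge0 (z - v).
  have q1 : 0 <= 32 * nc (z - v) / (rho * e) by rewrite divr_ge0 ?mulr_ge0 ?(ltW rho0) ?(ltW e0).
  (* Liouville's argument: a bound 2 r / rho on |u| = r makes the increment of the divided
     difference at most 32 |z - v| / (rho r), below e for this r. *)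
  pose r := rho + 2 * nc z + 2 * nc v + 32 * nc (z - v) / (rho * e) + 1.
  have r0 : 0 < r by rewrite /r; lra.
  have rr : rho < r by rewrite /r; lra.
  apply: (le_trans (@dq2_bound _ [::] k r (2 / rho * r) (r / 2) 0 v z _ _ _ _ _ _ _ _ _ _ _ _)) => //.
  - by move=> u ur _; exact: kM.
  - by rewrite mulr_ge0 ?divr_ge0 ?(ltW rho0) ?(ltW r0).
  - by rewrite nc0; lra.
  - by rewrite /r; lra.
  - lra.
  - by rewrite /r; lra.
  have -> : 4 * (2 / rho * r) / (r - r / 2) ^+ 2 * nc (z - v) = 32 * nc (z - v) / rho / r.
    by field; rewrite !gt_eqF.
  rewrite ler_pdivrMr// -ler_pdivrMl//.
  have -> : e^-1 * (32 * nc (z - v) / rho) = 32 * nc (z - v) / (rho * e).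
    by rewrite invfM; ring.
  rewrite /r; lra.
have one0 : (1 : C) != 0 by exact: oner_neq0.
have kaff z : k z = 1 + dq k 0 1 * z.
  have k0 : k 0 = 1 by rewrite /k q0 invr1.
  have [->|z0] := eqVneq z 0; first by rewrite k0 mulr0 addr0.
  by have := dqK k 0 z; rewrite subr0 (aff _ _ z0 one0) k0 => <-; rewrite addrC subrK.
have kn0 z : k z != 0 by rewrite invr_eq0.
have b0 : dq k 0 1 = 0.
  apply/eqP; apply: contraT => b0; have := kn0 (- (dq k 0 1)^-1).
  by rewrite kaff mulrN divff// subrr eqxx.
move=> z; have := kaff z; rewrite b0 mul0r addr0 /k => qz.
by rewrite hE -[q z]invrK qz invr1 mul1r.
Qed.

End Rigidity.

(** * Comparison of two univalent chains *)

Section Uniqueness.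
Context {R : realType}.
Local Notation C := R[i].
Variables (psi : R -> R -> C -> C) (lam : R -> R -> C) (beta : R).
Hypothesis NE : normalized_evolution psi lam beta.
Variable f : R -> C -> C.
Hypothesis fP : forall s z, 0 <= s -> nc z < 1 ->
  ccvg (fun n => gmap psi lam s n%:R z) (f s z).

Definition univalent_chain (g : R -> C -> C) :=
  [/\ forall t z, 0 <= t -> nc z < 1 -> cdiff (g t) z,
      forall t z w, 0 <= t -> nc z < 1 -> nc w < 1 -> g t z = g t w -> z = w &
      forall s t z, 0 <= s -> s <= t -> nc z < 1 -> g t (psi s t z) = g s z].

Lemma chain_univalent : univalent_chain f.
Proof.
split.
- by move=> t z; exact: (chain_diff NE fP).
- by move=> t z w; exact: (chain_inj NE fP).
- by move=> s t z; exact: (chain_comp NE fP).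
Qed.

(** For s <= t and an injective chain, g1 s z = g1 t w means psi s t z = w, a condition in which the
    chain does not occur. *)
Lemma chain_transfer g1 g2 s t z w : univalent_chain g1 -> univalent_chain g2 ->
  0 <= s -> 0 <= t -> nc z < 1 -> nc w < 1 -> g1 s z = g1 t w -> g2 s z = g2 t w.
Proof.
move=> [_ i1 c1] [_ _ c2].
wlog st : s t z w / s <= t.
  move=> H s0 t0 z1 w1 E; have [st|/ltW ts] := leP s t; first exact: H.
  by apply/esym; apply: H.
move=> s0 t0 z1 w1; rewrite -(c1 _ _ _ s0 st z1) -(c2 _ _ _ s0 st z1).
by move=> /i1 -> //; exact: (psi_self NE).
Qed.

(** [h] takes w to g at a chosen point (t, z) over w. Transfer from f to g makes this independent of
    the choice, transfer from g to f makes it injective. *)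
Lemma chain_factor g : univalent_chain g -> exists h : C -> C,
  [/\ forall t z, 0 <= t -> nc z < 1 -> g t z = h (f t z),
      forall w, beta * nc w < 1 -> cdiff h w,
      forall w w', beta * nc w < 1 -> beta * nc w' < 1 -> h w = h w' -> w = w' &
      forall w, beta * nc w < 1 -> exists t z, [/\ 0 <= t, nc z < 1 & f t z = w]].
Proof.
move=> gU; have fU := chain_univalent.
have surj w : beta * nc w < 1 -> exists t z, [/\ 0 <= t, nc z < 1 & f t z = w].
  move=> bw; have [S [rho [S0 rho0 rho1 H]]] := chain_cover NE fP (nc_ge0 w) bw.
  by have [z zr zw] := H w (lexx _); exists S, z; split=> //; lra.
have H w : exists p : R * C, beta * nc w < 1 -> [/\ 0 <= p.1, nc p.2 < 1 & f p.1 p.2 = w].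
  have [/surj [t [z Hz]]|bw] := ltP (beta * nc w) 1; first by exists (t, z).
  by exists (0, 0).
have [p Hp] := choice H.
pose h w := g (p w).1 (p w).2.
have gh t z : 0 <= t -> nc z < 1 -> g t z = h (f t z).
  move=> t0 z1; have bf := le_lt_trans (chain_disk NE fP t0 z1) z1.
  have [q1 q2 q3] := Hp _ bf.
  exact: (@chain_transfer f g).
exists h; split=> //; last first.
  move=> w w' bw bw'; have [q1 q2 q3] := Hp _ bw; have [q4 q5 q6] := Hp _ bw'.
  by move=> E; rewrite -q3 -q6; exact: (@chain_transfer g f).
move=> w bw; have b0 := beta_ge0 NE; have w0 := nc_ge0 w.
(* Room around w: a single time S covers the whole disk of radius |w| + eta. Then [zeta] is a
   section of f S near w, and h = g S o zeta there. *)
pose eta := (1 - beta * nc w) / (2 * (beta + 1)).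
have eta0 : 0 < eta by rewrite divr_gt0 ?mulr_gt0//; lra.
have bR : beta * (nc w + eta) < 1.
  have : 2 * (beta + 1) * eta = 1 - beta * nc w by rewrite /eta mulrC divfK// gt_eqF// mulr_gt0//; lra.
  nra.
have R0 : 0 <= nc w + eta by lra.
have [S [rho [S0 rho0 rho1 cov]]] := chain_cover NE fP R0 bR.
have Hz y : exists z, nc y <= nc w + eta -> nc z <= rho /\ f S z = y.
  have [/cov [z zr zy]|ye] := leP (nc y) (nc w + eta); first by exists z.
  by exists 0.
have [zeta Hzeta] := choice Hz.
pose r := (1 + rho) / 2.
have r0 : 0 <= r by rewrite /r; lra.
have r1 : r < 1 by rewrite /r; lra.
have rr : rho < r by rewrite /r; lra.
have [c c0 low] := chain_lower_lip NE fP S0 r0 r1.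
have near y : nc (y - w) < eta -> nc y <= nc w + eta.
  by move=> yw; have := ncBge y w; lra.
have ww : nc (w - w) < eta by rewrite subrr nc0.
have [zwr zwE] := Hzeta _ (near _ ww).
have zw1 : nc (zeta w) < 1 by lra.
have [l fl] := chain_diff NE fP S0 zw1.
have l0 : l != 0.
  have rz : 0 < r - rho by lra.
  apply: (deriv_neq0 c0 rz fl) => z zn; apply: low; last lra.
  by have := ncBge z (zeta w); lra.
have dz : cdiff zeta w.
  apply: (cdiff_inverse (K := c^-1) eta0 fl l0).
    by move=> y /near /Hzeta [].
  move=> y /near /Hzeta [yr yE].
  rewrite mulrC ler_pdivlMr// mulrC -{2}yE -{2}zwE; apply: low; lra.
apply: (@eq_cdiff _ (fun y => g S (zeta y))).
  exists eta => // y /near /Hzeta [yr yE]; rewrite gh//; last lra.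
  by rewrite yE.
apply: cdiff_comp => //; have [dg _ _] := gU; exact: dg.
Qed.

End Uniqueness.

(** * Derivatives and compact sets of the library *)

Section RegularDerivative.
Variable K : numFieldType.
Implicit Types (f : K^o -> K^o) (z l : K^o).

Definition eps_derivative f z l := forall e : K, 0 < e -> exists2 d : K, 0 < d &
  forall h : K, h != 0 -> `|h| < d -> `|h^-1 * (f (h + z) - f z) - l| < e.

Let quotientE f z (h : K) : h^-1 *: ((f \o shift z) (h *: (1 : K^o)) - f z) =
  h^-1 * (f (h + z) - f z).
Proof. by rewrite /= [h *: _]mulr1. Qed.

Lemma eps_derivativeP f z l :
  eps_derivative f z l <-> derivable f z 1 /\ 'D_1 f z = l.
Proof.
split=> [H|[/cvg_ex [m /= Hm] <-]].
  have cf : (fun h : K => h^-1 *: ((f \o shift z) (h *: (1 : K^o)) - f z)) @ 0^' --> l.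
    apply/cvgrPdistC_lt => e /H [d d0 Hd]; exists d => //= h.
    rewrite /ball_ /= sub0r normrN [h%:A]mulr1 => hd h0; exact: Hd.
  split; first by apply/cvg_ex; exists l.
  exact: (cvg_lim (@norm_hausdorff _ _) cf).
have -> : 'D_1 f z = m by exact: (cvg_lim (@norm_hausdorff _ _) Hm).
move: Hm => /cvgrPdistC_lt Hm e /Hm [d /= d0 Hd]; exists d => // h h0 hd.
by rewrite -quotientE; apply: Hd => //=; rewrite /ball_ /= sub0r normrN.
Qed.

End RegularDerivative.

Section Interface.
Context {R : realType}.
Local Notation C := R[i].
Implicit Types (f : (R[i])^o -> (R[i])^o) (z l : (R[i])^o).

Lemma normC_nc (z : R[i]) : `|z| = (nc z)%:C%C.
Proof. by []. Qed.

(** A positive element of [R[i]] has zero imaginary part, so its radii are real ones in disguise. *)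
Lemma cder_eps f z l : cder (f : C -> C) z l <-> eps_derivative f z l.
Proof.
split=> [/cderP H e|H].
- rewrite ltcE /= => /andP[/eqP e1 e0].
  have eE : e = (complex.Re e)%:C%C by move: e1; case: (e) => a b /= ->.
  have e2 : 0 < complex.Re e / 2 by lra.
  have [d d0 Hd] := H _ e2.
  exists d%:C%C => [|h h0]; first by rewrite ltcR.
  rewrite normC_nc ltcR => hd.
  have := Hd (h + z); rewrite addrK => /(_ hd) h1.
  have hn : 0 < nc h by rewrite nc_gt0.
  rewrite eE normC_nc ltcR.
  have -> : h^-1 * (f (h + z) - f z) - l = (f (h + z) - f z - l * h) / h :> C.
    by rewrite mulrBl mulfK//; congr (_ - _); exact: mulrC.
  rewrite ncM ncV ltr_pdivrMr// (le_lt_trans h1)// ltr_pM2r//; lra.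
- apply/cderP => e e0; have eC : (0 : C) < e%:C%C by rewrite ltcR.
  have [d0 + Hd] := H _ eC; rewrite ltcE /= => /andP[/eqP d1 d00].
  have dE : d0 = (complex.Re d0)%:C%C by move: d1; case: (d0) => a b /= ->.
  exists (complex.Re d0) => // w wz.
  have [->|wz0] := eqVneq w z; first by rewrite !subrr mulr0 subrr nc0 mulr0.
  have h0 : w - z != 0 by rewrite subr_eq0.
  have := Hd (w - z) h0; rewrite dE !normC_nc !ltcR subrK => /(_ wz).
  have -> : (w - z)^-1 * (f w - f z) - l = (f w - f z - l * (w - z)) / (w - z) :> C.
    by rewrite mulrBl mulfK//; congr (_ - _); exact: mulrC.
  rewrite ncM ncV ltr_pdivrMr ?nc_gt0//; exact: ltW.
Qed.

Lemma cder_derive f z l : cder (f : C -> C) z l -> derivable f z 1 /\ 'D_1 f z = l.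
Proof. by move=> /cder_eps /eps_derivativeP. Qed.

Lemma derivable_cder f z : derivable f z 1 -> cder (f : C -> C) z ('D_1 f z).
Proof. by move=> fz; apply/cder_eps/eps_derivativeP. Qed.

Lemma derivable_cdiff f z : derivable f z 1 <-> cdiff (f : C -> C) z.
Proof.
split; first by move=> /derivable_cder h; eexists; exact: h.
by move=> [l /cder_derive []].
Qed.

Lemma compact_disk (K : set (R[i])^o) : compact K -> K `<=` disk ->
  exists2 r : R, 0 <= r < 1 & forall z, K z -> nc z <= r.
Proof.
move=> cK KD.
pose U (n : nat) : set (R[i])^o := [set z | nc z < 1 - n.+1%:R^-1].
have cover_K : K `<=` \bigcup_(n in setT) U n.
  move=> z /KD; rewrite /disk /= => z1.
  have q0 : 0 <= (1 - nc z)^-1 by rewrite invr_ge0 subr_ge0 ltW.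
  exists (Num.bound (1 - nc z)^-1) => //=; rewrite /U /= ltrBrDl -ltrBrDr.
  rewrite -[ltRHS]invrK ltf_pV2 ?posrE ?invr_gt0 ?subr_gt0//.
  by rewrite (lt_trans (archi_boundP q0))// ltr_nat.
have openU n : open (U n).
  rewrite openE => z; rewrite /U /= => zU.
  have dC : (0 : R[i]) < (1 - n.+1%:R^-1 - nc z)%:C%C by rewrite ltcR subr_gt0.
  apply/nbhs_ballP; exists (1 - n.+1%:R^-1 - nc z)%:C%C => // w.
  rewrite /ball /= /ball_ normC_nc ltcR => h.
  have h' : nc (w - z : C) < 1 - n.+1%:R^-1 - nc z by rewrite ncC.
  have h2 : nc w - nc z <= nc (w - z : C) := ncBge w z.
  by rewrite -(ltrD2r (- nc z)); exact: le_lt_trans h2 h'.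
move: cK; rewrite compact_cover => /(_ _ setT U (fun n _ => openU n) cover_K) [D _ HD].
exists (1 - (\max_(n <- finmap.enum_fset D) n).+1%:R^-1).
  by rewrite subr_ge0 invf_le1// ler1n/= gtrBl invr_gt0 ltr0n.
move=> z /HD [n /= nD] /ltW; rewrite /U /= => /le_trans; apply.
rewrite lerD2l lerN2 lef_pV2 ?posrE ?ltr0n// ler_nat ltnS.
exact: leq_bigmax_seq.
Qed.

End Interface.

(** * Disk automorphisms *)

Section Mobius.
Context {R : realType}.
Local Notation C := R[i].
Implicit Types (a b z w : C) (r rho : R).

Definition mobius a z := (z - a) / (1 - a^*%C * z).

Lemma mobius_self a : mobius a a = 0.
Proof. by rewrite /mobius subrr mul0r. Qed.

Lemma mobius0z z : mobius 0 z = z.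
Proof. by rewrite /mobius conjc0 mul0r !subr0 divr1. Qed.

Lemma conjcN a : (- a)^*%C = - a^*%C.
Proof. exact: (rmorphN (@conjc R)). Qed.

Lemma mobius_den_neq0 a z : nc a < 1 -> nc z < 1 -> 1 - a^*%C * z != 0.
Proof. by move=> a1 z1; apply: nc_unitP => //; exact: ltW. Qed.

Lemma mobiusN0 a : mobius (- a) 0 = a.
Proof. by rewrite /mobius mulr0 subr0 opprK add0r divr1. Qed.

Lemma mobius_den_ge a z rho : nc a <= rho -> nc z <= 1 -> 1 - rho <= nc (1 - a^*%C * z).
Proof.
move=> ar z1; apply: le_trans (ncBge _ _); rewrite nc1 lerD2l lerN2 ncM nc_conj.
by rewrite (le_trans _ ar)// ler_piMr// nc_ge0.
Qed.

Lemma mobius_modulus a z : nc a < 1 -> nc z < 1 ->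
  1 - nc (mobius a z) ^+ 2 = (1 - nc a ^+ 2) * (1 - nc z ^+ 2) / nc (1 - a^*%C * z) ^+ 2.
Proof.
move=> a1 z1; have n0 := mobius_den_neq0 a1 z1.
rewrite -mobius_identity ncM ncV expr_div_n.
by rewrite mulrBl divff// expf_neq0// nc_eq0.
Qed.

Lemma mobius_disk a z : nc a < 1 -> nc z < 1 -> nc (mobius a z) < 1.
Proof.
move=> a1 z1; have n0 := mobius_den_neq0 a1 z1.
have : 0 < 1 - nc (mobius a z) ^+ 2.
  rewrite mobius_modulus// divr_gt0 ?exprn_gt0 ?nc_gt0// mulr_gt0//.
    by rewrite subr_gt0 expr_lt1// nc_ge0.
  by rewrite subr_gt0 expr_lt1// nc_ge0.
by rewrite subr_gt0 expr_lt1// nc_ge0.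
Qed.

Lemma mobiusK a z : nc a < 1 -> nc z < 1 -> mobius (- a) (mobius a z) = z.
Proof.
move=> a1 z1; have n0 := mobius_den_neq0 a1 z1; have n1 := mobius_den_neq0 a1 a1.
rewrite /mobius conjcN mulNr !opprK.
have e1 : (z - a) / (1 - a^*%C * z) + a = z * (1 - a^*%C * a) / (1 - a^*%C * z) by field.
have e2 : 1 + a^*%C * ((z - a) / (1 - a^*%C * z)) = (1 - a^*%C * a) / (1 - a^*%C * z) by field.
by rewrite e1 e2; field; rewrite n0 n1.
Qed.

Lemma mobiusKV a z : nc a < 1 -> nc z < 1 -> mobius a (mobius (- a) z) = z.
Proof. by move=> a1 z1; rewrite -{1}[a]opprK mobiusK// ncN. Qed.

Lemma cdiff_mobius a z : nc a < 1 -> nc z < 1 -> cdiff (mobius a) z.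
Proof.
move=> a1 z1; apply: cdiffM; first by apply: cdiffB; [exact: cdiff_id|exact: cdiff_cst].
apply: cdiffV; first exact: mobius_den_neq0.
apply: cdiffB; first exact: cdiff_cst.
by apply: cdiffM; [exact: cdiff_cst|exact: cdiff_id].
Qed.

Lemma cder_mobius_self a : nc a < 1 -> cder (mobius a) a (1 - nc a ^+ 2)^-1%:C%C.
Proof.
move=> a1; exists (fun z => (1 - a^*%C * z)^-1); split.
- apply: ccontV; first exact: mobius_den_neq0.
  apply: ccontB; first exact: ccont_cst.
  by apply: ccontM; [exact: ccont_cst|exact: ccont_id].
- by rewrite fmorphV rmorphB rmorph1 /= nc_sqr mulrC.
- by move=> z; rewrite mobius_self subr0 mulrC.
Qed.

(** A crude bound for |mobius a z| with |a| <= rho and |z| <= r: in [mobius_modulus] the denominator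
    is at most 4, and 1 - x^2 <= 2 (1 - x) gives the remaining factor 2. *)
Definition mobius_radius rho r := 1 - (1 - rho ^+ 2) * (1 - r ^+ 2) / 8.

Lemma mobius_radius_lt1 rho r : 0 <= rho < 1 -> 0 <= r < 1 -> 0 <= mobius_radius rho r < 1.
Proof.
move=> /andP[p0 p1] /andP[r0 r1].
have h1 : 0 < 1 - rho ^+ 2 <= 1 by rewrite subr_gt0 expr_lt1// p1 gerBl sqr_ge0.
have h2 : 0 < 1 - r ^+ 2 <= 1 by rewrite subr_gt0 expr_lt1// r1 gerBl sqr_ge0.
have /andP[a0 a1] := h1; have /andP[b0 b1] := h2.
have h3 : 0 < (1 - rho ^+ 2) * (1 - r ^+ 2) by rewrite mulr_gt0.
have h4 : (1 - rho ^+ 2) * (1 - r ^+ 2) <= 1 by rewrite mulr_ile1// ltW.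
rewrite /mobius_radius; apply/andP; split; lra.
Qed.

Lemma mobius_le a z rho r : rho < 1 -> r < 1 -> nc a <= rho -> nc z <= r ->
  nc (mobius a z) <= mobius_radius rho r.
Proof.
move=> p1 r1 ap zr; have a1 : nc a < 1 by lra.
have z1 : nc z < 1 by lra.
have a0 := nc_ge0 a; have z0 := nc_ge0 z.
have M1 := mobius_disk a1 z1; have M0 := nc_ge0 (mobius a z).
have E := mobius_modulus a1 z1.
have n0 : 0 < nc (1 - a^*%C * z) by rewrite nc_gt0 mobius_den_neq0.
have n2 : nc (1 - a^*%C * z) <= 2.
  rewrite (le_trans (ncB _ _))// nc1 ncM nc_conj.
  have : nc a * nc z <= 1 by rewrite mulr_ile1// ltW.
  lra.
have h1 : 1 - rho ^+ 2 <= 1 - nc a ^+ 2 by rewrite lerD2l lerN2 ler_sqr ?nnegrE//; lra.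
have h2 : 1 - r ^+ 2 <= 1 - nc z ^+ 2 by rewrite lerD2l lerN2 ler_sqr ?nnegrE//; lra.
have p2 : 0 <= 1 - rho ^+ 2 by rewrite subr_ge0 expr_le1//; lra.
have r2 : 0 <= 1 - r ^+ 2 by rewrite subr_ge0 expr_le1//; lra.
have h3 : (1 - rho ^+ 2) * (1 - r ^+ 2) <= (1 - nc a ^+ 2) * (1 - nc z ^+ 2) by apply: ler_pM.
have h4 : (1 - rho ^+ 2) * (1 - r ^+ 2) / 4 <= 1 - nc (mobius a z) ^+ 2.
  rewrite E ler_pdivlMr ?exprn_gt0// mulrAC ler_pdivrMr; last lra.
  apply: ler_pM => //; [exact: mulr_ge0|exact: sqr_ge0|].
  by have := sqr_ge0 (2 - nc (1 - a^*%C * z)); nra.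
rewrite /mobius_radius; set q := (1 - rho ^+ 2) * _ in h4 *.
have : 1 - nc (mobius a z) ^+ 2 <= 2 * (1 - nc (mobius a z)) by nra.
lra.
Qed.

Lemma mobius_lip a z w rho : rho < 1 -> nc a <= rho -> nc z < 1 -> nc w < 1 ->
  nc (mobius a z - mobius a w) <= nc (z - w) / (1 - rho) ^+ 2.
Proof.
move=> p1 ap z1 w1; have a1 : nc a < 1 by lra.
have nz := mobius_den_neq0 a1 z1; have nw := mobius_den_neq0 a1 w1.
have -> : mobius a z - mobius a w =
   (z - w) * (1 - a^*%C * a) / ((1 - a^*%C * z) * (1 - a^*%C * w)).
  by rewrite /mobius; field; rewrite nz nw.
rewrite !ncM ncV -mulrA; apply: ler_wpM2l; first exact: nc_ge0.
have dz := mobius_den_ge ap (ltW z1); have dw := mobius_den_ge ap (ltW w1).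
have p0 : 0 < 1 - rho by lra.
have -> : nc (1 - a^*%C * a) = 1 - nc a ^+ 2.
  have -> : 1 - a^*%C * a = (1 - nc a ^+ 2)%:C%C by rewrite rmorphB rmorph1 /= nc_sqr mulrC.
  by rewrite nc_real ger0_norm// subr_ge0 expr_le1 ?nc_ge0// ltW.
rewrite -[leRHS]mul1r; apply: ler_pM.
- by rewrite subr_ge0 expr_le1 ?nc_ge0// ltW.
- by rewrite invr_ge0 nc_ge0.
- by rewrite gerBl sqr_ge0.
- rewrite lef_pV2 ?posrE ?exprn_gt0 ?ncM ?mulr_gt0 ?nc_gt0//.
  by rewrite expr2; apply: ler_pM => //; exact: ltW.
Qed.

Lemma mobius_param_lip a b z rho : rho < 1 -> nc a <= rho -> nc b <= rho -> nc z < 1 ->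
  nc (mobius a z - mobius b z) <= 4 * nc (a - b) / (1 - rho) ^+ 2.
Proof.
move=> p1 ap bp z1; have a1 : nc a < 1 by lra.
have b1 : nc b < 1 by lra.
have nz := mobius_den_neq0 a1 z1; have nw := mobius_den_neq0 b1 z1.
have -> : mobius a z - mobius b z =
   ((a - b)^*%C * z ^+ 2 - (a - b) + (z * ((a - b) * b^*%C) - z * (b * (a - b)^*%C)))
   / ((1 - a^*%C * z) * (1 - b^*%C * z)).
  have -> : (a - b)^*%C = a^*%C - b^*%C by exact: (rmorphB (@conjc R)).
  by rewrite /mobius; field; rewrite nz nw.
rewrite ncM ncV; apply: ler_pM; rewrite ?nc_ge0 ?invr_ge0 ?nc_ge0//.
  have ab0 := nc_ge0 (a - b); have z0 := nc_ge0 z; have b0 := nc_ge0 b.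
  rewrite (le_trans (ncD _ _))//.
  have e1 : nc ((a - b)^*%C * z ^+ 2 - (a - b)) <= 2 * nc (a - b).
    rewrite (le_trans (ncB _ _))// ncM nc_conj ncX.
    have : nc (a - b) * nc z ^+ 2 <= nc (a - b) by rewrite ler_piMr// expr_le1// ltW.
    lra.
  have e2 : nc (z * ((a - b) * b^*%C) - z * (b * (a - b)^*%C)) <= 2 * nc (a - b).
    rewrite (le_trans (ncB _ _))// !ncM !nc_conj.
    have : nc z * (nc (a - b) * nc b) <= nc (a - b).
      by rewrite mulrCA ler_piMr// mulr_ile1// ltW.
    lra.
  lra.
have dz := mobius_den_ge ap (ltW z1); have dw := mobius_den_ge bp (ltW z1).
have p0 : 0 < 1 - rho by lra.
rewrite lef_pV2 ?posrE ?exprn_gt0 ?ncM ?mulr_gt0 ?nc_gt0//.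
by rewrite expr2; apply: ler_pM => //; exact: ltW.
Qed.

Lemma half_disk : nc (1 / 2 : C) = 1 / 2.
Proof. by rewrite ncM ncV nc1 nc_nat. Qed.

(** The two-point rigidity. Moving f 0 back to 0 changes f by at most 4 |f 0| and gives a map z k(z)
    with |k| <= 1. Then |k(1/2) - 1| <= 8 eps, and [schwarz_pick_contract] spreads this to |z| <= r;
    12 is 4 + 8. *)
Lemma selfmap_deviation (f : C -> C) r z : (forall z, nc z < 1 -> cdiff f z) ->
  (forall z, nc z < 1 -> nc (f z) < 1) -> 0 <= r < 1 -> nc z <= r ->
  nc (f z - z) <= (12 + 16 / (1 - mobius_radius (1 / 2) r)) *
    (nc (f 0 - 0) + nc (f (1 / 2) - 1 / 2)).
Proof.
move=> df f1 rI zr; have /andP[r0 r1] := rI.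
have nc01 : nc (0 : C) < 1 by rewrite nc0.
have h1 : nc (1 / 2 : C) < 1 by rewrite half_disk; lra.
have z1 : nc z < 1 by lra.
rewrite subr0; pose a := f 0; rewrite -/a.
set eps := nc a + _; set rho := mobius_radius _ _.
have hI : 0 <= (1 / 2 : R) < 1 by apply/andP; split; lra.
have /andP[rho0 rho1] := mobius_radius_lt1 hI rI; rewrite -/rho in rho0 rho1.
have q0 : 0 <= 16 / (1 - rho) by rewrite divr_ge0//; lra.
have e0 : nc a <= eps by rewrite lerDl nc_ge0.
have e1 : nc (f (1 / 2) - 1 / 2) <= eps by rewrite lerDr nc_ge0.
have a0 := nc_ge0 a; have eps0 : 0 <= eps by lra.
have qe : 0 <= 16 / (1 - rho) * eps by rewrite mulr_ge0.
(* If |f 0| > 1/2 the claim is trivial: two points of the disk are less than 2 apart. *)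
have [a2|a2] := ltP (1 / 2) (nc a).
  have fz := f1 _ z1; have := ncB (f z) z; rewrite mulrDl; lra.
have a1 : nc a < 1 by lra.
have near w : nc w < 1 -> nc (mobius a w - w) <= 4 * nc a.
  move=> w1; have nw := mobius_den_neq0 a1 w1.
  have -> : mobius a w - w = (a^*%C * w ^+ 2 - a) / (1 - a^*%C * w) by rewrite /mobius; field.
  have dw := mobius_den_ge a2 (ltW w1).
  rewrite ncM ncV ler_pdivrMr ?nc_gt0//.
  have : nc (a^*%C * w ^+ 2 - a) <= 2 * nc a.
    rewrite (le_trans (ncB _ _))// ncM nc_conj ncX.
    have : nc a * nc w ^+ 2 <= nc a by rewrite ler_piMr// expr_le1 ?nc_ge0// ltW.
    lra.
  have : nc a * (1 / 2) <= nc a * nc (1 - a^*%C * w) by rewrite ler_wpM2l//; lra.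
  lra.
pose chi u := mobius a (f u).
have dchi u : nc u < 1 -> cdiff chi u.
  by move=> u1; apply: cdiff_comp; [exact: df|apply: cdiff_mobius => //; exact: f1].
have chi1 u : nc u < 1 -> nc (chi u) <= 1.
  by move=> u1; apply/ltW/mobius_disk => //; exact: f1.
have chi0 : chi 0 = 0 by rewrite /chi -/a mobius_self.
have [k [dk k1 ck _]] := schwarz_quotient dchi chi0 chi1.
have half0 : (1 / 2 : C) != 0 by rewrite -nc_gt0 half_disk; lra.
have c1 : nc (k (1 / 2) - 1) <= 8 * eps.
  have h2 : nc (chi (1 / 2) - 1 / 2) <= 4 * eps.
    apply: (le_trans (ncB3 (f (1 / 2)) _ _)).
    have h3 : nc (chi (1 / 2) - f (1 / 2)) <= 4 * nc a := near _ (f1 _ h1).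
    have n4 := nc_ge0 (f (1 / 2) - 1 / 2).
    rewrite /eps; lra.
  have E : chi (1 / 2) - 1 / 2 = (1 / 2) * (k (1 / 2) - 1) by rewrite ck; ring.
  rewrite E ncM half_disk in h2; lra.
have kd : nc (k z - k (1 / 2)) <= 16 / (1 - rho) * eps.
  have pd : nc (z - 1 / 2) <= rho * nc (1 - (1 / 2 : C)^*%C * z).
    have hh : nc (1 / 2 : C) <= 1 / 2 by rewrite half_disk.
    have hl : (1 / 2 : R) < 1 by lra.
    have := mobius_le hl r1 hh zr; rewrite -/rho /mobius ncM ncV.
    by rewrite ler_pdivrMr// nc_gt0 mobius_den_neq0.
  have := schwarz_pick_contract dk k1 h1 z1 pd rho0 rho1.
  move/le_trans; apply.
  have c2 : 1 - nc (k (1 / 2)) ^+ 2 <= 16 * eps.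
    have cc := k1 _ h1; have c0 := nc_ge0 (k (1 / 2)).
    have := ncBge 1 (k (1 / 2)); rewrite nc1 ncC => h3.
    have : 1 - nc (k (1 / 2)) ^+ 2 <= 2 * (1 - nc (k (1 / 2))) by nra.
    lra.
  have c3 : 0 <= 1 - nc (k (1 / 2)) ^+ 2 by rewrite subr_ge0 expr_le1 ?nc_ge0 ?k1.
  rewrite [leRHS]mulrAC; apply: ler_wpM2r; first by rewrite invr_ge0; lra.
  by apply: le_trans c2; rewrite ler_piMr// ltW.
have cz : nc (chi z - z) <= 8 * eps + 16 / (1 - rho) * eps.
  have -> : chi z - z = z * (k z - 1) by rewrite ck; ring.
  rewrite ncM; apply: (@le_trans _ _ (nc (k z - 1))).
    by rewrite ler_piMl ?nc_ge0// ltW.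
  by have := ncB3 (k (1 / 2)) (k z) 1; lra.
have h3 : nc (f z - chi z) <= 4 * nc a by rewrite ncC; exact: near _ (f1 _ z1).
have := ncB3 (chi z) (f z) z; rewrite mulrDl; lra.
Qed.

End Mobius.

(** * Integrable bounds *)

Section IntegrableOrder.
Context {R : realType}.
Local Notation mu := (@lebesgue_measure R).
Implicit Types (k : R -> R) (d : \bar R) (s t T : R).

Lemma lebesgue_segment_lty T : (mu `[0%R, T]%classic < +oo)%E.
Proof. by rewrite lebesgue_measure_itv /=; case: ifP => _; rewrite ?ltry// -EFinD ltry. Qed.

Lemma integrable_cst_segment T (M : R) : mu.-integrable `[0, T] (EFin \o cst M).
Proof.
apply/integrableP; split; first exact/measurable_EFinP.
rewrite (_ : (fun x => _) = cst (`|M|%:E)); last by apply/funext.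
by rewrite integral_cst//= lte_mul_pinfty// ?lebesgue_segment_lty// abse_ge0.
Qed.

(** On a segment |k| <= 1 + |k|^r for finite r >= 1, and for order +oo k is essentially bounded. *)
Lemma Ld_on_integrable d T k : (1 <= d)%E -> Ld_on d 0 T k ->
  mu.-integrable `[0, T] (EFin \o k).
Proof.
move=> d1 [mk]; rewrite unlock /Lnorm; have mT : measurable `[0%R, T]%classic by [].
case: d d1 => [r r1|_|//].
- have r0 : 0 < r by rewrite (lt_le_trans ltr01).
  have mkr : measurable_fun `[0, T] (fun x => `|k x| `^ r).
    apply: (@measurableT_comp _ _ _ _ _ _ (@powR R ^~ r)) => //.
    exact: measurableT_comp.
  move=> /lty_poweRy; rewrite invr_neq0 ?gt_eqF// => /(_ isT) H.
  have ikr : mu.-integrable `[0, T] (EFin \o (fun x => `|k x| `^ r)).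
    apply/integrableP; split; first exact/measurable_EFinP.
    apply: le_lt_trans H; rewrite [leLHS]integral_mkcond le_eqVlt; apply/orP; left; apply/eqP.
    apply: eq_integral => x _; rewrite /patch /=; case: ifP => _ /=.
      by rewrite ger0_norm ?powR_ge0.
    by rewrite normr0 powR0// gt_eqF.
  apply: (le_integrable _ _ _ (integrableD _ (integrable_cst_segment T 1) ikr)) => //.
    exact/measurable_EFinP.
  move=> x _ /=; rewrite lee_fin [leRHS]ger0_norm; last first.
    by rewrite addr_ge0// powR_ge0.
  have [k1|k1] := leP `|k x| 1; first by rewrite (le_trans k1)// lerDl powR_ge0.
  rewrite (@le_trans _ _ (`|k x| `^ r))//; last by rewrite lerDr.
  by rewrite -{1}[`|k x|]powRr1// ler_powR// ltW.
- have -> : (0 < mu [set: R])%E.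
    rewrite (@lt_le_trans _ _ (mu `[0%R, 1]%classic))//.
      by rewrite lebesgue_measure_itv /= lte_fin ltr01 -EFinD subr0 lte_fin ltr01.
    by apply: le_measure; rewrite ?inE.
  move=> /(@ess_supr_bounded _ _ _ mu (fun x => `|(k \_ `[0, T]) x|)) [M kM].
  apply/integrableP; split; first exact/measurable_EFinP.
  apply: (@le_lt_trans _ _ (\int[mu]_(x in `[0%R, T]%classic) (cst `|M|%:E) x)%E).
    apply: ae_ge0_le_integral => //.
    - by apply: measurableT_comp => //; exact/measurable_EFinP.
    - by move=> x _; rewrite lee_fin normr_ge0.
    - apply: filterS kM => x kx xT /=; rewrite lee_fin.
      by move: kx; rewrite /patch /= mem_set// => /le_trans; apply; exact: ler_norm.
  by rewrite integral_cst//= lte_mul_pinfty// ?lebesgue_segment_lty// abse_ge0.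
Qed.

Lemma sub_segment s t T : 0 <= s -> t <= T -> `[s, t]%classic `<=` `[0%R, T]%classic.
Proof.
move=> s0 tT x /=; rewrite !in_itv /= => /andP[sx xt].
by rewrite (le_trans s0 sx) (le_trans xt tT).
Qed.

Lemma integrable_sub s t T k : 0 <= s -> t <= T ->
  mu.-integrable `[0, T] (EFin \o k) -> mu.-integrable `[s, t] (EFin \o k).
Proof. by move=> s0 tT; apply: integrableS => //; exact: sub_segment. Qed.

Lemma int_on_continuous T k (e : R) : (forall x, x \in `[0, T] -> 0 <= k x) ->
  mu.-integrable `[0, T] (EFin \o k) -> 0 < e ->
  exists2 d : R, 0 < d & forall s t, 0 <= s -> s <= t -> t <= T -> t - s < d ->
    int_on s t k < e.
Proof.
move=> k0 ik e0; have mT : measurable `[0%R, T]%classic by [].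
have ik' : mu.-integrable setT (EFin \o (k \_ `[0, T])).
  have -> : EFin \o (k \_ `[0, T]) = (EFin \o k) \_ `[0, T].
    by apply/funext => x; rewrite /patch /=; case: ifP.
  by have [h _] := integrable_mkcond (mu := mu) (EFin \o k) mT; have := h ik.
have [d [d0 Hd]] := integral_normr_continuous ik' e0.
exists d => // s t s0 st tT std.
have mst : measurable `[s, t]%classic by [].
have mu_lt : (mu `[s, t]%classic < d%:E)%E.
  by rewrite lebesgue_measure_itv /=; case: ifP => _; rewrite ?lte_fin// -EFinD lte_fin.
have -> : int_on s t k = \int[mu]_(x in `[s, t]%classic) `|(k \_ `[0, T]) x|.
  apply: eq_Rintegral => x /set_mem xst.
  have xT := sub_segment s0 tT xst.
  by rewrite /patch mem_set// ger0_norm// k0.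
exact: Hd _ mst mu_lt.
Qed.

Lemma int_onZ s t T k (c : R) : 0 <= s -> t <= T -> mu.-integrable `[0, T] (EFin \o k) ->
  int_on s t (fun x => c * k x) = c * int_on s t k.
Proof. by move=> s0 tT ik; apply: RintegralZl => //; exact: integrable_sub ik. Qed.

Lemma int_onD s t T k1 k2 : 0 <= s -> t <= T -> mu.-integrable `[0, T] (EFin \o k1) ->
  mu.-integrable `[0, T] (EFin \o k2) ->
  int_on s t (fun x => k1 x + k2 x) = int_on s t k1 + int_on s t k2.
Proof.
by move=> s0 tT ik1 ik2; apply: RintegralD => //; [exact: integrable_sub ik1|exact: integrable_sub ik2].
Qed.

Lemma integrable_Ld1 T k : mu.-integrable `[0, T] (EFin \o k) -> Ld_on 1 0 T k.
Proof.
move=> /integrableP[/measurable_EFinP mk ik]; split=> //.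
rewrite Lnorm1; apply: le_lt_trans ik; rewrite [leRHS]integral_mkcond.
rewrite le_eqVlt; apply/orP; left; apply/eqP; apply: eq_integral => x _.
by rewrite /patch /=; case: ifP => _ //=; rewrite normr0.
Qed.

End IntegrableOrder.

(** * Centering an evolution family *)

Section Normalization.
Context {R : realType}.
Local Notation C := R[i].
Variables (d : \bar R) (phi : R -> R -> C -> C) (beta : R).
Hypothesis EF : @evolution_family R d phi.

Lemma evol_diff s t z : 0 <= s -> s <= t -> nc z < 1 -> cdiff (phi s t) z.
Proof. by move=> s0 st z1; have [_ [/(_ s t s0 st)[H _] _]] := EF; apply/derivable_cdiff/H. Qed.

Lemma evol_self s t z : 0 <= s -> s <= t -> nc z < 1 -> nc (phi s t z) < 1.
Proof. by move=> s0 st z1; have [_ [/(_ s t s0 st)[_ H] _]] := EF; exact: H. Qed.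

Lemma evol_id s z : 0 <= s -> nc z < 1 -> phi s s z = z.
Proof. by move=> s0 z1; have [_ [_ [H _]]] := EF; exact: H. Qed.

Lemma evol_comp s u t z : 0 <= s -> s <= u -> u <= t -> nc z < 1 ->
  phi s t z = phi u t (phi s u z).
Proof. by have [_ [_ [_ [H _]]]] := EF; exact: H. Qed.

Lemma evol_integral z T : nc z < 1 -> 0 < T -> exists k : R -> R,
  [/\ forall x, x \in `[0, T] -> 0 <= k x,
      (@lebesgue_measure R).-integrable `[0, T] (EFin \o k) &
      forall s t, 0 <= s -> s <= t -> t <= T -> nc (phi s t z - z) <= int_on s t k].
Proof.
move=> z1 T0; have [d1 [_ [_ [_ H]]]] := EF; have [k [k0 [Lk Hk]]] := H z T z1 T0.
exists k; split=> //; first exact: Ld_on_integrable Lk.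
by move=> s t s0 st tT; have := Hk s s t s0 (lexx _) st tT; rewrite evol_id// ncC.
Qed.

Lemma evol_modulus z T (e : R) : nc z < 1 -> 0 < e -> exists2 d : R, 0 < d &
  forall s t, 0 <= s -> s <= t -> t <= T -> t - s < d -> nc (phi s t z - z) < e.
Proof.
move=> z1 e0; pose T' := Num.max T 1.
have T'0 : 0 < T' by rewrite lt_max ltr01 orbT.
have [k [k0 ik Hk]] := evol_integral z1 T'0.
have [d' d'0 Hd] := int_on_continuous k0 ik e0; exists d' => // s t s0 st tT std.
have tT' : t <= T' by rewrite le_max tT.
exact: le_lt_trans (Hk _ _ s0 st tT') (Hd _ _ s0 st tT' std).
Qed.

Let nc01 : nc (0 : C) < 1. Proof. by rewrite nc0. Qed.

Let half1 : nc (1 / 2 : C) < 1. Proof. by rewrite half_disk; lra. Qed.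

Definition evol_dev s t := nc (phi s t 0 - 0) + nc (phi s t (1 / 2) - 1 / 2).

Lemma evol_dev_modulus T (e : R) : 0 < e -> exists2 d : R, 0 < d &
  forall s t, 0 <= s -> s <= t -> t <= T -> t - s < d -> evol_dev s t < e.
Proof.
move=> e0; have e2 : 0 < e / 2 by lra.
have [d1 d10 H1] := evol_modulus T nc01 e2.
have [d2 d20 H2] := evol_modulus T half1 e2.
exists (Num.min d1 d2); first by rewrite lt_min d10.
move=> s t s0 st tT; rewrite lt_min => /andP[h1 h2].
have := H1 _ _ s0 st tT h1; have := H2 _ _ s0 st tT h2; rewrite /evol_dev; lra.
Qed.

Definition deviation_const (r : R) := 12 + 16 / (1 - mobius_radius (1 / 2) r).

Lemma deviation_const_ge0 r : 0 <= r < 1 -> 0 <= deviation_const r.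
Proof.
move=> rI; have hI : 0 <= (1 / 2 : R) < 1 by apply/andP; split; lra.
have /andP[_ r1] := mobius_radius_lt1 hI rI.
by rewrite addr_ge0// divr_ge0// subr_ge0 ltW.
Qed.

Lemma evol_near_id s t z r : 0 <= s -> s <= t -> 0 <= r < 1 -> nc z <= r ->
  nc (phi s t z - z) <= deviation_const r * evol_dev s t.
Proof.
move=> s0 st rI zr; apply: selfmap_deviation => //.
- by move=> u; exact: evol_diff.
- by move=> u; exact: evol_self.
Qed.

Definition orbit0 t := phi 0 t 0.
Local Notation a := orbit0.

Lemma orbit0_disk t : 0 <= t -> nc (a t) < 1.
Proof. by move=> t0; apply: evol_self. Qed.

Lemma orbit0_disk_opp t : 0 <= t -> nc (- a t) < 1.
Proof. by move=> t0; rewrite ncN; exact: orbit0_disk. Qed.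

Lemma orbit00 : a 0 = 0.
Proof. exact: evol_id. Qed.

Lemma evol_orbit0 s t : 0 <= s -> s <= t -> phi s t (a s) = a t.
Proof. by move=> s0 st; rewrite /a -evol_comp. Qed.

(** On a short step |phi s u 0| <= 1/2, and by Schwarz-Pick a u lies within pseudo-hyperbolic
    distance |a s| of that point; [mobius_radius] turns this into a radius below 1. *)
Lemma orbit0_bounded T : 0 <= T -> exists2 rho : R, 0 <= rho < 1 &
  forall t, 0 <= t -> t <= T -> nc (a t) <= rho.
Proof.
move=> T0; have h2 : 0 < (1 / 2 : R) by lra.
have [dl dl0 Hd] := evol_modulus T nc01 h2.
apply: (@interval_chain _ (fun s t => exists2 rho : R, 0 <= rho < 1 &
  forall u, s <= u -> u <= t -> nc (a u) <= rho) T dl) => //.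
- move=> s u t s0 su ut tT [r1 /andP[r10 r11] H1] [r2 /andP[r20 r21] H2].
  exists (Num.max r1 r2); first by rewrite le_max r10 gt_max r11 r21.
  move=> v sv vt; rewrite le_max; have [vu|/ltW uv] := leP v u.
    by rewrite H1.
  by rewrite H2// orbT.
- move=> s t s0 st tT std.
  have as1 := orbit0_disk s0.
  have rI : 0 <= nc (a s) < 1 by rewrite nc_ge0.
  have hI : 0 <= (1 / 2 : R) < 1 by apply/andP; split; lra.
  exists (mobius_radius (1 / 2) (nc (a s))); first exact: mobius_radius_lt1.
  move=> u su ut.
  have u0 : 0 <= u by lra.
  have b2 : nc (phi s u 0) <= 1 / 2.
    rewrite -[phi s u 0]subr0; apply/ltW/Hd => //; lra.
  have b1 : nc (phi s u 0) < 1 by lra.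
  have au1 := orbit0_disk u0.
  have sp : nc (mobius (phi s u 0) (a u)) <= nc (a s).
    have := @schwarz_pick _ (phi s u) 0 (a s) (fun z => @evol_diff s u z s0 su)
      (fun z z1 => ltW (evol_self s0 su z1)) nc01 as1.
    rewrite conjc0 mul0r !subr0 nc1 mulr1 evol_orbit0// => h.
    rewrite /mobius ncM ncV ler_pdivrMr; last by rewrite nc_gt0 mobius_den_neq0.
    by rewrite mulrC.
  rewrite -(mobiusK b1 au1); apply: mobius_le => //; last by rewrite ncN.
  by have /andP[] := hI.
Qed.

Definition centered_map s t z := mobius (a t) (phi s t (mobius (- a s) z)).

Definition centered_deriv s t : C := 'D_1 (centered_map s t : (R[i])^o -> (R[i])^o) 0.

Lemma centered_map_diff s t z : 0 <= s -> s <= t -> nc z < 1 -> cdiff (centered_map s t) z.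
Proof.
move=> s0 st z1; have t0 : 0 <= t by lra.
have Tz := mobius_disk (orbit0_disk_opp s0) z1.
apply: (@cdiff_comp _ (fun z => phi s t (mobius (- a s) z))).
  apply: cdiff_comp; first by apply: cdiff_mobius => //; exact: orbit0_disk_opp.
  exact: evol_diff.
by apply: cdiff_mobius; [exact: orbit0_disk|exact: evol_self].
Qed.

Lemma centered_map_deriv s t : 0 <= s -> s <= t -> cder (centered_map s t) 0 (centered_deriv s t).
Proof. by move=> s0 st; apply: derivable_cder; apply/derivable_cdiff; exact: centered_map_diff. Qed.

Lemma centered_map_disk s t z : 0 <= s -> s <= t -> nc z < 1 -> nc (centered_map s t z) < 1.
Proof.
move=> s0 st z1; have t0 : 0 <= t by lra.
apply: mobius_disk; first exact: orbit0_disk.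
by apply: evol_self => //; apply: mobius_disk => //; exact: orbit0_disk_opp.
Qed.

Lemma centered_map0 s t : 0 <= s -> s <= t -> centered_map s t 0 = 0.
Proof. by move=> s0 st; rewrite /centered_map mobiusN0 evol_orbit0// mobius_self. Qed.

Lemma centered_map_mobius s t z : 0 <= s -> s <= t -> nc z < 1 ->
  centered_map s t (mobius (a s) z) = mobius (a t) (phi s t z).
Proof. by move=> s0 st z1; rewrite /centered_map mobiusK// orbit0_disk. Qed.

Lemma mobius_centered_map s t z : 0 <= s -> s <= t -> nc z < 1 ->
  mobius (- a t) (centered_map s t z) = phi s t (mobius (- a s) z).
Proof.
move=> s0 st z1; have t0 : 0 <= t by lra.
rewrite /centered_map mobiusK ?orbit0_disk//; apply: evol_self => //.
by apply: mobius_disk => //; exact: orbit0_disk_opp.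
Qed.

(** Reads the derivative off the value at 1/2. With psi z = z k(z) and delta = |psi(1/2) - 1/2|, one
    has |k(1/2) - 1| = 2 delta; the contraction bound from 1/2 to 0 costs twice as much again, in
    all 6 delta. *)
Lemma centered_deriv_near1 s t : 0 <= s -> s <= t -> 1 - 6 * nc (centered_map s t (1 / 2) - 1 / 2) <= nc (centered_deriv s t).
Proof.
move=> s0 st.
have [k [dk k1 pk k0]] := selfmap_quotient (fun z => @centered_map_diff s t z s0 st) (centered_map0 s0 st)
  (fun z => @centered_map_disk s t z s0 st) (centered_map_deriv s0 st).
rewrite -k0.
have h := @schwarz_pick_contract _ k (1 / 2) 0 (1 / 2) dk k1 half1 nc01.
have {h} : nc (k 0 - k (1 / 2)) <= 1 - nc (k (1 / 2)) ^+ 2.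
  have h2 : (1 / 2 : R) < 1 by lra.
  have -> : 1 - nc (k (1 / 2)) ^+ 2 = (1 - nc (k (1 / 2)) ^+ 2) * (1 / 2) / (1 - 1 / 2).
    by field; lra.
  by apply: h => //; rewrite mulr0 subr0 nc1 mulr1 sub0r ncN half_disk.
have E : centered_map s t (1 / 2) - 1 / 2 = (1 / 2) * (k (1 / 2) - 1) by rewrite pk; ring.
rewrite E ncM half_disk.
have c1 := k1 _ half1; have c0 := nc_ge0 (k (1 / 2)).
have := ncBge 1 (k (1 / 2)); rewrite nc1 (ncC 1).
have := ncBge (k (1 / 2)) (k 0); rewrite (ncC (k (1 / 2)) (k 0)).
set c := nc (k (1 / 2)) in c1 c0 *.
have : 1 - c ^+ 2 <= 2 * (1 - c) by nra.
lra.
Qed.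

Lemma centered_deriv_cont T e : 0 < e -> exists2 d : R, 0 < d &
  forall s t, 0 <= s -> s <= t -> t <= T -> t - s < d -> 1 - e <= nc (centered_deriv s t).
Proof.
move=> e0; have T'0 : 0 <= Num.max T 0 by rewrite le_max lexx orbT.
have [rho rI Ha] := orbit0_bounded T'0; have /andP[rho0 rho1] := rI.
have hI : 0 <= (1 / 2 : R) < 1 by apply/andP; split; lra.
pose r1 := mobius_radius rho (1 / 2).
have r1I : 0 <= r1 < 1 by exact: mobius_radius_lt1.
pose A := deviation_const r1; pose B := deviation_const rho.
have A0 : 0 <= A by exact: deviation_const_ge0.
have B0 : 0 <= B by exact: deviation_const_ge0.
pose D := 6 * ((A + 4 * B) / (1 - rho) ^+ 2).
have p0 : 0 < (1 - rho) ^+ 2 by rewrite exprn_gt0// subr_gt0.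
have D0 : 0 <= D by rewrite mulr_ge0// divr_ge0 ?(ltW p0)//; lra.
have q0 : 0 < e / (D + 1) by rewrite divr_gt0//; lra.
have [dl dl0 Hd] := evol_dev_modulus T q0.
exists dl => // s t s0 st tT std.
apply: le_trans (centered_deriv_near1 s0 st); rewrite lerD2l lerN2.
have t0 : 0 <= t by lra.
have tT' : t <= Num.max T 0 by rewrite le_max tT.
have sT' : s <= Num.max T 0 by lra.
have as1 := Ha _ s0 sT'; have at1 := Ha _ t0 tT'.
pose z := mobius (- a s) (1 / 2).
have nas1 : nc (- a s) <= rho by rewrite ncN.
have hh : nc (1 / 2 : C) <= 1 / 2 by rewrite half_disk.
have h21 : (1 / 2 : R) < 1 by lra.
have zr : nc z <= r1 by exact: mobius_le.
have z1 : nc z < 1 by have /andP[_ r11] := r1I; exact: le_lt_trans zr r11.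
have az : mobius (a s) z = 1 / 2 by apply: mobiusKV => //; lra.
have pz1 := evol_self s0 st z1.
have n1 : nc (phi s t z - z) <= A * evol_dev s t by exact: evol_near_id.
(* The centre moves exactly as [phi s t] moves the point a s, which stays in a fixed compact
   disk. *)
have n2 : nc (a t - a s) <= B * evol_dev s t.
  by rewrite -(evol_orbit0 s0 st); exact: evol_near_id.
have m1 := mobius_lip rho1 at1 pz1 z1.
have m2 := mobius_param_lip rho1 at1 as1 z1.
have hdev := Hd _ _ s0 st tT std.
have tri := ncB3 (mobius (a t) z) (mobius (a t) (phi s t z)) (1 / 2).
rewrite -{2}az in tri.
have psiE : centered_map s t (1 / 2) = mobius (a t) (phi s t z) by [].
rewrite -psiE in tri m1.
have : nc (centered_map s t (1 / 2) - 1 / 2) <= (A + 4 * B) / (1 - rho) ^+ 2 * evol_dev s t.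
  apply: (le_trans tri); apply: (le_trans (lerD m1 m2)).
  rewrite -mulrDl [leRHS]mulrAC; apply: ler_wpM2r; first by rewrite invr_ge0 ltW.
  have -> : (A + 4 * B) * evol_dev s t = A * evol_dev s t + 4 * (B * evol_dev s t) by ring.
  by apply: lerD => //; rewrite ler_wpM2l.
move=> h6; have {h6} : 6 * nc (centered_map s t (1 / 2) - 1 / 2) <= D * evol_dev s t.
  by rewrite /D -mulrA ler_wpM2l.
move/le_trans; apply.
have De : (D + 1) * (e / (D + 1)) = e by rewrite mulrC divfK// gt_eqF//; lra.
have : D * evol_dev s t <= D * (e / (D + 1)) by rewrite ler_wpM2l// ltW.
move/le_trans; apply; rewrite -[leRHS]De mulrDl mul1r lerDl; exact: ltW.
Qed.

Hypothesis phi_beta : @beta_ratio R phi @ +oo --> beta.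

(** The denominator 1 - |phi 0 t 0|^2 is the inverse derivative at a t of the automorphism that
    takes a t to 0. *)
Lemma centered_deriv_beta_ratio t : 0 <= t -> nc (centered_deriv 0 t) = @beta_ratio R phi t.
Proof.
move=> t0; have l0 : 0 <= (0 : R) by [].
have at1 := orbit0_disk t0.
have dphi : cder (phi 0 t) 0 ('D_1 (phi 0 t : (R[i])^o -> (R[i])^o) 0).
  by apply: derivable_cder; apply/derivable_cdiff; exact: evol_diff.
have -> : centered_deriv 0 t = (1 - nc (a t) ^+ 2)^-1%:C%C * 'D_1 (phi 0 t : (R[i])^o -> (R[i])^o) 0.
  apply: (@cder_unique _ (centered_map 0 t) 0); first exact: centered_map_deriv.
  apply: (@eq_cder _ (fun z => mobius (a t) (phi 0 t z))).
    by exists 1 => // z _; rewrite /centered_map orbit00 oppr0 mobius0z.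
  by apply: cder_comp => //; exact: cder_mobius_self.
rewrite ncM nc_real ger0_norm; first by rewrite mulrC.
by rewrite invr_ge0 subr_ge0 expr_le1 ?nc_ge0// ltW.
Qed.

Lemma centered_map_normalized : normalized_evolution centered_map centered_deriv beta.
Proof.
split.
- exact: centered_map_diff.
- exact: centered_map_disk.
- exact: centered_map0.
- exact: centered_map_deriv.
- move=> s z s0 z1; rewrite /centered_map evol_id ?mobiusKV ?orbit0_disk//.
  by apply: mobius_disk => //; exact: orbit0_disk_opp.
- move=> s u t z s0 su ut z1.
  have u0 : 0 <= u by lra.
  have Tz := mobius_disk (orbit0_disk_opp s0) z1.
  by rewrite {1}/centered_map (evol_comp s0 su ut Tz) -(mobius_centered_map s0 su z1).
- exact: centered_deriv_cont.
- move=> e e0; move/cvgrPdistC_lt: phi_beta => /(_ e e0) [T [_ HT]].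
  (* The filter [+oo] provides a strict inequality T < t; the summand 1 accounts for it. *)
  exists (Num.max (T + 1) 0) => t; rewrite ge_max => /andP[tT t0].
  by rewrite centered_deriv_beta_ratio//; apply: HT; lra.
Qed.

End Normalization.

(** * The standard chain *)

Section StandardChain.
Context {R : realType}.
Local Notation C := R[i].
Variables (d : \bar R) (phi : R -> R -> C -> C) (beta : R).
Hypothesis EF : @evolution_family R d phi.
Hypothesis phi_beta : @beta_ratio R phi @ +oo --> beta.
Local Notation a := (orbit0 phi).

Let NE := centered_map_normalized EF phi_beta.

Variable f : R -> C -> C.
Hypothesis fP : forall s z, 0 <= s -> nc z < 1 ->
  ccvg (fun n => gmap (centered_map phi) (centered_deriv phi) s n%:R z) (f s z).

Definition standard_chain t z := f t (mobius (a t) z).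
Local Notation F := standard_chain.

Let aD t : 0 <= t -> nc (a t) < 1. Proof. by move=> t0; exact: (orbit0_disk EF t0). Qed.
Let naD t : 0 <= t -> nc (- a t) < 1. Proof. by move=> t0; exact: (orbit0_disk_opp EF t0). Qed.
Let nc01 : nc (0 : C) < 1. Proof. by rewrite nc0. Qed.

Lemma standard_chain_comp s t z : 0 <= s -> s <= t -> nc z < 1 -> F t (phi s t z) = F s z.
Proof.
move=> s0 st z1; rewrite /F -(centered_map_mobius EF)//.
by apply: (chain_comp NE fP) => //; apply: mobius_disk => //; exact: aD.
Qed.

Lemma standard_chain_diff t z : 0 <= t -> nc z < 1 -> cdiff (F t) z.
Proof.
move=> t0 z1; apply: cdiff_comp; first by apply: cdiff_mobius => //; exact: aD.
by apply: (chain_diff NE fP) => //; apply: mobius_disk => //; exact: aD.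
Qed.

Lemma standard_chain_inj t z w : 0 <= t -> nc z < 1 -> nc w < 1 -> F t z = F t w -> z = w.
Proof.
move=> t0 z1 w1 E; have at1 := aD t0.
rewrite -(mobiusK at1 z1) -(mobiusK at1 w1).
by rewrite (chain_inj NE fP t0 (mobius_disk at1 z1) (mobius_disk at1 w1) E).
Qed.

Lemma standard_chain0 z : F 0 z = f 0 z.
Proof. by rewrite /F (orbit00 EF) mobius0z. Qed.

Lemma standard_chain_deriv : cder (F 0) 0 1.
Proof.
apply: eq_cder (chain_deriv0 NE fP).
by exists 1 => // z _; rewrite standard_chain0.
Qed.

(** F s z - F t z = F t (phi s t z) - F t z. On compact sets F t is Lipschitz uniformly in t <= T,
    because L t >= L T, and the displacement of phi s t is controlled at 0 and 1/2. *)
Lemma standard_chain_lip T r : 0 < T -> 0 <= r < 1 -> exists2 A : R, 0 <= A &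
  forall s t z, 0 <= s -> s <= t -> t <= T -> nc z <= r ->
  nc (F s z - F t z) <= A * (nc (phi s t 0 - 0) + nc (phi s t (1 / 2) - 1 / 2)).
Proof.
move=> T0 rI; have /andP[r0 r1] := rI.
have [rho rhoI Ha] := orbit0_bounded EF (ltW T0); have /andP[rho0 rho1] := rhoI.
pose r3 := mobius_radius rho r; pose r4 := (1 + r3) / 2.
have r3I := mobius_radius_lt1 rhoI rI; have /andP[r30 r31] := r3I.
have r41 : r4 < 1 by rewrite /r4 /r3; lra.
have r34 : r3 < r4 by rewrite /r4 /r3; lra.
have r40 : 0 <= r4 by rewrite /r4 /r3; lra.
have LT := L_gt0 NE (ltW T0).
set LamT := nc (centered_deriv phi 0 T) in LT.
pose M := growth_fun r4 / LamT.
have G0 : 0 <= growth_fun r4 by apply: le_trans (growth_fun_ge r40 r41).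
have M0 : 0 <= M by rewrite divr_ge0// ltW.
pose B := 2 * M / (r4 - r3).
have r34' : 0 <= r4 - r3 by rewrite subr_ge0 ltW.
have B0 : 0 <= B by rewrite divr_ge0// mulr_ge0.
have p0 : 0 < (1 - rho) ^+ 2 by rewrite exprn_gt0// subr_gt0.
have c0 := deviation_const_ge0 rI.
exists (B * (deviation_const r / (1 - rho) ^+ 2)); first by rewrite mulr_ge0// divr_ge0// ltW.
move=> s t z s0 st tT zr; have t0 : 0 <= t by lra.
have z1 : nc z < 1 by lra.
have as1 : nc (a s) <= rho by apply: Ha => //; lra.
have at1 := Ha _ t0 tT.
rewrite -(standard_chain_comp s0 st z1) /F -(centered_map_mobius EF)//.
have u3 : nc (centered_map phi s t (mobius (a s) z)) <= r3.
  rewrite (le_trans (psi_schwarz NE s0 st _))//; last exact: mobius_le.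
  by apply: mobius_disk => //; exact: aD.
have v3 : nc (mobius (a t) z) <= r3 by exact: mobius_le.
have fM u : nc u = r4 -> nc (f t u) <= M.
  move=> ur; have u1 : nc u < 1 by lra.
  have Lt := L_gt0 NE t0.
  have := chain_bound NE fP t0 u1; rewrite ur => /le_trans; apply.
  apply: (ler_wpM2l G0); rewrite lef_pV2; [|exact: Lt|exact: LT].
  exact: (L_mono NE t0 tT).
have df u : nc u <= r4 -> cdiff (f t) u.
  by move=> ur; apply: (chain_diff NE fP) => //; lra.
apply: (le_trans (lip_bound df fM M0 r34 u3 v3)).
rewrite -/B -mulrA ler_wpM2l// (centered_map_mobius EF)//.
apply: (le_trans (mobius_lip rho1 at1 (evol_self EF s0 st z1) z1)).
rewrite [leRHS]mulrAC; apply: ler_wpM2r; first by rewrite invr_ge0 ltW.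
exact: (evol_near_id EF s0 st rI zr).
Qed.

Lemma standard_chain_loewner : @loewner_chain R F.
Proof.
(* Order one, with the bound A (k0 + k1) built from the integrable bounds at 0 and 1/2. *)
exists 1%E; split=> //; split; last split.
- move=> t t0; split.
    by move=> z z1; apply/derivable_cdiff; exact: standard_chain_diff.
  by move=> z w z1 w1; exact: standard_chain_inj.
- move=> s t s0 st _ [z z1 <-]; exists (phi s t z).
    by apply: (evol_self EF) => //; exact: ltW.
  by apply: standard_chain_comp => //; exact: ltW.
- move=> K T cK KD T0.
  have [r rI Kr] := compact_disk cK KD.
  have half1 : nc (1 / 2 : C) < 1 by rewrite half_disk; lra.
  have [k0 [k0_ge ik0 Hk0]] := evol_integral EF nc01 T0.
  have [k1 [k1_ge ik1 Hk1]] := evol_integral EF half1 T0.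
  have [A A0 HA] := standard_chain_lip T0 rI.
  have ik : (@lebesgue_measure R).-integrable `[0, T] (EFin \o (fun x => k0 x + k1 x)).
    have := integrableD _ ik0 ik1; apply => //.
  have iAk : (@lebesgue_measure R).-integrable `[0, T] (EFin \o (fun x => A * (k0 x + k1 x))).
    have := @integrableZl _ _ _ (@lebesgue_measure R) `[0, T]%classic _ A _ ik; apply => //.
  exists (fun x => A * (k0 x + k1 x)); split; last split.
  + by move=> x xT; rewrite mulr_ge0// addr_ge0 ?k0_ge ?k1_ge.
  + exact: integrable_Ld1.
  + move=> s t z s0 st tT /Kr zr.
    rewrite (int_onZ A s0 tT ik) (int_onD s0 tT ik0 ik1).
    apply: (le_trans (HA _ _ _ s0 st tT zr)); rewrite ler_wpM2l// lerD//.
      exact: Hk0.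
    exact: Hk1.
Qed.

Lemma standard_chain_nlc : @nlc_assoc R phi F.
Proof.
split; first exact: standard_chain_loewner.
split; last by move=> s t z; exact: standard_chain_comp.
split; first by rewrite standard_chain0 (chain0 NE fP).
by have [_ ->] := cder_derive standard_chain_deriv.
Qed.

Let beta_ge0 : 0 <= beta := beta_ge0 NE.

(** The form beta |w| < 1 treats the plane and the disk of radius 1 / beta alike. *)
Lemma range_diskE (w : C) : (@range_disk R beta) w <-> beta * nc w < 1.
Proof.
rewrite /range_disk; case: eqP => [->|/eqP b0]; first by rewrite mul0r ltr01.
have bp : 0 < beta by rewrite lt_def b0.
by rewrite /= -[beta^-1]mulr1 ltr_pdivlMl.
Qed.

Lemma standard_chain_range t z : 0 <= t -> nc z < 1 -> beta * nc (F t z) < 1.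
Proof.
move=> t0 z1; have Tz := mobius_disk (aD t0) z1.
exact: le_lt_trans (chain_disk NE fP t0 Tz) Tz.
Qed.

Lemma standard_chain_surj w : beta * nc w < 1 ->
  exists t z, [/\ 0 <= t, nc z < 1 & F t z = w].
Proof.
move=> bw; have [S [rho [S0 rho0 rho1 H]]] := chain_cover NE fP (nc_ge0 w) bw.
have [z zr zw] := H w (lexx _); have z1 : nc z < 1 by lra.
exists S, (mobius (- a S) z); split=> //; first by apply: mobius_disk => //; exact: naD.
by rewrite /F mobiusKV// aD.
Qed.

Lemma standard_chain_standard : @standard R beta phi F.
Proof.
split; first exact: standard_chain_nlc.
apply/seteqP; split=> w.
  by move=> [t t0 [z z1 <-]]; apply/range_diskE; exact: standard_chain_range.
move=> /range_diskE /standard_chain_surj [t [z [t0 z1 <-]]].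
by exists t => //; exists z.
Qed.

(** Composition with [mobius (- a t)] turns g into a univalent chain of the centred family, to which
    [chain_factor] applies; the two normalisations at time 0 then fix h and its derivative at 0. *)
Lemma nlc_factor (g : R -> C -> C) : @nlc_assoc R phi g -> exists h : C -> C,
  [/\ forall t z, 0 <= t -> nc z < 1 -> g t z = h (F t z),
      forall w, beta * nc w < 1 -> cdiff h w,
      forall w w', beta * nc w < 1 -> beta * nc w' < 1 -> h w = h w' -> w = w',
      h 0 = 0 & cder h 0 1].
Proof.
move=> [[d' [_ [gU _]]] [[g0 gd] gA]].
pose G t w := g t (mobius (- a t) w).
have nT t w : 0 <= t -> nc w < 1 -> nc (mobius (- a t) w) < 1.
  by move=> t0 w1; apply: mobius_disk => //; exact: naD.
have GU : univalent_chain (centered_map phi) G.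
  split.
  - move=> t z t0 z1; apply: cdiff_comp; first by apply: cdiff_mobius => //; exact: naD.
    by apply/derivable_cdiff; have [gh _] := gU t t0; exact: gh (nT _ _ t0 z1).
  - move=> t z w t0 z1 w1 E; have at1 := aD t0.
    rewrite -(mobiusKV at1 z1) -(mobiusKV at1 w1); congr (mobius _ _).
    by have [_ gi] := gU t t0; apply: gi => //; exact: nT.
  - move=> s t z s0 st z1; rewrite /G (mobius_centered_map EF)//.
    by apply: gA => //; exact: nT.
have [h [gh hd hi _]] := chain_factor NE fP GU.
have gF t z : 0 <= t -> nc z < 1 -> g t z = h (F t z).
  move=> t0 z1; rewrite -gh//; last by apply: mobius_disk => //; exact: aD.
  by rewrite /G mobiusK// aD.
have F00 : F 0 0 = 0 by rewrite standard_chain0 (chain0 NE fP).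
have b0 : beta * nc (0 : C) < 1 by rewrite nc0 mulr0 ltr01.
exists h; split=> //; first by have := gF 0 0 (lexx _) nc01; rewrite F00 g0 => <-.
have [l hl] := hd _ b0; suff <- : l = 1 by [].
have : cder (g 0) 0 (l * 1).
  apply: (@eq_cder _ (fun z => h (F 0 z))).
    by exists 1 => // z; rewrite subr0 => z1; rewrite gF.
  by apply: cder_comp; [exact: standard_chain_deriv|rewrite F00].
rewrite mulr1 => gl; apply: (cder_unique gl); rewrite -gd.
apply: derivable_cder; have [gh0 _] := gU 0 (lexx _); exact: gh0 nc01.
Qed.

Lemma nlc_unique0 (g : R -> C -> C) : beta = 0 -> @nlc_assoc R phi g -> @eq_chain R g F.
Proof.
move=> b0 /nlc_factor [h [gF hd hi h0 h1]] t z t0 z1.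
rewrite gF//; apply: entire_injective_id => //.
- by move=> w; apply: hd; rewrite b0 mul0r ltr01.
- by move=> w w'; apply: hi; rewrite b0 mul0r ltr01.
Qed.

Lemma scale_cder (h : C -> C) (l : C) : l != 0 -> cder h 0 1 -> cder (fun z => l * h (z / l)) 0 1.
Proof.
move=> l0 h1.
have -> : (1 : C) = 0 * h (0 / l) + l * (1 * (1 * l^-1 + 0 * 0)).
  by rewrite !mul0r addr0 add0r !mul1r mulfV.
apply: (@cderM _ (fun=> l) (fun z => h (z / l))); first exact: cder_cst.
apply: (@cder_comp _ (fun z => z / l)); last by rewrite mul0r.
by apply: cderM; [exact: cder_id|exact: cder_cst].
Qed.

Lemma scale_cdiff (h : C -> C) (l z : C) : cdiff h (z / l) -> cdiff (fun z => l * h (z / l)) z.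
Proof.
move=> hz; apply: cdiffM; first exact: cdiff_cst.
apply: (@cdiff_comp _ (fun z => z / l)) => //.
by apply: cdiffM; [exact: cdiff_id|exact: cdiff_cst].
Qed.

Lemma standard_unique (g : R -> C -> C) : @standard R beta phi g -> @eq_chain R g F.
Proof.
move=> [gN grange].
have [b0|bp] : beta = 0 \/ 0 < beta.
  by move: beta_ge0; rewrite le_eqVlt => /orP[/eqP <-|]; [left|right].
  exact: nlc_unique0.
have [h [gF hd hi h0 h1]] := nlc_factor gN.
have bC : (beta%:C%C : C) != 0 by rewrite -nc_gt0 nc_real gtr0_norm.
have nb (z : C) : beta * nc (z / beta%:C%C) = nc z.
  by rewrite ncM ncV nc_real gtr0_norm// mulrC divfK// gt_eqF.
(* Each w is some F t z, and h w = g t z lies in the range of g, which is the same disk; after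
   rescaling, Schwarz's lemma applies. *)
have hbound w : beta * nc w < 1 -> beta * nc (h w) < 1.
  move=> /standard_chain_surj [t [z [t0 z1 <-]]]; rewrite -gF//.
  by apply/range_diskE; rewrite -grange; exists t => //; exists z.
have hid z : nc z < 1 -> beta%:C%C * h (z / beta%:C%C) = z.
  apply: (@schwarz_rigid _ (fun z => beta%:C%C * h (z / beta%:C%C))).
  - by move=> w w1; apply: scale_cdiff; apply: hd; rewrite nb.
  - by rewrite mul0r h0 mulr0.
  - move=> w w1; rewrite ncM nc_real gtr0_norm//.
    by apply/ltW/hbound; rewrite nb.
  - exact: scale_cder.
move=> t z t0 z1; rewrite gF//; have bF := standard_chain_range t0 z1.
apply: (mulfI bC); have := hid (beta%:C%C * F t z).
rewrite [_ * _ / _]mulrAC divff// mul1r; apply.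
by rewrite ncM nc_real gtr0_norm.
Qed.

End StandardChain.

Theorem theorem3p6 (R : realType) (d : \bar R)
    (phi : R -> R -> (R[i])^o -> (R[i])^o) (beta : R) :
  evolution_family d phi ->
  beta_ratio phi @ +oo --> beta ->
  (* (1) existence and uniqueness of the standard Loewner chain *)
  ((exists f, standard beta phi f /\
      forall g, standard beta phi g -> eq_chain g f) /\
  (* (2) beta = 0: unique normalized associated Loewner chain, the standard one *)
   (beta = 0 ->
      (exists f, nlc_assoc phi f /\ forall g, nlc_assoc phi g -> eq_chain g f) /\
      (forall g, nlc_assoc phi g -> standard beta phi g)) /\
  (* (3) beta > 0: every normalized associated chain is h(beta f_t)/beta *)
   (0 < beta -> forall f g, standard beta phi f -> nlc_assoc phi g ->
      exists h, class_S h /\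
        forall t z, 0 <= t -> disk z ->
          g t z = h ((beta%:C)%C * f t z) / (beta%:C)%C)).
Proof.
move=> EF phi_beta; have NE := centered_map_normalized EF phi_beta.
have [f fP] := chain_exists NE.
pose F := standard_chain phi f.
have FS : standard beta phi F by exact: standard_chain_standard EF phi_beta f fP.
have Funiq g : standard beta phi g -> eq_chain g F.
  by move=> gS; exact: (standard_unique EF phi_beta fP gS).
split; first by exists F.
split=> [b0|bp f' g f'S gN].
  have uniq0 g : nlc_assoc phi g -> eq_chain g F.
    by move=> gN; exact: (nlc_unique0 EF phi_beta fP b0 gN).
  split; first by exists F; split => //; exact: FS.1.
  move=> g gN; split=> //; rewrite -FS.2; apply/seteqP.
  by split=> _ [t t0 [z z1 <-]]; exists t => //; exists z => //; rewrite uniq0.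
have [h [gF hd hi h0 h1]] := nlc_factor EF phi_beta fP gN.
have bC : (beta%:C%C : R[i]) != 0 by rewrite -nc_gt0 nc_real gtr0_norm.
have nb (z : R[i]) : beta * nc (z / beta%:C%C) = nc z.
  by rewrite ncM ncV nc_real gtr0_norm// mulrC divfK// gt_eqF.
(* Rescaled from the disk of radius 1 / beta to the unit disk; the derivative at 0 is unchanged. *)
exists (fun z => beta%:C%C * h (z / beta%:C%C)); split; last first.
  move=> t z t0 z1; rewrite (Funiq _ f'S t z t0 z1) (gF t z t0 z1).
  have E (u : R[i]) : beta%:C%C * u / beta%:C%C = u by rewrite mulrAC divff// mul1r.
  by rewrite [RHS]E; congr h; rewrite [RHS]E.
split; first split.
- move=> z z1; apply/derivable_cdiff; apply: scale_cdiff; apply: hd.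
  by rewrite nb.
- move=> z w z1 w1 /(mulfI bC) /hi; rewrite !nb => /(_ z1 w1).
  by move=> /(mulIf (invr_neq0 bC)).
- split; first by rewrite mul0r h0 mulr0.
  by have [_ ->] := cder_derive (scale_cder bC h1).
Qed.
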